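(* Fix a real number $\alpha\ge \frac12$ and positive integers $n,k$ with $n>1$. Let $\Omega$ be a nonempty open subset of $\mathbb{R}^n$. Let $J^k(\mathbb{R})$ be the model filiform Carnot group of topological dimension $k+2$, equipped with either coordinates of the first kind or coordinates of the second kind with respect to the basis $(e^{(k)},e_k,\ldots,e_0)$ of its Lie algebra (so that its underlying set is $\mathbb{R}^{k+2}$) and with its Carnot–Carathéodory metric. Then there is no injective mapping in the class $C^{0,\alpha+}(\Omega;J^k(\mathbb{R}))$ that is also locally Lipschitz when considered as a map into Euclidean space $\mathbb{R}^{k+2}$.
   Context: **Carnot groups.** A Carnot group $G$ is a connected, simply connected, nilpotent Lie group whose Lie algebra has a fixed stratification $\mathfrak g=\mathfrak g_1\oplus\cdots\oplus\mathfrak g_r$, with $\mathfrak g_{j+1}=[\mathfrak g_1,\mathfrak g_j]$ for $1\le j\le r-1$ and $[\mathfrak g,\mathfrak g_r]=0$; $r$ is its step and $\mathfrak g_1$ its horizontal layer. **The group $J^k(\mathbb{R})$.** Its Lie algebra has basis $e^{(k)},e_k,\ldots,e_0$ with $[e_j,e^{(k)}]=e_{j-1}$ for $1\le j\le k$ as the only nontrivial bracket relations (up to antisymmetry). The stratification is $\mathfrak g_1=\mathrm{span}\{e^{(k)},e_k\}$ and $\mathfrak g_{i}=\mathrm{span}\{e_{k+1-i}\}$ for $2\le i\le k+1$ (step $k+1$). **Coordinates.** Identify the Lie algebra $\mathfrak g$ with $\mathbb{R}^{k+2}$ by coordinates $(x,u_k,\ldots,u_0)$ in the basis $(e^{(k)},e_k,\ldots,e_0)$.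 Coordinates of the first kind: the group law on $\mathbb{R}^{k+2}$ is $X\star Y=\exp^{-1}(\exp(X)\exp(Y))$ (the Baker–Campbell–Hausdorff product). Coordinates of the second kind: the group law is $X\odot Y=\Phi^{-1}(\Phi(X)\Phi(Y))$, where $\Phi(xe^{(k)}+u_ke_k+\cdots+u_0e_0)=\exp(xe^{(k)})\exp(u_ke_k)\cdots\exp(u_0e_0)$; explicitly $(x,u_k,\ldots,u_0)\odot(y,v_k,\ldots,v_0)=(z,w_k,\ldots,w_0)$ with $z=x+y$, $w_k=u_k+v_k$, and $w_s=u_s+v_s+\sum_{j=s+1}^k u_j\frac{y^{j-s}}{(j-s)!}$ for $0\le s\le k-1$. **Carnot–Carathéodory metric.** Let $X^1,X^2$ be the left-invariant vector fields on the group that agree at $0$ with the first two coordinate vectors (corresponding to $e^{(k)},e_k$). The horizontal space at $p$ is $H_p=\mathrm{span}\{X^1_p,X^2_p\}$, with inner product making $X^1_p,X^2_p$ orthonormal. A path $\gamma:[a,b]\to\mathbb{R}^{k+2}$ is horizontal if it is absolutely continuous (Euclidean sense) and $\gamma'(t)\in H_{\gamma(t)}$ for a.e. $t$; its length is $\int_a^b|\gamma'(t)|\,dt$ with respect to this inner product. The Carnot–Carathéodory distance $d_{cc}(p,q)$ is the infimum of lengths of horizontal paths from $p$ to $q$. **The class $C^{0,\alpha+}$.** For metric spaces $X,Y$ and $\alpha>0$, a map $f:X\to Y$ is of class $C^{0,\alpha+}(X;Y)$ if there is a homeomorphism $\beta:[0,\infty)\to[0,\infty)$ with $d_Y(f(a),f(b))\le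 d_X(a,b)^\alpha\,\beta(d_X(a,b))$ for all $a,b\in X$. Here $\Omega$ carries the Euclidean metric and $J^k(\mathbb{R})$ carries $d_{cc}$. *)

(* Defs.v *)
From HB Require Import structures.
From mathcomp Require Import all_boot all_order all_algebra.
From mathcomp Require Import all_classical all_reals all_analysis.
From mathcomp Require Import ring.
Set Implicit Arguments. Unset Strict Implicit. Unset Printing Implicit Defensive.
Import Order.TTheory GRing.Theory Num.Theory.
Import numFieldNormedType.Exports.
Local Open Scope classical_set_scope.
Local Open Scope ring_scope.

(* The library's norm on 'rV[R]_n is the sup norm. *)
Definition eucl_norm (R : realType) (n : nat) (v : 'rV[R]_n) : R :=
  Num.sqrt (\sum_(i < n) v 0 i ^+ 2).

Definition eucl_dist (R : realType) (n : nat) (a b : 'rV[R]_n) : R :=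
  eucl_norm (a - b).

(* The exponential of strictly triangular N.+1 x N.+1 matrices: the terms of
   degree > N of the exponential series vanish. *)
Definition nilp_exp (R : realType) (N : nat) (A : 'M[R]_N.+1) : 'M[R]_N.+1 :=
  \sum_(m < N.+1) m`!%:R^-1 *: A ^+ m.

(* The Lie algebra of J^k(R), as a Lie algebra of strictly upper triangular
   matrices under A *m B - B *m A. The basis (e^(k), e_k, ..., e_0) is numbered
   0, 1, ..., k+1, so that e_j has number k + 1 - j. See jk_bracket0 and
   jk_bracketS for the bracket relations. *)
Definition jk_basis (R : realType) (k : nat) (i : 'I_k.+2) : 'M[R]_k.+2 :=
  if i == 0 then \matrix_(a, b) ((0 < a) && (b == a.+1 :> nat))%N%:R
  else delta_mx 0 i.

Inductive coord_kind := FirstKind | SecondKind.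

(* The charts from R^(k+2), with coordinates (x, u_k, ..., u_0), onto the
   connected, simply connected group of unitriangular matrices which is the
   image under nilp_exp of the Lie algebra above. In the product, the factors
   are ordered as exp(x e^(k)) exp(u_k e_k) ... exp(u_0 e_0). *)
Definition jk_chart (R : realType) (k : nat) (c : coord_kind)
    (X : 'rV[R]_k.+2) : 'M[R]_k.+2 :=
  match c with
  | FirstKind => nilp_exp (\sum_(i < k.+2) X 0 i *: jk_basis R i)
  | SecondKind => \prod_(i < k.+2) nilp_exp (X 0 i *: jk_basis R i)
  end.

(* The group law in coordinates: chart^-1 (chart X * chart Y). For 0 < k the Z
   below exists and is unique, by jk_chart_inj and jk_chart_mul; jk_mul_second0 and
   jk_mul_secondS give the law of the second kind explicitly. *)
Definition jk_mul (R : realType) (k : nat) (c : coord_kind)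
    (X Y : 'rV[R]_k.+2) : 'rV[R]_k.+2 :=
  xget 0 [set Z | jk_chart c Z = jk_chart c X * jk_chart c Y].

(* The left-invariant vector field equal to the i-th coordinate vector at 0:
   the differential at 0 of the left translation by p. *)
Definition left_field (R : realType) (k : nat) (c : coord_kind) (i : 'I_k.+2)
    (p : 'rV[R]_k.+2) : 'rV[R]_k.+2 :=
  'D_(delta_mx 0 i) (jk_mul c p) 0.

Definition hcomb (R : realType) (k : nat) (c : coord_kind)
    (p : 'rV[R]_k.+2) (s : R * R) : 'rV[R]_k.+2 :=
  s.1 *: left_field c 0 p + s.2 *: left_field c 1 p.

Definition hspace (R : realType) (k : nat) (c : coord_kind)
    (p : 'rV[R]_k.+2) : set 'rV[R]_k.+2 :=
  range (hcomb c p).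

(* The norm on hspace c p for which the two left-invariant fields are
   orthonormal; its value outside hspace c p is irrelevant. *)
Definition hnorm (R : realType) (k : nat) (c : coord_kind)
    (p v : 'rV[R]_k.+2) : R :=
  let s := xget (0, 0) [set s | hcomb c p s = v] in
  Num.sqrt (s.1 ^+ 2 + s.2 ^+ 2).

Definition abs_continuous (R : realType) (n : nat) (a b : R)
    (g : R -> 'rV[R]_n) : Prop :=
  forall eps : R, 0 < eps -> exists2 delta : R, 0 < delta &
    forall (m : nat) (l r : 'I_m -> R),
      (forall i, a <= l i /\ l i <= r i /\ r i <= b) ->
      trivIset setT (fun i => `]l i, r i[%classic) ->
      \sum_(i < m) (r i - l i) < delta ->
      \sum_(i < m) eucl_dist (g (r i)) (g (l i)) < eps.

Definition horizontal_path (R : realType) (k : nat) (c : coord_kind)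
    (a b : R) (g : R -> 'rV[R]_k.+2) : Prop :=
  abs_continuous a b g /\
  {ae (@lebesgue_measure R), forall t, t \in `[a, b] ->
     derivable g t 1 /\ hspace c (g t) (g^`()%classic t)}.

Definition path_length (R : realType) (k : nat) (c : coord_kind)
    (a b : R) (g : R -> 'rV[R]_k.+2) : \bar R :=
  (\int[@lebesgue_measure R]_(t in `[a, b]) (hnorm c (g t) (g^`()%classic t))%:E)%E.

Definition d_cc (R : realType) (k : nat) (c : coord_kind)
    (p q : 'rV[R]_k.+2) : \bar R :=
  ereal_inf [set L | exists a b : R, exists g : R -> 'rV[R]_k.+2,
    [/\ a <= b, horizontal_path c a b g, g a = p, g b = q
      & L = path_length c a b g]].

Definition homeo_halfline (R : realType) (beta : R -> R) : Prop :=
  let H : set R := `[0, +oo[%classic in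
  exists gamma : R -> R,
    [/\ set_fun H H beta, set_fun H H gamma,
        {in H, cancel beta gamma} /\ {in H, cancel gamma beta},
        {within H, continuous beta} & {within H, continuous gamma}].

(* The class C^{0,alpha+}(A; Y), the distance on Y being allowed to take its
   values in the extended reals. *)
Definition holder_plus (R : realType) (S T : Type) (dS : S -> S -> R)
    (dT : T -> T -> \bar R) (alpha : R) (A : set S) (f : S -> T) : Prop :=
  exists2 beta : R -> R, homeo_halfline beta &
    forall a b, A a -> A b ->
      (dT (f a) (f b) <= (dS a b `^ alpha * beta (dS a b))%:E)%E.

Definition locally_lipschitz (R : realType) (n m : nat) (A : set 'rV[R]_n)
    (f : 'rV[R]_n -> 'rV[R]_m) : Prop :=
  forall p, A p -> exists2 U : set 'rV[R]_n, nbhs p U & exists L : R,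
    forall a b, A a -> A b -> U a -> U b ->
      eucl_dist (f a) (f b) <= L * eucl_dist a b.

Section ChartFacts.
Variables (R : realType) (k : nat).
Local Notation n := k.+2.
Local Notation N := (@jk_basis R k 0).
Implicit Types (X Y : 'rV[R]_n) (x y : R).

Lemma jk_basis0_delta m (v : 'M[R]_(1, m)) : N *m (delta_mx 0 0 *m v) = 0.
Proof.
rewrite mulmxA (_ : N *m _ = 0) ?mul0mx//; apply/matrixP => a b.
rewrite !mxE big1// => c _; rewrite /jk_basis eqxx !mxE.
by case: (c =P 0) => [->|]; rewrite ?andbF ?mul0r ?mulr0.
Qed.

Lemma jk_bracket0 (i : 'I_n) : i != 0 ->
  jk_basis R i *m N - N *m jk_basis R i =
  if (i < k.+1)%N then jk_basis R (inord i.+1) else 0.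
Proof.
move=> i0; have bi : jk_basis R i = delta_mx 0 i by rewrite /jk_basis (negbTE i0).
have -> : N *m jk_basis R i = 0.
  by rewrite bi -(mul_delta_mx (0 : 'I_1)) jk_basis0_delta.
rewrite subr0 bi; apply/matrixP => a b; rewrite !mxE (bigD1 i)//= big1 => [|c ci].
  rewrite /jk_basis eqxx !mxE eqxx andbT addr0.
  have i0' : (0 < i)%N by rewrite lt0n.
  rewrite i0' /=; case: ltnP => ik; last first.
    have /negbTE -> : b != i.+1 :> nat.
      by rewrite neq_ltn (leq_trans (ltn_ord b)).
    by rewrite mulr0 mxE.
  have -> : (inord i.+1 == 0 :> 'I_n) = false.
    by apply/negbTE/eqP => /(congr1 val); rewrite /= inordK.
  rewrite mxE (_ : (b == _ :> 'I_n) = (b == i.+1 :> nat)); last first.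
    by rewrite -(inj_eq val_inj)/= inordK.
  by rewrite -natrM mulnb.
by rewrite !mxE (negbTE ci) andbF mul0r.
Qed.

Lemma jk_bracketS (i j : 'I_n) : i != 0 -> j != 0 ->
  jk_basis R i *m jk_basis R j - jk_basis R j *m jk_basis R i = 0.
Proof.
move=> i0 j0; rewrite /jk_basis (negbTE i0) (negbTE j0).
by rewrite !mul_delta_mx_0// subrr.
Qed.

Lemma jk_basisX m (a b : 'I_n) :
  (N ^+ m) a b = (((m == 0%N) || (0 < a)%N) && (b == (a + m)%N :> nat))%:R.
Proof.
elim: m a b => [|m IH] a b.
  by rewrite expr0 mxE addn0 eq_sym.
rewrite exprS -mulmxE mxE.
have [am|am] := boolP ((0 < a) && (a.+1 < n))%N; last first.
  rewrite big1 => [|c _].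
    case: a am => -[|a] //= an; rewrite -leqNgt => am.
    have /negbTE -> // : b != (a.+1 + m.+1)%N :> nat.
    by rewrite neq_ltn (leq_trans (ltn_ord b))// (leq_trans am)// addnS ltnS leq_addr.
  rewrite /jk_basis eqxx mxE; have [/andP[a0 /eqP ca]|_] := boolP (_ && _).
    by rewrite a0 -ca ltn_ord in am.
  by rewrite mul0r.
have /andP[a0 am1] := am.
rewrite (bigD1 (Ordinal am1))//= big1 => [|c ca].
  by rewrite IH /jk_basis eqxx mxE a0 eqxx mul1r orbT /= addr0 addSn addnS.
rewrite /jk_basis eqxx mxE -(inj_eq val_inj)/= in ca *.
by rewrite (negbTE ca) andbF mul0r.
Qed.

Lemma jk_basis_expE x (a b : 'I_n) : nilp_exp (x *: N) a b =
  if a == 0 then (b == 0)%:R else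
  if (a <= b)%N then x ^+ (b - a) / (b - a)`!%:R else 0.
Proof.
rewrite /nilp_exp summxE.
under eq_bigr => m _ do rewrite exprZn !mxE jk_basisX.
case: (eqVneq a 0) => [->|a0].
  rewrite big_ord_recl big1 => [|m _]; last by rewrite /= !mulr0.
  by rewrite /= addr0 invr1 !mul1r.
have a0' : (0 < a)%N by rewrite lt0n.
rewrite a0'; under eq_bigr do rewrite orbT /=.
case: leqP => ab; last first.
  rewrite big1// => m _; have /negbTE -> : b != (a + m)%N :> nat.
    by rewrite neq_ltn (leq_trans ab)// leq_addr.
  by rewrite !mulr0.
have bn : (b - a < n)%N by rewrite (leq_ltn_trans (leq_subr _ _)).
rewrite (bigD1 (Ordinal bn))//= big1 => [|m mb].
  by rewrite subnKC// eqxx mulr1 addr0 mulrC.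
have /negbTE -> : b != (a + m)%N :> nat.
  by apply: contraNN mb => /eqP bE; apply/eqP/val_inj; rewrite /= bE addKn.
by rewrite !mulr0.
Qed.

Lemma jk_basis_expD x y :
  nilp_exp (x *: N) *m nilp_exp (y *: N) = nilp_exp ((x + y) *: N).
Proof.
apply/matrixP => a b; rewrite mxE; under eq_bigr do rewrite !jk_basis_expE.
rewrite jk_basis_expE; case: (eqVneq a 0) => [_|a0].
  rewrite (bigD1 0)//= big1 => [|c c0]; last by rewrite (negbTE c0) mul0r.
  by rewrite mul1r addr0.
case: leqP => ab; last first.
  rewrite big1// => c _; case: leqP => ac; rewrite ?mul0r//.
  have /negbTE-> : c != 0 by apply: contraNneq a0 => c0; move: ac; rewrite c0 leqn0.
  by rewrite leqNgt (leq_trans ab)// mulr0.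
pose G (c : nat) := if (a <= c <= b)%N then
  x ^+ (c - a) / (c - a)`!%:R * (y ^+ (b - c) / (b - c)`!%:R) else 0.
rewrite (eq_bigr (fun c : 'I_n => G c)) => [|c _]; last first.
  rewrite /G; case: leqP => ac; rewrite ?mul0r//=.
  have /negbTE-> : c != 0 by apply: contraNneq a0 => c0; move: ac; rewrite c0 leqn0.
  by case: ifP; rewrite ?mulr0.
rewrite -(big_mkord xpredT G) (big_cat_nat (n:=a))//=; last exact: ltnW.
rewrite big_nat big1 ?add0r => [|c /andP[_ ca]]; last by rewrite /G leqNgt ca.
rewrite (big_cat_nat (n:=b.+1))//=; last exact: leqW.
rewrite addrC big_nat big1 ?add0r => [|c /andP[bc _]]; last first.
  by rewrite /G (leqNgt c) bc andbF.
rewrite -{1}(add0n (a : nat)) big_addn subSn// big_mkord exprDn mulr_suml.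
rewrite [RHS](reindex_inj rev_ord_inj)/=; apply: eq_bigr => i _.
have ib : (i <= b - a)%N by rewrite -ltnS.
have E1 : (b - (i + a) = b - a - i)%N by rewrite addnC subnDA.
have iab : (i + a <= b)%N by rewrite addnC -leq_subRL.
rewrite /G leq_addl iab addnK /=.
rewrite subSS subKn// E1 bin_sub// -[X in _ = X / _]mulr_natr.
have f0 m : m`!%:R != 0 :> R by rewrite pnatr_eq0 -lt0n fact_gt0.
have -> : 'C(b - a, i)%:R = (b - a)`!%:R / (i`!%:R * (b - a - i)`!%:R) :> R.
  by rewrite -(bin_fact ib) natrM natrM mulfK// mulf_neq0.
by field; rewrite !f0.
Qed.

Let e0 : 'cV[R]_n := delta_mx 0 0.
Let E x := nilp_exp (x *: N).
Let tail X : 'rV[R]_n := X - X 0 0 *: delta_mx 0 0.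

Lemma tail0 X : tail X 0 0 = 0.
Proof. by rewrite !mxE eqxx mulr1 subrr. Qed.

Lemma sum_tail X :
  \sum_(i < n | i != 0) X 0 i *: delta_mx 0 i = tail X.
Proof.
by apply/esym; rewrite /tail [X in X - _](row_sum_delta X) (bigD1 0)//= addrAC subrr add0r.
Qed.

Lemma jk_basisN0 i : i != 0 -> jk_basis R i = e0 *m delta_mx 0 i.
Proof. by move=> i0; rewrite /jk_basis (negbTE i0) mul_delta_mx. Qed.

Lemma mul_row_e0 (v w : 'rV[R]_n) : v 0 0 = 0 -> v *m (e0 *m w) = 0.
Proof.
move=> v0; rewrite mulmxA (_ : _ *m e0 = 0) ?mul0mx//; apply/matrixP => a b.
rewrite !ord1 !mxE (bigD1 0)//= big1 => [|c c0].
  by rewrite v0 mul0r addr0.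
by rewrite !mxE (negbTE c0) mulr0.
Qed.

Let U x : 'M[R]_n := \sum_(m < n) (m.+1)`!%:R^-1 *: (x *: N) ^+ m.

Lemma UE x (a b : 'I_n) : (b <= a)%N -> U x a b = (b == a)%:R.
Proof.
move=> ba; rewrite summxE big_ord_recl big1 => [|m _].
  by rewrite /= expr0 !mxE invr1 mul1r addr0 eq_sym.
have /ltn_eqF bam : (b < a + lift ord0 m)%N.
  by rewrite (leq_ltn_trans ba)// addnS ltnS leq_addr.
by rewrite exprZn !mxE jk_basisX bam andbF !mulr0.
Qed.

Lemma U_unit x : U x \in unitmx.
Proof.
rewrite unitmxE -det_tr det_trig; last first.
  apply/is_trig_mxP => i j ij; rewrite mxE UE ?(ltnW ij)//.
  by rewrite (_ : (i == j) = false)//; apply/negbTE; rewrite -(inj_eq val_inj) ltn_eqF.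
by rewrite big1 ?unitr1// => i _; rewrite mxE UE ?eqxx.
Qed.

Lemma chart1E X : jk_chart FirstKind X = E (X 0 0) + e0 *m (tail X *m U (X 0 0)).
Proof.
rewrite /jk_chart (bigD1 0)//=.
under eq_bigr => i i0 do rewrite jk_basisN0// scalemxAr.
rewrite -mulmx_sumr sum_tail /E /nilp_exp.
set x := X 0 0; set V := e0 *m tail X.
have NV : (x *: N) *m V = 0 by rewrite -scalemxAl jk_basis0_delta scaler0.
have VV : V *m V = 0 by rewrite /V -mulmxA mul_row_e0 ?tail0// mulmx0.
have VN : V *m (x *: N) ^+ k.+1 = 0.
  rewrite exprZn (_ : N ^+ k.+1 = 0) ?scaler0 ?mulmx0//; apply/matrixP => a b.
  rewrite jk_basisX mxE /=; case: posnP => //= a0.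
  by rewrite ltn_eqF// (leq_trans (ltn_ord b))// -[leqLHS]add1n leq_add2r.
have AE m : (x *: N + V) ^+ m.+1 = (x *: N) ^+ m.+1 + V *m (x *: N) ^+ m.
  elim: m => [|m IH]; first by rewrite !expr1 expr0 mulmx1.
  rewrite exprS IH mulrDl !mulrDr -exprS -!mulmxE.
  rewrite !(mulmxA _ V) NV VV !mul0mx !addr0.
  by [].
rewrite big_ord_recl /=.
under eq_bigr => i _ do rewrite AE scalerDr.
rewrite big_split/= addrA [X in _ = X + _]big_ord_recl/= mulmxA mulmx_sumr.
rewrite [X in _ = _ + X]big_ord_recr/= -scalemxAr VN scaler0 addr0.
by congr (_ + _); apply: eq_bigr => i _; rewrite -scalemxAr.
Qed.

Lemma chart2E X : jk_chart SecondKind X = E (X 0 0) + e0 *m tail X.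
Proof.
rewrite /jk_chart big_ord_recl /=.
have expE (v : 'rV[R]_n) : v 0 0 = 0 -> nilp_exp (e0 *m v) = 1 + e0 *m v.
  move=> v0; rewrite /nilp_exp !big_ord_recl big1 => [|m _].
    by rewrite /= !invr1 !scale1r expr0 expr1 addr0.
  have VV : (e0 *m v) * (e0 *m v) = 0 by rewrite -mulmxE -mulmxA mul_row_e0// mulmx0.
  by rewrite !lift0 !exprS mulrA VV mul0r scaler0.
have -> : \prod_(i < k.+1) nilp_exp (X 0 (lift 0 i) *: jk_basis R (lift 0 i)) =
    1 + e0 *m \sum_(i < k.+1) X 0 (lift 0 i) *: delta_mx 0 (lift 0 i).
  elim/big_rec2: _ => [|i w v _ ->]; first by rewrite mulmx0 addr0.
  rewrite jk_basisN0// scalemxAr expE; last by rewrite !mxE mulr0.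
  rewrite mulrDr mulr1 mulrDl mul1r mulmxDr -!mulmxE -mulmxA mul_row_e0 ?mulmx0 ?addr0 ?addrA//.
  by rewrite !mxE mulr0.
have -> : \sum_(i < k.+1) X 0 (lift 0 i) *: delta_mx 0 (lift 0 i) = tail X.
  by rewrite -(sum_tail X) [RHS]big_mkcond [RHS]big_ord_recl /= add0r.
set v := tail X; rewrite mulrDr mulr1; congr (_ + _).
rewrite /nilp_exp mulr_suml big_ord_recl big1 ?addr0 /= ?invr1 ?scale1r ?mul1r// => m _.
by rewrite /bump leq0n add1n exprSr -scalerAl -mulrA -mulmxE -scalemxAl jk_basis0_delta !scaler0 mulmx0 scaler0.
Qed.

Let T c x : 'M[R]_n := if c is FirstKind then U x else 1%:M.

Lemma chartE c X : jk_chart c X = E (X 0 0) + e0 *m (tail X *m T c (X 0 0)).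
Proof. by case: c; rewrite ?chart1E ?chart2E //= mulmx1. Qed.

Lemma T_unit c x : T c x \in unitmx.
Proof. by case: c; [exact: U_unit|exact: unitmx1]. Qed.

Lemma mulT0 c x (v : 'rV[R]_n) : (v *m T c x) 0 0 = v 0 0.
Proof.
case: c => /=; last by rewrite mulmx1.
rewrite mxE (bigD1 0)//= UE// eqxx mulr1 big1 ?addr0// => i i0.
by rewrite UE// eq_sym (negbTE i0) mulr0.
Qed.

Lemma e0_inj (v w : 'rV[R]_n) : e0 *m v = e0 *m w -> v = w.
Proof.
move=> vw; apply/rowP => j; move/matrixP/(_ 0 j): vw.
by rewrite !mxE !big_ord1 !mxE eqxx !mul1r.
Qed.

Lemma chart_E x (v : 'rV[R]_n) : (0 < k)%N -> (E x + e0 *m v) 1 (inord 2) = x.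
Proof.
move=> k0; rewrite mxE jk_basis_expE /= inordK//.
by rewrite expr1 divr1 mxE big1 ?addr0// => i _; rewrite !mxE mul0r.
Qed.

Lemma jk_chart_inj c : (0 < k)%N -> injective (@jk_chart R k c).
Proof.
move=> k0 X Y; rewrite !chartE => XY.
have x0 : X 0 0 = Y 0 0.
  by rewrite -(chart_E (X 0 0) (tail X *m T c (X 0 0)) k0) XY chart_E.
move: XY; rewrite x0 => /addrI/e0_inj/(can_inj (mulmxK (T_unit _ _))).
by rewrite /tail x0 => /addIr.
Qed.

Lemma chart_prod x y (w v : 'rV[R]_n) : w 0 0 = 0 ->
  (E x + e0 *m w) * (E y + e0 *m v) = E (x + y) + e0 *m (w *m E y + v).
Proof.
move=> w0; rewrite mulrDl !mulrDr -!mulmxE jk_basis_expD -!mulmxA mul_row_e0//.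
rewrite mulmx0 addr0 mulmxDr addrAC -addrA; congr (_ + (_ + _)).
rewrite mulmxA; congr (_ *m _); apply/matrixP => a b; rewrite mxE (bigD1 0)//=.
rewrite big1 => [|c c0]; last by rewrite !mxE (negbTE c0) mulr0.
rewrite addr0 jk_basis_expE !mxE eqxx ord1 /= mulr1 andbT.
by case: eqVneq => // a0; rewrite leqNgt lt0n a0.
Qed.

Lemma mulE0 y (w : 'rV[R]_n) : (w *m E y) 0 0 = w 0 0.
Proof.
rewrite mxE (bigD1 0)//= jk_basis_expE eqxx mulr1 big1 ?addr0// => i i0.
by rewrite jk_basis_expE (negbTE i0) leqNgt lt0n i0 mulr0.
Qed.

Lemma jk_chart_mul c X Y :
  jk_chart c (jk_mul c X Y) = jk_chart c X * jk_chart c Y.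
Proof.
rewrite /jk_mul; case: xgetP => [Z _ //|noZ]; exfalso.
pose x := X 0 0; pose y := Y 0 0.
pose w := tail X *m T c x; pose v := tail Y *m T c y.
pose u := (w *m E y + v) *m invmx (T c (x + y)).
have u0 : u 0 0 = 0.
  by rewrite -(mulT0 c (x + y)) /u mulmxKV ?T_unit// mxE mulE0 !mulT0 !tail0 addr0.
apply: (noZ (u + (x + y) *: delta_mx 0 0)); rewrite /= !chartE chart_prod ?mulT0 ?tail0//.
have -> : (u + (x + y) *: delta_mx 0 0) 0 0 = x + y.
  by rewrite mxE u0 !mxE eqxx mulr1 add0r.
congr (_ + _ *m _); rewrite [tail _](_ : _ = u).
  by rewrite /u mulmxKV ?T_unit.
by rewrite /tail mxE u0 !mxE eqxx mulr1 add0r addrK.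
Qed.

Lemma jk_mul_second0 X Y : (0 < k)%N -> jk_mul SecondKind X Y 0 0 = X 0 0 + Y 0 0.
Proof.
move=> k0; have := jk_chart_mul SecondKind X Y.
rewrite !chartE chart_prod ?mulT0 ?tail0// => /(congr1 (fun M : 'M[R]_n => M 1 (inord 2))).
by rewrite !chart_E.
Qed.

Lemma jk_mul_secondS X Y (j : 'I_n) : (0 < k)%N -> j != 0 ->
  jk_mul SecondKind X Y 0 j = X 0 j + Y 0 j +
    \sum_(i < n | (0 < i < j)%N) X 0 i * Y 0 0 ^+ (j - i) / (j - i)`!%:R.
Proof.
move=> k0 j0; have := jk_chart_mul SecondKind X Y.
rewrite !chartE chart_prod ?mulT0 ?tail0// /= !mulmx1 jk_mul_second0//.
move=> /addrI/e0_inj/rowP/(_ j).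
have tailj (W : 'rV[R]_n) i : i != 0 -> tail W 0 i = W 0 i.
  by move=> i0; rewrite !mxE (negbTE i0) mulr0 subr0.
rewrite tailj// => ->; rewrite mxE tailj// addrAC; congr (_ + _).
rewrite mxE (bigD1 0)//= tail0 mul0r add0r (bigD1 j)//= tailj//.
rewrite jk_basis_expE (negbTE j0) leqnn subnn expr0 divr1 mulr1; congr (_ + _).
rewrite [RHS]big_mkcond [LHS]big_mkcond; apply: eq_bigr => i _.
rewrite jk_basis_expE; case: (eqVneq i 0) => [->//|i0] /=.
rewrite lt0n i0 ltn_neqAle /= tailj//.
rewrite (_ : (i != j) = (i != j :> nat)) //.
by case: (_ != _) => //=; case: leqP; rewrite ?mulr0 ?mulrA.
Qed.
End ChartFacts.

(* Main.v *)
Require Import Defs.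
From mathcomp Require Import all_boot all_order all_algebra.
From mathcomp Require Import all_classical all_reals all_analysis.
From mathcomp Require Import measurable_realfun.
From mathcomp Require Import ring lra.
Set Implicit Arguments. Unset Strict Implicit. Unset Printing Implicit Defensive.
Import Order.TTheory GRing.Theory Num.Theory.
Import numFieldNormedType.Exports.
Local Open Scope classical_set_scope.
Local Open Scope ring_scope.

(** Write W_0, ..., W_(k+1) for the coordinates of the second kind, so that
    W_0 = x, W_1 = u_k, and so on down to u_0. Along a horizontal curve each
    W_(j+1) with j > 0 is a primitive of W_j with respect to W_0, as for the
    jet of a function. Hence two points p, q at distance less than r <= 1
    satisfy |W_(j+1)(q) - W_(j+1)(p) - W_j(p) (W_0(q) - W_0(p))| <= C r^2, with C
    uniform on bounded sets ([dcc_contact]). Let f be a map as in the theorem,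
    and w_j = W_j o f. As alpha >= 1/2, points at a small Euclidean distance t
    have images at distance o(sqrt t), so that the relations
    dw_(j+1) = w_j dw_0 hold for w_j, up to an error o(t) ([phi_contact]).

    Formally, dw_1 /\ dw_0 = d(dw_2) = 0 on a two-dimensional piece of the
    domain, so that w_1 is constant along the curves where w_0 is constant;
    by the other relations all the w_j are constant there, and f is not
    injective. The functions w_j are only Lipschitz, and a set of measure zero
    where they are not differentiable might contain these curves. The
    argument is therefore carried out at a finite scale.

    - Quantitative differentiation ([most_cells_slope_constant]): on some
      fine grid, w_0 and w_1 are nearly affine in most cells. In such a cell
      the increments of w_2 along the four edges are given by the trapezoid
      rule, and they add up to zero; so the slopes of w_0 and w_1 are nearly
      proportional ([affine_det_le]). In every such cell the oscillation of
      w_0, times that of w_1 along the level sets of w_0, is small compared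
      with the area of the cell ([cell_bound], [grid_bound]).
    - By averaging over the levels, some level c of w_0 is such that w_1 has a
      small total oscillation along w_0 = c, over all the cells which meet
      this level set ([level_selection]).
    - On a strip whose left side lies in w_0 <= c and whose right side lies in
      w_0 > c, a parity argument yields a sequence of adjacent cells, all
      meeting w_0 = c, from the bottom to the top ([door_path_bottom_top]).
      Along this sequence all the w_j change by little ([level_chain]).
    - By compactness a point of the bottom and a point of the top have the same
      image ([strip_collapse]).

    If w_0 is constant on a ball, then so are w_2, ..., w_(k+1), and w_1 takes
    the same value at two points by the intermediate value theorem
    ([strip_collapse_cst]). If w_1 is constant as well, f is constant. *)

(** * Interfaces in a labelled grid *)

Section Hex.
Local Open Scope nat_scope.
Variables (N : nat) (b : nat -> nat -> bool).

(** A door is an edge of the grid whose ends carry different labels. A cell is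
    named by its lower left corner, so that its doors are hdoor i j (bottom),
    hdoor i j.+1 (top), vdoor i j (left) and vdoor i.+1 j (right). *)
Definition hdoor i j := b i j (+) b i.+1 j.
Definition vdoor i j := b i j (+) b i j.+1.

Definition through_door : rel ('I_N * 'I_N) := fun q q' =>
  [|| [&& q.2 == q'.2, q'.1 == q.1.+1 :> nat & vdoor q'.1 q'.2],
      [&& q.2 == q'.2, q.1 == q'.1.+1 :> nat & vdoor q.1 q.2],
      [&& q.1 == q'.1, q'.2 == q.2.+1 :> nat & hdoor q'.1 q'.2] |
      [&& q.1 == q'.1, q.2 == q'.2.+1 :> nat & hdoor q.1 q.2]].

(* The cells which can be reached through doors from a door on the bottom side.
   Taking i and j in nat, with the value false off the grid, makes the parity
   sums telescope without boundary cases. *)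
Let C (i j : nat) := [exists q0 : 'I_N * 'I_N, [exists q : 'I_N * 'I_N,
  [&& q0.2 == 0 :> nat, hdoor q0.1 0, connect through_door q0 q, q.1 == i :> nat & q.2 == j :> nat]]].

Let CP i j : reflect (exists q0 q : 'I_N * 'I_N,
  [/\ q0.2 = 0 :> nat, hdoor q0.1 0, connect through_door q0 q, q.1 = i :> nat & q.2 = j :> nat]) (C i j).
Proof.
apply: (iffP existsP) => [[q0 /existsP[q /and5P[/eqP ? ? ? /eqP ? /eqP ?]]]|].
  by exists q0, q; split.
move=> [q0 [q [A1 A2 A3 A4 A5]]]; exists q0; apply/existsP; exists q.
by rewrite A1 A2 A3 A4 A5 !eqxx.
Qed.

Let C_vdoor i j : i.+1 < N -> C i j && vdoor i.+1 j = C i.+1 j && vdoor i.+1 j.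
Proof.
move=> iN; case vd: (vdoor i.+1 j); rewrite ?andbF// !andbT.
apply/idP/idP => /CP[q0 [q [A1 A2 A3 A4 A5]]]; apply/CP; exists q0.
  exists (Ordinal iN, q.2); split => //=; apply: connect_trans A3 _; apply: connect1.
  by apply/or4P; constructor 1; rewrite /= A4 A5 vd !eqxx.
exists (Ordinal (ltnW iN), q.2); split => //=; apply: connect_trans A3 _; apply: connect1.
by apply/or4P; constructor 2; rewrite /= A4 A5 vd !eqxx.
Qed.

Let C_hdoor i j : j.+1 < N -> C i j && hdoor i j.+1 = C i j.+1 && hdoor i j.+1.
Proof.
move=> jN; case vd: (hdoor i j.+1); rewrite ?andbF// !andbT.
apply/idP/idP => /CP[q0 [q [A1 A2 A3 A4 A5]]]; apply/CP; exists q0.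
  exists (q.1, Ordinal jN); split => //=; apply: connect_trans A3 _; apply: connect1.
  by apply/or4P; constructor 3; rewrite /= A4 A5 vd !eqxx.
exists (q.1, Ordinal (ltnW jN)); split => //=; apply: connect_trans A3 _; apply: connect1.
by apply/or4P; constructor 4; rewrite /= A4 A5 vd !eqxx.
Qed.

Let telescope_addb (W : nat -> bool) m :
  \big[addb/false]_(i < m) (W i (+) W i.+1) = W 0 (+) W m.
Proof.
elim: m => [|m IH]; first by rewrite big_ord0 addbb.
by rewrite big_ord_recr /= IH -addbA (addbA (W m)) addbb addFb.
Qed.

Hypothesis N0 : 0 < N.
Hypothesis b_left : forall j, j <= N -> b 0 j = false.
Hypothesis b_right : forall j, j <= N -> b N j = true.

(* Every cell has an even number of doors. Modulo 2, the vertical doors between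
   reachable cells of a row cancel, since both sides of such a door are
   reachable together, and the left and right sides of the grid have none. *)
Let row_parity j : j < N ->
  \big[addb/false]_(i < N) (C i j && hdoor i j) = \big[addb/false]_(i < N) (C i j && hdoor i j.+1).
Proof.
move=> jN; pose W i := [&& i < N, C i j & vdoor i j].
have vdN : vdoor N j = false by rewrite /vdoor !b_right// ltnW.
have WS (i : 'I_N) : C i j && vdoor i.+1 j = W i.+1.
  rewrite /W; have [iN|] := boolP (i.+1 < N); first exact: C_vdoor.
  by rewrite -leqNgt => Ni; have -> : i.+1 = N by [apply/eqP; rewrite eqn_leq Ni ltn_ord]; rewrite vdN andbF.
have : \big[addb/false]_(i < N) ((C i j && hdoor i j) (+) (C i j && hdoor i j.+1)) = false.
  rewrite (eq_bigr (fun i : 'I_N => W i (+) W i.+1)) => [|i _].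
    by rewrite telescope_addb /W ltnn /vdoor !b_left ?(ltnW jN)// !andbF.
  rewrite -WS /W ltn_ord /= -!andb_addr; congr (_ && _).
  by rewrite /hdoor /vdoor; case: (b _ _); case: (b _ _); case: (b _ _); case: (b _ _).
rewrite big_split /=.
by case: (\big[_/_]_(_ < _) _); case: (\big[_/_]_(_ < _) _).
Qed.

(** The labels change from false to true along the bottom side, which thus has
    an odd number of doors. By the parity of rows, every row has an odd number
    of doors of reachable cells on its upper edge; so has the last one. *)
Lemma door_path_bottom_top : exists (q : 'I_N * 'I_N) p,
  [/\ q.2 = 0 :> nat, hdoor q.1 0, path through_door q p, uniq (q :: p)
    & (last q p).2.+1 = N /\ hdoor (last q p).1 N].
Proof.
have row j : j < N -> \big[addb/false]_(i < N) (C i j && hdoor i j).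
  elim: j => [_|j IH jN].
    rewrite (eq_bigr (fun i : 'I_N => b i 0 (+) b i.+1 0)) => [|i _].
      by rewrite (telescope_addb (fun i => b i 0)) b_left ?b_right.
    rewrite -/(hdoor i 0); case hd: (hdoor i 0); rewrite ?andbF// andbT.
    by apply/CP; exists (i, Ordinal N0), (i, Ordinal N0); split.
  have := IH (ltnW jN); rewrite row_parity ?(ltnW jN)//.
  by congr is_true; apply: eq_bigr => i _; apply: C_hdoor.
have N1 : N.-1 < N by rewrite prednK.
have := row _ N1; rewrite row_parity// prednK// => top.
have [i /andP[/CP[q0 [q [A1 A2 /connectP[p pp pq] A4 A5]]] hd]] : exists i : 'I_N, C i N.-1 && hdoor i N.
  apply/existsP; apply: contraLR top; rewrite negb_exists => /forallP no.
  by rewrite big1// => i _; apply/negbTE.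
case/shortenP: pp pq => p' pp' up' _ pq.
by exists q0, p'; split => //; rewrite -pq A4 A5 prednK.
Qed.

End Hex.

(** * Mean slopes and refinement of grids *)

Section QD.
Variable R : realType.
Implicit Types (Y : R -> R -> R) (N K : nat).

(** When Y s is a primitive of f s, this is the mean over the cell (i, j) of the
    grid of mesh 1 / N of the derivative of f in its first variable; as a
    second difference of Y it makes sense for every f. *)
Definition mean_slope Y N (i j : nat) : R :=
  N%:R ^+ 2 * (Y (i.+1%:R / N%:R) (j.+1%:R / N%:R) - Y (i.+1%:R / N%:R) (j%:R / N%:R)
    - (Y (i%:R / N%:R) (j.+1%:R / N%:R) - Y (i%:R / N%:R) (j%:R / N%:R))).

Lemma sum_ord_mul (F : nat -> R) N K :
  \sum_(I < N * K) F I = \sum_(i < N) \sum_(a < K) F (i * K + a)%N.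
Proof.
elim: N => [|N IH]; first by rewrite !big_ord0.
rewrite big_ord_recr /= -IH mulSn addnC.
rewrite -(big_mkord xpredT F) (big_cat_nat (n := (N * K)%N)) ?leq_addr//= big_mkord.
congr (_ + _); rewrite -{1}(add0n (N * K)%N) big_addn addKn big_mkord.
by apply: eq_bigr => a _; rewrite addnC.
Qed.

Lemma mean_slope_refine Y N K i j : (0 < N)%N -> (0 < K)%N ->
  \sum_(a < K) \sum_(b < K) mean_slope Y (N * K) (i * K + a) (j * K + b)
  = K%:R ^+ 2 * mean_slope Y N i j.
Proof.
move=> N0 K0.
have NR : N%:R != 0 :> R by rewrite pnatr_eq0 -lt0n.
have KR : K%:R != 0 :> R by rewrite pnatr_eq0 -lt0n.
pose P I := I%:R / (N * K)%:R : R.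
pose G I J := Y (P I) (P J).
have PK I : P (I * K)%N = I%:R / N%:R by rewrite /P !natrM; field; rewrite NR KR.
have tele (F : nat -> R) m : \sum_(a < K) (F (m + a).+1 - F (m + a)%N) = F (m + K)%N - F m.
  rewrite -(big_mkord xpredT (fun a => F (m + a).+1 - F (m + a)%N)).
  rewrite (eq_bigr (fun a => F (m + a.+1)%N - F (m + a)%N)) => [|a _]; last by rewrite addnS.
  by rewrite (telescope_sumr (fun a => F (m + a)%N))// addn0.
have inner a : \sum_(b < K) mean_slope Y (N * K) (i * K + a) (j * K + b) =
    (N * K)%:R ^+ 2 * ((G (i * K + a).+1 (j * K + K)%N - G (i * K + a).+1 (j * K)%N)
    - (G (i * K + a)%N (j * K + K)%N - G (i * K + a)%N (j * K)%N)).
  rewrite -!(tele (G _)) -sumrB mulr_sumr.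
  by apply: eq_bigr => b _.
under eq_bigr do rewrite inner.
rewrite -mulr_sumr.
rewrite (tele (fun I => G I (j * K + K)%N - G I (j * K)%N)).
rewrite -![(_ * K + K)%N]mulSnr /G !PK /mean_slope natrM; ring.
Qed.

Definition energy Y N : R :=
  N%:R ^- 2 * \sum_(i < N) \sum_(j < N) mean_slope Y N i j ^+ 2.

(** As the slope of a cell is the mean of the slopes of its subcells, the energy
    grows under refinement, by the variance of the finer slopes. *)
Lemma energy_refine Y N K : (0 < N)%N -> (0 < K)%N ->
  \sum_(i < N) \sum_(j < N) \sum_(a < K) \sum_(b < K)
    (mean_slope Y (N * K) (i * K + a) (j * K + b) - mean_slope Y N i j) ^+ 2
  = (N * K)%:R ^+ 2 * (energy Y (N * K) - energy Y N).
Proof.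
move=> N0 K0.
have NR : N%:R != 0 :> R by rewrite pnatr_eq0 -lt0n.
have KR : K%:R != 0 :> R by rewrite pnatr_eq0 -lt0n.
rewrite /energy mulrBr mulrA mulfV; last by rewrite expf_neq0// natrM mulf_neq0.
rewrite mul1r.
have -> : (N * K)%:R ^+ 2 * (N%:R ^- 2 * \sum_(i < N) \sum_(j < N) mean_slope Y N i j ^+ 2)
  = \sum_(i < N) \sum_(j < N) K%:R ^+ 2 * mean_slope Y N i j ^+ 2.
  under [RHS]eq_bigr do rewrite -mulr_sumr.
  by rewrite -mulr_sumr natrM; field.
rewrite (sum_ord_mul (fun I => \sum_(j < N * K) mean_slope Y (N * K) I j ^+ 2)).
rewrite -[RHS]sumrB; apply: eq_bigr => i _.
under [X in _ = X - _]eq_bigr => a _ do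
  rewrite (sum_ord_mul (fun J => mean_slope Y (N * K) (i * K + a) J ^+ 2)).
rewrite [X in _ = X - _]exchange_big /= -[RHS]sumrB; apply: eq_bigr => j _.
under eq_bigr => a _ do under eq_bigr => b _ do rewrite sqrrB.
set g := mean_slope Y N i j; set G := fun a b : nat => mean_slope Y (N * K) (i * K + a) (j * K + b).
have -> : \sum_(a < K) \sum_(b < K) (G a b ^+ 2 - G a b * g *+ 2 + g ^+ 2) =
    \sum_(a < K) \sum_(b < K) G a b ^+ 2 - 2 * g * \sum_(a < K) \sum_(b < K) G a b + K%:R ^+ 2 * g ^+ 2.
  rewrite mulr_sumr -sumrB.
  have -> : K%:R ^+ 2 * g ^+ 2 = \sum_(a < K) \sum_(b < K) g ^+ 2.
    by rewrite !sumr_const !card_ord -mulrnA -[RHS]mulr_natl natrM expr2.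
  rewrite -big_split /=; apply: eq_bigr => a _.
  rewrite mulr_sumr -sumrB -big_split /=; apply: eq_bigr => b _; ring.
by rewrite /G mean_slope_refine// -/g; ring.
Qed.

Lemma slow_step (E : nat -> R) (M e : R) : 0 < e -> (forall i, 0 <= E i <= M) ->
  exists i, E i.+1 - E i <= e.
Proof.
move=> e0 EM; apply: contrapT => no.
have grow i : i%:R * e <= E i.
  elim: i => [|i IH]; first by rewrite mul0r; case/andP: (EM 0%N).
  have : e < E i.+1 - E i by rewrite ltNge; apply/negP => h; apply: no; exists i.
  rewrite -natr1 mulrDl mul1r; lra.
have [m] : exists m : nat, M / e < m%:R.
  by exists (Num.bound `|M / e|); rewrite (le_lt_trans (ler_norm _))// archi_boundP.
rewrite ltr_pdivrMr// => Mm; have := grow m; have /andP[_] := EM m; lra.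
Qed.

(** The energies are bounded, so that refining by K increases their sum by very
    little at some scale. At this scale Chebyshev's inequality applies to the
    variance in [energy_refine]. *)
Lemma most_cells_slope_constant (I : finType) (Y : I -> R -> R -> R) (B d : R) K N0 :
  (forall l N i j, (0 < N)%N -> `|mean_slope (Y l) N i j| <= B) ->
  0 < d -> (0 < K)%N -> (0 < N0)%N ->
  exists2 N, (N0 <= N)%N &
   #|[set q : 'I_N * 'I_N | [exists l, [exists a : 'I_K, [exists b : 'I_K,
      d < `|mean_slope (Y l) (N * K) (q.1 * K + a) (q.2 * K + b)
            - mean_slope (Y l) N q.1 q.2| ]]]]%SET|%:R <= d * N%:R ^+ 2.
Proof.
move=> YB d0 K0 N00.
have NKgt0 i : (0 < N0 * K ^ i)%N by rewrite muln_gt0 N00 expn_gt0 K0.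
pose E i := \sum_l energy (Y l) (N0 * K ^ i).
have EB i : 0 <= E i <= #|I|%:R * B ^+ 2.
  rewrite mulr_natl -sumr_const; apply/andP; split.
    apply: sumr_ge0 => l _; rewrite mulr_ge0 ?invr_ge0 ?sqr_ge0//.
    by apply: sumr_ge0 => ? _; apply: sumr_ge0 => ? _; rewrite sqr_ge0.
  apply: ler_sum => l _; have := NKgt0 i; move: (_ * _)%N => N N_0.
  rewrite /energy mulrC ler_pdivrMr ?exprn_gt0 ?ltr0n//.
  have -> : B ^+ 2 * N%:R ^+ 2 = \sum_(i < N) \sum_(j < N) B ^+ 2.
    by rewrite !sumr_const !card_ord -mulrnA -[RHS]mulr_natr natrM expr2.
  apply: ler_sum => a _; apply: ler_sum => b _.
  by rewrite -[X in X <= _]real_normK ?num_real// lerXn2r ?nnegrE// ?YB// (le_trans _ (YB l _ a b N_0)).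
have KR : 0 < K%:R :> R by rewrite ltr0n.
have e0 : 0 < d ^+ 3 / K%:R ^+ 2 by rewrite divr_gt0 ?exprn_gt0.
have [i] := slow_step e0 EB; rewrite /E expnSr mulnA => Ei.
have N_0 := NKgt0 i; exists (N0 * K ^ i)%N; first by rewrite leq_pmulr// expn_gt0 K0.
move: Ei N_0; set N := (N0 * K ^ i)%N => Ei N_0.
set bad := finset _.
have NR : 0 < N%:R :> R by rewrite ltr0n.
have : \sum_(q in bad) d ^+ 2 <= (N * K)%:R ^+ 2 * (d ^+ 3 / K%:R ^+ 2).
  apply: (@le_trans _ _ (\sum_l (N * K)%:R ^+ 2 * (energy (Y l) (N * K) - energy (Y l) N))); last first.
    by rewrite -mulr_sumr ler_wpM2l ?sqr_ge0// sumrB.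
  under [X in _ <= X]eq_bigr do rewrite -energy_refine//.
  under [X in _ <= X]eq_bigr do rewrite pair_bigA /=.
  rewrite exchange_big /= [X in X <= _]big_mkcond; apply: ler_sum => q _.
  have ge0 : forall l : I, 0 <= \sum_(a < K) \sum_(b < K)
      (mean_slope (Y l) (N * K) (q.1 * K + a) (q.2 * K + b) - mean_slope (Y l) N q.1 q.2) ^+ 2.
    by move=> l; apply: sumr_ge0 => ? _; apply: sumr_ge0 => ? _; rewrite sqr_ge0.
  case: ifP => [|_]; last exact: sumr_ge0.
  rewrite inE => /existsP[l /existsP[a /existsP[b ab]]].
  rewrite (bigD1 l)//= ler_wpDr ?sumr_ge0//.
  rewrite (bigD1 a)//= ler_wpDr ?sumr_ge0// => [? _|]; first by apply: sumr_ge0 => ? _; rewrite sqr_ge0.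
  rewrite (bigD1 b)//= ler_wpDr ?sumr_ge0// => [? _|]; first by rewrite sqr_ge0.
  by rewrite -[X in _ <= X]real_normK ?num_real// lerXn2r ?nnegrE// ltW.
rewrite sumr_const -[X in X <= _]mulr_natl => le1.
rewrite -(ler_pM2r (exprn_gt0 2 d0)); apply: le_trans le1 _.
rewrite le_eqVlt; apply/orP; left; apply/eqP.
by rewrite [X in X ^+ 2 * _]natrM; field; rewrite gt_eqF.
Qed.

End QD.

(** * Affine approximation on a cell *)

Section Affine.
Variable R : realType.
Implicit Types (Y f x u v : R -> R -> R) (N K : nat) (L : R).

Definition lipschitz2 L f := forall s t s' t',
  `|f s' t' - f s t| <= L * (`|s' - s| + `|t' - t|).

(** A second-order form of dY/dt = f, which holds for the primitives of a
    Lipschitz function. *)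
Definition prim2 L Y f := forall s t t', 0 <= t -> t <= t' ->
  `|Y s t' - Y s t - (t' - t) * f s t| <= L * (t' - t) ^+ 2.

Lemma mean_slope_swap Y N i j :
  mean_slope (fun s t => Y t s) N i j = mean_slope Y N j i.
Proof. by rewrite /mean_slope; congr (_ * _); ring. Qed.

Lemma itv_dist_le (a h s s' : R) : a <= s <= a + h -> a <= s' <= a + h -> `|s' - s| <= h.
Proof. by move=> /andP[? ?] /andP[? ?]; rewrite ler_norml; apply/andP; split; lra. Qed.

Lemma rect_prim L Y f s s' t t' : prim2 L Y f -> 0 <= t -> t <= t' ->
  `|Y s' t' - Y s' t - (Y s t' - Y s t) - (t' - t) * (f s' t - f s t)| 
    <= 2 * L * (t' - t) ^+ 2.
Proof.
move=> YL t0 tt; have := YL s' t t' t0 tt; have := YL s t t' t0 tt.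
rewrite !ler_norml => /andP[A1 A2] /andP[A3 A4]; apply/andP; split; lra.
Qed.

Lemma mean_slope_le L Y f N i j : prim2 L Y f -> lipschitz2 L f -> (0 < N)%N ->
  `|mean_slope Y N i j| <= 3 * L.
Proof.
move=> YL fL N0; have NR : 0 < N%:R :> R by rewrite ltr0n.
have step m : m.+1%:R / N%:R - m%:R / N%:R = N%:R^-1 :> R.
  by rewrite -mulrBl -natr1 addrAC subrr add0r mul1r.
have leh : j%:R / N%:R <= j.+1%:R / N%:R :> R by rewrite ler_pM2r ?invr_gt0// ?ler_nat.
have G0 := rect_prim (i%:R / N%:R) (i.+1%:R / N%:R) YL (divr_ge0 (ler0n _ j) (ler0n _ N))
  leh.
move: G0.
have := fL (i%:R / N%:R) (j%:R / N%:R) (i.+1%:R / N%:R) (j%:R / N%:R).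
rewrite !step subrr normr0 addr0 (ger0_norm (x := N%:R^-1)) ?invr_ge0 ?ler0n//.
rewrite /mean_slope; move: (f _ _ - f _ _) (_ - _ - (_ - _)) => F G.
move=> FL GL; rewrite normrM ger0_norm ?exprn_ge0 ?ler0n//.
have NI : N%:R^-1 > 0 :> R by rewrite invr_gt0.
have NN : N%:R * N%:R^-1 = 1 :> R by rewrite mulfV// gt_eqF.
have : `|G| <= 3 * L * N%:R^-1 ^+ 2.
  have : `|N%:R^-1 * F| <= N%:R^-1 * (L * N%:R^-1).
    by rewrite normrM (ger0_norm (ltW NI)) ler_pM2l.
  move: GL; rewrite !ler_norml => /andP[A1 A2] /andP[A3 A4]; apply/andP; split; lra.
rewrite -(ler_pM2l (exprn_gt0 2 NR)) => /le_trans; apply.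
by rewrite mulrCA -exprMn NN expr1n mulr1.
Qed.

(** Along a row of subcells of height 1 / (N K) the slopes add up to a second
    difference of Y, which is the height times the increment of f, up to the
    square of the height. *)
Lemma row_affine L Y f N K i j (d : R) a b
    (P := fun m : nat => m%:R / (N * K)%:R : R) : prim2 L Y f -> 
  (0 < N)%N -> (0 < K)%N -> (a <= K)%N ->
  (forall a : 'I_K, `|mean_slope Y (N * K) (i * K + a) (j * K + b)
      - mean_slope Y N i j| <= d) ->
  `|f (P (i * K + a)%N) (P (j * K + b)%N) - f (P (i * K)%N) (P (j * K + b)%N)
     - mean_slope Y N i j * P a| <= d * P a + 2 * L * P 1%N.
Proof.
move=> YL N0 K0 aK good.
have NKR : 0 < (N * K)%:R :> R by rewrite ltr0n muln_gt0 N0.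
set g := mean_slope Y N i j in good *; set t := P (j * K + b)%N.
set t' := P (j * K + b).+1.
have tt : t' - t = P 1%N by rewrite /t' /t /P -mulrBl -natr1 addrAC subrr add0r.
have p0 : 0 < P 1%N by rewrite divr_gt0.
have p1E : P 1%N = (N * K)%:R^-1 by rewrite /P div1r.
have key : `|(Y (P (i * K + a)%N) t' - Y (P (i * K + a)%N) t 
      - (Y (P (i * K)%N) t' - Y (P (i * K)%N) t)) - g * a%:R * P 1%N ^+ 2|
    <= d * a%:R * P 1%N ^+ 2.
  elim: a aK => [|a IH] aK.
    by rewrite addn0 subrr !mulr0 !mul0r subr0 normr0.
  have := IH (ltnW aK); have := good (Ordinal aK).
  move=> ga.
  have : `|(Y (P (i * K + a.+1)%N) t' - Y (P (i * K + a.+1)%N) t 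
      - (Y (P (i * K + a)%N) t' - Y (P (i * K + a)%N) t)) - g * P 1%N ^+ 2|
    <= d * P 1%N ^+ 2.
    have <- : (mean_slope Y (N * K) (i * K + a) (j * K + b) - g) * P 1%N ^+ 2
       = (Y (P (i * K + a.+1)%N) t' - Y (P (i * K + a.+1)%N) t 
      - (Y (P (i * K + a)%N) t' - Y (P (i * K + a)%N) t)) - g * P 1%N ^+ 2.
      rewrite mulrBl; congr (_ - _); rewrite /mean_slope addnS.
      by rewrite mulrAC p1E -exprMn mulfV ?expr1n ?mul1r// gt_eqF.
    by rewrite normrM [`|P 1%N ^+ 2|]ger0_norm ?ler_wpM2r ?exprn_ge0// ltW.
  rewrite -natr1 !ler_norml => /andP[A1 A2] /andP[A3 A4]; apply/andP; split; lra.
have Pa : P a = a%:R * P 1%N by rewrite /P div1r.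
rewrite Pa.
have t0 : 0 <= t by rewrite divr_ge0 ?ler0n.
have lett : t <= t' by rewrite -subr_ge0 tt ltW.
have := rect_prim (P (i * K)%N) (P (i * K + a)%N) YL t0 lett.
rewrite tt => k2.
rewrite -(ler_pM2l p0) -[X in X * `|_|](ger0_norm (ltW p0)) -normrM.
move: k2 key; rewrite !ler_norml => /andP[A1 A2] /andP[A3 A4]; apply/andP; split; nra.
Qed.

End Affine.

Section Cell.
Variable R : realType.
Implicit Types (Y f x u v : R -> R -> R) (N K : nat) (L : R).

Lemma round_down K (h r : R) : (0 < K)%N -> 0 <= r <= K%:R * h ->
  exists2 a, (a < K)%N & 0 <= r - a%:R * h <= h.
Proof.
move=> + /andP[r0]; elim: K => // K IH _ rK.
have [rle|rgt] := lerP r (K%:R * h); last first.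
  by exists K => //; rewrite -natr1 mulrDl in rK; apply/andP; split; lra.
case: K IH rle rK => [_ _|K IH rle _].
  by rewrite mul1r => rh; exists 0%N => //; rewrite mul0r subr0 r0.
by have [a aK ?] := IH isT rle; exists a => //; rewrite ltnW.
Qed.

Definition in_cell N (i j : nat) (s t : R) :=
  (i%:R / N%:R <= s <= i.+1%:R / N%:R) /\ (j%:R / N%:R <= t <= j.+1%:R / N%:R).

(** The point (s, t) is rounded down to the grid of mesh 1 / (N K), and reached
    from the corner of the cell by a column and a row of subcells. The rounding
    and the two applications of [row_affine] give the terms in L / K. *)
Lemma near_affine L Y1 Y2 f N K i j (d : R) :
  prim2 L Y1 f -> prim2 L (fun s t => Y2 t s) (fun s t => f t s) -> lipschitz2 L f ->
  (0 < N)%N -> (0 < K)%N -> 0 <= d ->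
  (forall a b : 'I_K, `|mean_slope Y1 (N * K) (i * K + a) (j * K + b)
      - mean_slope Y1 N i j| <= d) ->
  (forall a b : 'I_K, `|mean_slope Y2 (N * K) (i * K + a) (j * K + b)
      - mean_slope Y2 N i j| <= d) ->
  forall s t, in_cell N i j s t ->
  `|f s t - f (i%:R / N%:R) (j%:R / N%:R) - mean_slope Y1 N i j * (s - i%:R / N%:R)
     - mean_slope Y2 N i j * (t - j%:R / N%:R)| <= (2 * d + 12 * L / K%:R) / N%:R.
Proof.
move=> YL1 YL2 fL N0 K0 d0 good1 good2 s t [/andP[s1 s2] /andP[t1 t2]].
have NR : 0 < N%:R :> R by rewrite ltr0n.
have KR : 0 < K%:R :> R by rewrite ltr0n.
have NKR : 0 < (N * K)%:R :> R by rewrite ltr0n muln_gt0 N0.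
pose P m : R := m%:R / (N * K)%:R.
have PK m : P (m * K)%N = m%:R / N%:R.
  by rewrite /P !natrM; field; rewrite !gt_eqF.
have PD m a : P (m * K + a)%N = m%:R / N%:R + P a.
  by rewrite -PK /P natrD mulrDl.
have h1 : 1 / N%:R = K%:R * P 1%N by rewrite -[1 / _]/(1%:R / N%:R) -PK mul1n /P mulrA mulr1.
have p0 : 0 < P 1%N by rewrite divr_gt0.
have Pa a : P a = a%:R * P 1%N by rewrite /P div1r.
have [a aK /andP[a1 a2]] : exists2 a, (a < K)%N & 0 <= (s - i%:R / N%:R) - a%:R * P 1%N <= P 1%N.
  by apply: round_down => //; rewrite -h1; move: s2; rewrite -natr1 mulrDl => s2; apply/andP; split; lra.
have [b bK /andP[b1 b2]] : exists2 b, (b < K)%N & 0 <= (t - j%:R / N%:R) - b%:R * P 1%N <= P 1%N.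
  by apply: round_down => //; rewrite -h1; move: t2; rewrite -natr1 mulrDl => t2; apply/andP; split; lra.
have R1 := row_affine YL1 N0 K0 (ltnW aK) (fun a => good1 a (Ordinal bK)).
have R2 : `|f (i%:R / N%:R) (P (j * K + b)%N) - f (i%:R / N%:R) (P (j * K)%N)
     - mean_slope Y2 N i j * P b| <= d * P b + 2 * L * P 1%N.
  have := @row_affine _ _ _ _ N K j i d b 0 YL2 N0 K0 (ltnW bK).
  rewrite mean_slope_swap -!/(P _) addn0 PK; apply => b'.
  by rewrite mean_slope_swap -[(i * K)%N]addn0; apply: (good2 (Ordinal K0)).
have Lge := mean_slope_le i j YL1 fL N0.
have Lge2 : `|mean_slope Y2 N i j| <= 3 * L.
  rewrite -(mean_slope_swap Y2); apply: mean_slope_le YL2 _ N0.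
  by move=> ? ? ? ?; rewrite [X in L * X]addrC; apply: fL.
have S := fL (P (i * K + a)%N) (P (j * K + b)%N) s t.
move: R1 R2 S; rewrite /= -!/(P _) !PK !PD; set g1 := mean_slope _ _ _ _; set g2 := mean_slope _ _ _ _.
have Pa1 : P a <= K%:R * P 1%N by rewrite Pa ler_pM2r// ler_nat ltnW.
have Pb1 : P b <= K%:R * P 1%N by rewrite Pa ler_pM2r// ler_nat ltnW.
have -> : (2 * d + 12 * L / K%:R) / N%:R = 2 * d * (K%:R * P 1%N) + 12 * L * P 1%N.
  by rewrite -h1 -[P 1%N](mulKf (lt0r_neq0 KR)) -h1; field; rewrite !gt_eqF.
rewrite -!Pa in a1 a2 b1 b2.
have dPa : d * P a <= d * (K%:R * P 1%N) by rewrite ler_wpM2l.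
have dPb : d * P b <= d * (K%:R * P 1%N) by rewrite ler_wpM2l.
have L0 : 0 <= L by move: Lge; rewrite -/g1; have := normr_ge0 g1; lra.
have Ea : `|s - (i%:R / N%:R + P a)| <= P 1%N by rewrite ler_norml; apply/andP; split; lra.
have Eb : `|t - (j%:R / N%:R + P b)| <= P 1%N by rewrite ler_norml; apply/andP; split; lra.
have Ga : `|g1 * (s - (i%:R / N%:R + P a))| <= 3 * L * P 1%N.
  by rewrite normrM ler_pM.
have Gb : `|g2 * (t - (j%:R / N%:R + P b))| <= 3 * L * P 1%N.
  by rewrite normrM ler_pM.
have LE : L * (`|s - (i%:R / N%:R + P a)| + `|t - (j%:R / N%:R + P b)|) <= L * (2 * P 1%N).
  by rewrite ler_wpM2l//; lra.
move=> R1 R2 /le_trans/(_ LE).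
clear -R1 R2 Ga Gb dPa dPb; move: R1 R2 Ga Gb.
rewrite !ler_norml => /andP[A1 A2] /andP[A3 A4] /andP[A5 A6] /andP[A7 A8] /andP[A9 A10].
apply/andP; split; lra.
Qed.

End Cell.

(** * The relation dv = u dx on a square *)

Section Edge.
Variable R : realType.
Implicit Types (x u v : R -> R -> R) (L : R).

(** The mean value inequality for functions which need not be differentiable. *)
Lemma local_to_global (psi : R -> R) (C a b : R) : a <= b ->
  (forall e, 0 < e -> exists2 r, 0 < r & forall t t', a <= t -> t <= t' -> t' <= b ->
     t' - t < r -> `|psi t' - psi t| <= (C + e) * (t' - t)) ->
  `|psi b - psi a| <= C * (b - a).
Proof.
move=> ab H; apply/ler_addgt0Pr => e e0.
have [c c0 ce] : exists2 c, 0 < c & c * (b - a) <= e.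
  exists (e / (b - a + 1)); first by rewrite divr_gt0// ltr_wpDl// subr_ge0.
  by rewrite mulrAC ler_pdivrMr ?ltr_wpDl ?subr_ge0// ler_pM2l//; lra.
have [r r0 Hr] := H c c0.
have [M M0 Mr] : exists2 M, (0 < M)%N & (b - a) / M%:R < r.
  exists (Num.bound `|(b - a) / r|).+1 => //.
  rewrite ltr_pdivrMr ?ltr0n// mulrC -ltr_pdivrMr//.
  rewrite (le_lt_trans (ler_norm _))// -natr1 ltr_wpDr// .
  by rewrite archi_boundP.
have MR : 0 < M%:R :> R by rewrite ltr0n.
set h := (b - a) / M%:R in Mr.
have h0 : 0 <= h by apply: divr_ge0; [rewrite subr_ge0|exact: ltW].
have hM : M%:R * h = b - a by rewrite mulrC divfK// gt_eqF.
have ind m : (m <= M)%N -> `|psi (a + m%:R * h) - psi a| <= (C + c) * (m%:R * h).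
  elim: m => [_|m IH mM]; first by rewrite !mul0r mulr0 addr0 subrr normr0.
  have mh : m.+1%:R * h <= b - a by rewrite -hM ler_wpM2r// ler_nat.
  have := IH (ltnW mM); have := Hr (a + m%:R * h) (a + m.+1%:R * h).
  have m0 : 0 <= m%:R * h by rewrite mulr_ge0.
  have -> : a + m.+1%:R * h - (a + m%:R * h) = h by rewrite -natr1; ring.
  rewrite -natr1 mulrDl mul1r in mh *.
  move=> /(_ ltac:(lra) ltac:(lra) ltac:(lra) Mr).
  rewrite !ler_norml => /andP[A1 A2] /andP[A3 A4]; apply/andP; split; lra.
have := ind M (leqnn _); rewrite hM (addrC a) subrK => /le_trans; apply; lra.
Qed.

(** The trapezoid rule for V, the integral of U dX, where X and U are close to
    affine. The slope of X is not close to that of its affine approximation,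
    so that this part of the integral is integrated by parts: it leaves a
    boundary term, which is subtracted from V. *)
Lemma edge_trapezoid (X U V : R -> R) (x0 u0 a b k L B h : R) : 0 <= h -> 0 <= k ->
  (forall s s', `|X s' - X s| <= L * `|s' - s|) -> `|b| <= B ->
  (forall e, 0 < e -> exists2 r, 0 < r & forall s s', `|s' - s| < r ->
     `|V s' - V s - U s * (X s' - X s)| <= e * `|s' - s|) ->
  (forall s, 0 <= s <= h -> `|X s - (x0 + a * s)| <= k) ->
  (forall s, 0 <= s <= h -> `|U s - (u0 + b * s)| <= k) ->
  `|(V h - (u0 + b * h) * (X h - (x0 + a * h))) - (V 0 - u0 * (X 0 - x0))
     - (u0 * a * h + a * b * h ^+ 2 / 2)| <= k * (L + B) * h.
Proof.
move=> h0 k0 XL bB Vc Xk Uk.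
pose psi s := V s - (u0 + b * s) * (X s - (x0 + a * s)) - (u0 * a * s + a * b * s ^+ 2 / 2).
have -> : (V h - (u0 + b * h) * (X h - (x0 + a * h))) - (V 0 - u0 * (X 0 - x0))
     - (u0 * a * h + a * b * h ^+ 2 / 2) = psi h - psi 0 by rewrite /psi; ring.
rewrite -[X in _ <= _ * X]subr0; apply: local_to_global => // e e0.
have [r r0 Hr] := Vc (e / 2) ltac:(by rewrite divr_gt0).
have ab0 : 0 < `|a * b| + 1 by rewrite ltr_wpDl.
exists (Num.min r (e / (`|a * b| + 1))); first by rewrite lt_min r0 divr_gt0.
move=> s s' s0 ss sh; rewrite lt_min ltr_pdivlMr// => /andP[sr se].
have ds : `|s' - s| = s' - s by rewrite ger0_norm// subr_ge0.
have ds0 : 0 <= s' - s by rewrite subr_ge0.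
have := Hr s s'; rewrite ds => /(_ sr) V1.
have X1 := XL s s'; rewrite ds in X1.
have U1 := Uk s ltac:(apply/andP; split; lra).
have X2 := Xk s' ltac:(apply/andP; split; lra).
have T1 : `|(U s - (u0 + b * s)) * (X s' - X s)| <= k * (L * (s' - s)) by rewrite normrM ler_pM.
have T2 : `|b * (s' - s) * (X s' - (x0 + a * s'))| <= B * (s' - s) * k.
  by rewrite normrM ler_pM// normrM ds ler_wpM2r.
have T3 : `|a * b * (s' - s) ^+ 2 / 2| <= e / 2 * (s' - s).
  rewrite normrM [`|2^-1|]ger0_norm ?invr_ge0// normrM [`|_ ^+ 2|]ger0_norm ?sqr_ge0//.
  have : `|a * b| * (s' - s) <= e by lra.
  have := normr_ge0 (a * b); nra.
have -> : psi s' - psi s = (V s' - V s - U s * (X s' - X s))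
  + (U s - (u0 + b * s)) * (X s' - X s) - b * (s' - s) * (X s' - (x0 + a * s'))
  - a * b * (s' - s) ^+ 2 / 2 by rewrite /psi; field.
move: V1 T1 T2 T3; rewrite !ler_norml => /andP[A1 A2] /andP[A3 A4] /andP[A5 A6] /andP[A7 A8].
apply/andP; split; lra.
Qed.

(** The relation dv = u dx, to first order and uniformly on the plane; it makes
    sense without derivatives. *)
Definition primitive_of x u v := forall e : R, 0 < e -> exists2 r, 0 < r &
  forall s t s' t', `|s' - s| + `|t' - t| < r ->
  `|v s' t' - v s t - u s t * (x s' t' - x s t)| <= e * (`|s' - s| + `|t' - t|).

End Edge.

Section Cell2.
Variable R : realType.
Implicit Types (Y f x u v : R -> R -> R) (N K : nat) (L B : R).

(** Stokes' formula: the increments of v around the square add up to zero, while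
    by [edge_trapezoid] they add up to the determinant of the slopes times the
    area, the boundary terms at the corners cancelling. *)
Lemma affine_det_le L B x u v (s0 t0 h k a1 a2 b1 b2 : R) :
  0 < h -> 0 <= k -> lipschitz2 L x -> primitive_of x u v -> `|b1| <= B -> `|b2| <= B ->
  (forall s t, s0 <= s <= s0 + h -> t0 <= t <= t0 + h ->
    `|x s t - x s0 t0 - a1 * (s - s0) - a2 * (t - t0)| <= k) ->
  (forall s t, s0 <= s <= s0 + h -> t0 <= t <= t0 + h ->
    `|u s t - u s0 t0 - b1 * (s - s0) - b2 * (t - t0)| <= k) ->
  `|a1 * b2 - a2 * b1| * h <= 4 * (k * (L + B)).
Proof.
move=> h0 k0 xL vP B1 B2 xk uk.
have hh := ltW h0.
have addB2 (a b c : R) : a + b - (a + c) = b - c by ring.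
have hor t := @edge_trapezoid R (fun s => x (s0 + s) t) (fun s => u (s0 + s) t)
  (fun s => v (s0 + s) t) (x s0 t0 + a2 * (t - t0)) (u s0 t0 + b2 * (t - t0)) a1 b1 k L B h hh k0.
have ver s := @edge_trapezoid R (fun t => x s (t0 + t)) (fun t => u s (t0 + t))
  (fun t => v s (t0 + t)) (x s0 t0 + a1 * (s - s0)) (u s0 t0 + b1 * (s - s0)) a2 b2 k L B h hh k0.
have lipS f : lipschitz2 L f -> forall t s s', `|f (s0 + s') t - f (s0 + s) t| <= L * `|s' - s|.
  by move=> fL t s s'; have := fL (s0 + s) t (s0 + s') t; rewrite subrr normr0 addr0 addB2.
have lipT f : lipschitz2 L f -> forall s t t', `|f s (t0 + t') - f s (t0 + t)| <= L * `|t' - t|.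
  by move=> fL s t t'; have := fL s (t0 + t) s (t0 + t'); rewrite subrr normr0 add0r addB2.
have primS t e : 0 < e -> exists2 r, 0 < r & forall s s', `|s' - s| < r ->
     `|v (s0 + s') t - v (s0 + s) t - u (s0 + s) t * (x (s0 + s') t - x (s0 + s) t)| <= e * `|s' - s|.
  move=> e0; have [r r0 Hr] := vP e e0; exists r => // s s'.
  by have := Hr (s0 + s) t (s0 + s') t; rewrite subrr normr0 addr0 addB2.
have primT s e : 0 < e -> exists2 r, 0 < r & forall t t', `|t' - t| < r ->
     `|v s (t0 + t') - v s (t0 + t) - u s (t0 + t) * (x s (t0 + t') - x s (t0 + t))| <= e * `|t' - t|.
  move=> e0; have [r r0 Hr] := vP e e0; exists r => // t t'.
  by have := Hr s (t0 + t) s (t0 + t'); rewrite subrr normr0 add0r addB2.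
have affS f c1 c2 : (forall s t, s0 <= s <= s0 + h -> t0 <= t <= t0 + h ->
    `|f s t - f s0 t0 - c1 * (s - s0) - c2 * (t - t0)| <= k) ->
    forall t, t0 <= t <= t0 + h -> forall s, 0 <= s <= h ->
    `|f (s0 + s) t - (f s0 t0 + c2 * (t - t0) + c1 * s)| <= k.
  move=> fk t th s sh; have := fk (s0 + s) t; rewrite (addrAC s0) subrr add0r.
  rewrite (_ : _ - _ - _ - _ = f (s0 + s) t - (f s0 t0 + c2 * (t - t0) + c1 * s)); last by ring.
  by apply => //; apply/andP; split; lra.
have affT f c1 c2 : (forall s t, s0 <= s <= s0 + h -> t0 <= t <= t0 + h ->
    `|f s t - f s0 t0 - c1 * (s - s0) - c2 * (t - t0)| <= k) ->
    forall s, s0 <= s <= s0 + h -> forall t, 0 <= t <= h ->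
    `|f s (t0 + t) - (f s0 t0 + c1 * (s - s0) + c2 * t)| <= k.
  move=> fk s sh t th; have := fk s (t0 + t); rewrite (addrAC t0) subrr add0r.
  rewrite (_ : _ - _ - _ - _ = f s (t0 + t) - (f s0 t0 + c1 * (s - s0) + c2 * t)); last by ring.
  by apply => //; apply/andP; split; lra.
have {}hor t th := hor t (lipS x xL t) B1 (primS t) (affS _ _ _ xk t th) (affS _ _ _ uk t th).
have {}ver s sh := ver s (lipT x xL s) B2 (primT s) (affT _ _ _ xk s sh) (affT _ _ _ uk s sh).
have H1 := hor t0 ltac:(apply/andP; split; lra).
have H2 := hor (t0 + h) ltac:(apply/andP; split; lra).
have V1 := ver s0 ltac:(apply/andP; split; lra).
have V2 := ver (s0 + h) ltac:(apply/andP; split; lra).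
have key : `|(a1 * b2 - a2 * b1) * h ^+ 2| <= 4 * (k * (L + B)) * h.
  move: H1 H2 V1 V2; rewrite !addr0 !subrr !mulr0 !addr0.
  rewrite !ler_norml => /andP[A1 A2] /andP[A3 A4] /andP[A5 A6] /andP[A7 A8].
  apply/andP; split; lra.
rewrite -(ler_pM2r h0); apply: le_trans key.
by rewrite normrM [`|h ^+ 2|]ger0_norm ?sqr_ge0// expr2 mulrA.
Qed.

(** If the gradient (a1, a2) is short, x varies little in the cell. If not, the
    gradient of u is nearly proportional to it by [affine_det_le], and u varies
    little along the level sets of x. In both cases the product of the two
    bounds is small with respect to the area. *)
Lemma cell_bound L x u v (s0 t0 h eta a1 a2 b1 b2 : R) : 0 <= L ->
  0 < h -> 0 < eta <= 1 -> lipschitz2 L x -> lipschitz2 L u -> primitive_of x u v ->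
  `|a1| <= 3 * L -> `|a2| <= 3 * L -> `|b1| <= 3 * L -> `|b2| <= 3 * L ->
  (forall s t, s0 <= s <= s0 + h -> t0 <= t <= t0 + h ->
    `|x s t - x s0 t0 - a1 * (s - s0) - a2 * (t - t0)| <= eta ^+ 3 * h) ->
  (forall s t, s0 <= s <= s0 + h -> t0 <= t <= t0 + h ->
    `|u s t - u s0 t0 - b1 * (s - s0) - b2 * (t - t0)| <= eta ^+ 3 * h) ->
  exists rho beta, [/\ 0 <= rho <= 2 * (L + 1) * h, 0 <= beta,
    rho * beta <= (8 * L + 528 * L ^+ 3) * eta * h ^+ 2,
    (forall s t, s0 <= s <= s0 + h -> t0 <= t <= t0 + h -> `|x s t - x s0 t0| <= rho)
    & (forall s t s' t', s0 <= s <= s0 + h -> t0 <= t <= t0 + h ->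
        s0 <= s' <= s0 + h -> t0 <= t' <= t0 + h -> x s t = x s' t' ->
        `|u s' t' - u s t| <= beta)].
Proof.
move=> L0 h0 /andP[eta0 eta1] xL uL vP A1 A2 B1 B2 xk uk.
(* The gradient is short when it is less than eta. Otherwise the variation of u
   is an error of size eps h divided by the square of the gradient, whence
   the choice eps = eta ^ 3. *)
set eps := eta ^+ 3 in xk uk *.
have eps0 : 0 <= eps by rewrite exprn_ge0// ltW.
have epse : eps <= eta by rewrite /eps exprS (ler_piMr (ltW eta0))// exprn_ile1// ltW.
have hh := ltW h0.
have det := affine_det_le h0 (mulr_ge0 eps0 hh) xL vP B1 B2 xk uk.
have {}det : `|a1 * b2 - a2 * b1| <= 16 * L * eps.
  by rewrite -(ler_pM2r h0); apply: le_trans det _; lra.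
have lip2 f : lipschitz2 L f -> forall s t s' t', s0 <= s <= s0 + h -> t0 <= t <= t0 + h ->
    s0 <= s' <= s0 + h -> t0 <= t' <= t0 + h -> `|f s' t' - f s t| <= 2 * L * h.
  move=> fL s t s' t' sh th sh' th'.
  have E1 := itv_dist_le sh sh'; have E2 := itv_dist_le th th'.
  apply: le_trans (fL _ _ _ _) _.
  have : L * (`|s' - s| + `|t' - t|) <= L * (h + h) by rewrite ler_wpM2l// lerD.
  by move/le_trans; apply; lra.
have s00 : s0 <= s0 <= s0 + h by apply/andP; split; lra.
have t00 : t0 <= t0 <= t0 + h by apply/andP; split; lra.
have [steep|flat] := lerP eta (`|a1| + `|a2|); last first.
  exists (2 * eta * h), (2 * L * h); split.
  - apply/andP; split; nra.
  - nra.
  - have : 0 <= 524 * L ^+ 3 * eta * h ^+ 2 by rewrite !mulr_ge0 ?ler0n ?exprn_ge0// ltW.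
    have : 0 <= L * eta * h ^+ 2 by rewrite !mulr_ge0 ?exprn_ge0// ltW.
    have : 0 <= L ^+ 3 * eta * h ^+ 2 by rewrite !mulr_ge0 ?exprn_ge0// ltW.
    lra.
  - move=> s t sh th; have := xk s t sh th.
    case/andP: sh => ? ?; case/andP: th => ? ?.
    have E1 : `|a1 * (s - s0)| <= `|a1| * h.
      by rewrite normrM ler_wpM2l// ler_norml; apply/andP; split; lra.
    have E2 : `|a2 * (t - t0)| <= `|a2| * h.
      by rewrite normrM ler_wpM2l// ler_norml; apply/andP; split; lra.
    have E3 : (`|a1| + `|a2|) * h <= eta * h by rewrite ler_wpM2r// ltW.
    have E4 : eps * h <= eta * h by rewrite ler_wpM2r.
    move: E1 E2; rewrite !ler_norml => /andP[? ?] /andP[? ?] /andP[? ?].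
    apply/andP; split; lra.
  - by move=> s t s' t' sh th sh' th' _; apply: lip2.
exists (2 * L * h), ((2 + 264 * L ^+ 2) * eta * h).
have e2 : 0 < eta ^+ 2 by rewrite exprn_gt0.
have L2 : 0 <= L ^+ 2 by rewrite exprn_ge0.
split.
- apply/andP; split; nra.
- by rewrite !mulr_ge0 ?addr_ge0 ?mulr_ge0 ?ler0n// ltW.
- have : 0 <= L * eta * h ^+ 2 by rewrite !mulr_ge0 ?exprn_ge0// ltW.
  rewrite (_ : 2 * L * h * _ = (4 * L + 528 * L ^+ 3) * eta * h ^+ 2); last by ring.
  lra.
- by move=> s t sh th; apply: lip2.
move=> s t s' t' sh th sh' th' xx.
have X1 := xk s t sh th; have X2 := xk s' t' sh' th'.
have U1 := uk s t sh th; have U2 := uk s' t' sh' th'.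
have D1 := itv_dist_le sh sh'; have D2 := itv_dist_le th th'.
set d1 := s' - s in D1; set d2 := t' - t in D2.
have Ad : `|a1 * d1 + a2 * d2| <= 2 * eps * h.
  move: X1 X2; rewrite -xx /d1 /d2; clear; rewrite !ler_norml => /andP[? ?] /andP[? ?].
  by apply/andP; split; lra.
have AB : `|a1 * b1 + a2 * b2| <= 18 * L ^+ 2.
  apply: le_trans (ler_normD _ _) _; rewrite !normrM.
  have : `|a1| * `|b1| <= 3 * L * (3 * L) by rewrite ler_pM.
  have : `|a2| * `|b2| <= 3 * L * (3 * L) by rewrite ler_pM.
  lra.
have Aperp : `|a1 * d2 - a2 * d1| <= 6 * L * h.
  apply: le_trans (ler_normB _ _) _; rewrite !normrM.
  have : `|a1| * `|d2| <= 3 * L * h by rewrite ler_pM.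
  have : `|a2| * `|d1| <= 3 * L * h by rewrite ler_pM.
  lra.
have Q : eta ^+ 2 <= 2 * (a1 ^+ 2 + a2 ^+ 2).
  rewrite -(real_normK (num_real a1)) -(real_normK (num_real a2)).
  have : eta ^+ 2 <= (`|a1| + `|a2|) ^+ 2 by rewrite lerXn2r// nnegrE ?addr_ge0// ltW.
  have := sqr_ge0 (`|a1| - `|a2|); lra.
have P1 : `|(a1 * b1 + a2 * b2) * (a1 * d1 + a2 * d2)| <= 18 * L ^+ 2 * (2 * eps * h).
  by rewrite normrM ler_pM.
have P2 : `|(a1 * b2 - a2 * b1) * (a1 * d2 - a2 * d1)| <= 16 * L * eps * (6 * L * h).
  by rewrite normrM ler_pM.
(* Decompose (d1, d2) along (a1, a2) and its rotation: the first component is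
   small because x takes the same value at both points, the second one is
   multiplied by the small determinant. *)
have Bd : `|b1 * d1 + b2 * d2| * eta ^+ 2 <= 264 * L ^+ 2 * eps * h.
  apply: (@le_trans _ _ (2 * `|(a1 ^+ 2 + a2 ^+ 2) * (b1 * d1 + b2 * d2)|)).
    rewrite normrM [`|_ + _ ^+ 2|]ger0_norm ?addr_ge0 ?sqr_ge0//.
    have := normr_ge0 (b1 * d1 + b2 * d2); nra.
  rewrite (_ : (a1 ^+ 2 + a2 ^+ 2) * _ = (a1 * b1 + a2 * b2) * (a1 * d1 + a2 * d2)
     + (a1 * b2 - a2 * b1) * (a1 * d2 - a2 * d1)); last by ring.
  have := ler_normD ((a1 * b1 + a2 * b2) * (a1 * d1 + a2 * d2)) ((a1 * b2 - a2 * b1) * (a1 * d2 - a2 * d1)).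
  lra.
have {}Bd : `|b1 * d1 + b2 * d2| <= 264 * L ^+ 2 * eta * h.
  rewrite -(ler_pM2r e2); apply: le_trans Bd _.
  by rewrite /eps le_eqVlt; apply/orP; left; apply/eqP; ring.
have eh : eps * h <= eta * h by rewrite ler_wpM2r.
move: eh Bd U1 U2; rewrite /d1 /d2; clear; rewrite !ler_norml => ? /andP[? ?] /andP[? ?] /andP[? ?].
apply/andP; split; lra.
Qed.

End Cell2.

Section Grid.
Variable R : realType.
Implicit Types (Y f x u v : R -> R -> R) (N K : nat) (L : R).

Definition has_prims L f :=
  exists Y1 Y2 : R -> R -> R,
    prim2 L Y1 f /\ prim2 L (fun s t => Y2 t s) (fun s t => f t s).

(** The cells where the slopes vary between subcells are so few that the trivial
    bounds 2 L / N for x and u are sufficient there; [near_affine] and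
    [cell_bound] apply to the others. *)
Lemma grid_bound L x u v (theta : R) N0 : 0 <= L -> 0 < theta -> (0 < N0)%N ->
  lipschitz2 L x -> lipschitz2 L u -> primitive_of x u v -> has_prims L x -> has_prims L u ->
  exists2 N, (N0 <= N)%N & exists rho beta : 'I_N * 'I_N -> R,
  [/\ forall q, 0 <= rho q <= 2 * (L + 1) / N%:R, forall q, 0 <= beta q,
      \sum_q rho q * beta q <= theta,
      (forall (q : 'I_N * 'I_N) s t, in_cell N q.1 q.2 s t ->
         `|x s t - x (q.1%:R / N%:R) (q.2%:R / N%:R)| <= rho q)
    & (forall (q : 'I_N * 'I_N) s t s' t', in_cell N q.1 q.2 s t -> in_cell N q.1 q.2 s' t' ->
         x s t = x s' t' -> `|u s' t' - u s t| <= beta q)].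
Proof.
move=> L0 th0 N00 xL uL vP [X1 [X2 [X1P X2P]]] [U1 [U2 [U1P U2P]]].
pose Y (l : bool * bool) := if l.1 then (if l.2 then X1 else X2) else (if l.2 then U1 else U2).
have swapL f : lipschitz2 L f -> lipschitz2 L (fun s t => f t s).
  by move=> fL ? ? ? ?; rewrite [X in L * X]addrC; apply: fL.
have YB l N i j : (0 < N)%N -> `|mean_slope (Y l) N i j| <= 3 * L.
  case: l => [[] []] NN; rewrite /Y /=.
  - exact: mean_slope_le X1P xL NN.
  - by rewrite -(mean_slope_swap X2); apply: mean_slope_le X2P (swapL _ xL) NN.
  - exact: mean_slope_le U1P uL NN.
  - by rewrite -(mean_slope_swap U2); apply: mean_slope_le U2P (swapL _ uL) NN.
pose C := 8 * L + 528 * L ^+ 3.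
have C0 : 0 <= C by rewrite addr_ge0 ?mulr_ge0 ?ler0n ?exprn_ge0.
have [eta [eta0 eta1 etaC]] : exists eta : R, [/\ 0 < eta, eta <= 1 & C * eta <= theta / 2].
  exists (Num.min 1 (theta / (2 * (C + 1)))); have D0 : 0 < 2 * (C + 1) by lra.
  rewrite lt_min ltr01 divr_gt0// ge_min lexx; split=> //.
  have [|] := lerP 1 (theta / (2 * (C + 1))).
    rewrite ler_pdivlMr//; lra.
  move=> _; rewrite mulrA ler_pdivrMr//; nra.
have e3 : 0 < eta ^+ 3 by rewrite exprn_gt0.
have [d [d0 de dL]] : exists d : R, [/\ 0 < d, 2 * d <= eta ^+ 3 / 2 & 4 * L ^+ 2 * d <= theta / 2].
  have L2 : 0 <= L ^+ 2 by rewrite sqr_ge0.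
  have D0 : 0 < 8 * (L ^+ 2 + 1) by lra.
  exists (Num.min (eta ^+ 3 / 4) (theta / (8 * (L ^+ 2 + 1)))).
  split; first by rewrite lt_min !divr_gt0.
    have : Num.min (eta ^+ 3 / 4) (theta / (8 * (L ^+ 2 + 1))) <= eta ^+ 3 / 4 by rewrite ge_min lexx.
    lra.
  have : Num.min (eta ^+ 3 / 4) (theta / (8 * (L ^+ 2 + 1))) <= theta / (8 * (L ^+ 2 + 1)).
    by rewrite ge_min lexx orbT.
  rewrite ler_pdivlMr//; set m := Num.min _ _ => mle.
  have m0 : 0 <= m by rewrite le_min !divr_ge0 ?ltW.
  nra.
have [K K0 KL] : exists2 K, (0 < K)%N & 12 * L / K%:R <= eta ^+ 3 / 2.
  exists (Num.bound `|24 * L / eta ^+ 3|).+1 => //.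
  rewrite ler_pdivrMr ?ltr0n// -ler_pdivrMl ?divr_gt0//.
  rewrite (_ : (eta ^+ 3 / 2)^-1 * (12 * L) = 24 * L / eta ^+ 3); last by field; rewrite gt_eqF.
  rewrite (le_trans (ler_norm _))// -[X in _ <= X]natr1 ler_wpDr// ltW//.
  by rewrite archi_boundP.
have [N NN Nbad] := most_cells_slope_constant YB d0 K0 N00.
exists N => //; set bad := finset _ in Nbad.
have Ngt : (0 < N)%N by apply: leq_trans NN.
have NR : 0 < N%:R :> R by rewrite ltr0n.
have NI : 0 < N%:R^-1 :> R by rewrite invr_gt0.
have corner m : m.+1%:R / N%:R = m%:R / N%:R + N%:R^-1 :> R by rewrite -natr1 mulrDl mul1r.
have lip2 f : lipschitz2 L f -> forall (q : 'I_N * 'I_N) s t s' t', in_cell N q.1 q.2 s t ->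
    in_cell N q.1 q.2 s' t' -> `|f s' t' - f s t| <= 2 * L / N%:R.
  move=> fL q s t s' t' [] + + []; rewrite !corner => sh th sh' th'.
  apply: le_trans (fL _ _ _ _) _.
  have E1 := itv_dist_le sh sh'; have E2 := itv_dist_le th th'.
  apply: (@le_trans _ _ (L * (N%:R^-1 + N%:R^-1))); last by lra.
  by rewrite ler_wpM2l// lerD.
have /choice[F HF] : forall q : 'I_N * 'I_N, exists p : R * R,
  [/\ 0 <= p.1 <= 2 * (L + 1) / N%:R, 0 <= p.2,
      p.1 * p.2 <= (C * eta + (q \in bad)%:R * (4 * L ^+ 2)) * N%:R^-1 ^+ 2,
      (forall s t, in_cell N q.1 q.2 s t ->
         `|x s t - x (q.1%:R / N%:R) (q.2%:R / N%:R)| <= p.1)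
    & (forall s t s' t', in_cell N q.1 q.2 s t -> in_cell N q.1 q.2 s' t' ->
         x s t = x s' t' -> `|u s' t' - u s t| <= p.2)].
  move=> q; have [qbad|qgood] := boolP (q \in bad).
    exists (2 * L / N%:R, 2 * L / N%:R) => /=; split.
    - apply/andP; split; first by rewrite !mulr_ge0// ltW.
      by rewrite ler_wpM2r ?ltW//; lra.
    - by rewrite !mulr_ge0// ltW.
    - rewrite mul1r (_ : 2 * L / N%:R * (2 * L / N%:R) = 4 * L ^+ 2 * N%:R^-1 ^+ 2); last by ring.
      rewrite ler_wpM2r ?exprn_ge0 ?(ltW NI)//.
      have : 0 <= C * eta by rewrite mulr_ge0// ltW.
      lra.
    - move=> s t st; apply: (lip2 x xL q) => //.
      by split; rewrite !corner; apply/andP; split; lra.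
    - by move=> s t s' t' st st' _; apply: (lip2 u uL q).
  have good l a b : (a < K)%N -> (b < K)%N ->
      `|mean_slope (Y l) (N * K) (q.1 * K + a) (q.2 * K + b) - mean_slope (Y l) N q.1 q.2| <= d.
    move=> aK bK; rewrite leNgt; apply: contra qgood => ab; rewrite inE.
    by apply/existsP; exists l; apply/existsP; exists (Ordinal aK); apply/existsP; exists (Ordinal bK).
  have aff Z1 Z2 f : prim2 L Z1 f -> prim2 L (fun s t => Z2 t s) (fun s t => f t s) ->
      lipschitz2 L f ->
      (forall a b : 'I_K, `|mean_slope Z1 (N * K) (q.1 * K + a) (q.2 * K + b) - mean_slope Z1 N q.1 q.2| <= d) ->
      (forall a b : 'I_K, `|mean_slope Z2 (N * K) (q.1 * K + a) (q.2 * K + b) - mean_slope Z2 N q.1 q.2| <= d) ->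
      forall s t, q.1%:R / N%:R <= s <= q.1%:R / N%:R + N%:R^-1 ->
        q.2%:R / N%:R <= t <= q.2%:R / N%:R + N%:R^-1 ->
      `|f s t - f (q.1%:R / N%:R) (q.2%:R / N%:R) - mean_slope Z1 N q.1 q.2 * (s - q.1%:R / N%:R)
     - mean_slope Z2 N q.1 q.2 * (t - q.2%:R / N%:R)| <= eta ^+ 3 * N%:R^-1.
    move=> P1 P2 fL g1 g2 s t sh th.
    apply: le_trans (near_affine P1 P2 fL Ngt K0 (ltW d0) g1 g2 _) _.
      by rewrite /in_cell !corner.
    by rewrite ler_wpM2r ?(ltW NI)//; lra.
  have xA := aff _ _ _ X1P X2P xL (fun a b => good (true, true) a b (ltn_ord a) (ltn_ord b))
     (fun a b => good (true, false) a b (ltn_ord a) (ltn_ord b)).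
  have uA := aff _ _ _ U1P U2P uL (fun a b => good (false, true) a b (ltn_ord a) (ltn_ord b))
     (fun a b => good (false, false) a b (ltn_ord a) (ltn_ord b)).
  have eta01 : 0 < eta <= 1 by rewrite eta0.
  have [rho [beta [H1 H2 H3 H4 H5]]] := cell_bound L0 NI eta01 xL uL vP
    (YB (true, true) _ _ _ Ngt) (YB (true, false) _ _ _ Ngt)
    (YB (false, true) _ _ _ Ngt) (YB (false, false) _ _ _ Ngt) xA uA.
  exists (rho, beta); split => //=.
  - by rewrite mul0r addr0.
  - by move=> s t []; rewrite !corner; apply: H4.
  - by move=> s t s' t' [] + + []; rewrite !corner; apply: H5.
exists (fun q => (F q).1), (fun q => (F q).2); split.
- by move=> q; case: (HF q).
- by move=> q; case: (HF q).
- apply: (@le_trans _ _ (\sum_(q : 'I_N * 'I_N) (C * eta + (q \in bad)%:R * (4 * L ^+ 2)) * N%:R^-1 ^+ 2)).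
    by apply: ler_sum => q _; case: (HF q).
  have sumbad : \sum_(q : 'I_N * 'I_N) (q \in bad)%:R = #|bad|%:R :> R.
    rewrite -sum1_card natr_sum [RHS]big_mkcond; apply: eq_bigr => q _.
    by case: (q \in bad).
  rewrite -mulr_suml big_split /= sumr_const card_prod card_ord -mulr_suml sumbad.
  have NN1 : N%:R ^+ 2 * N%:R^-1 ^+ 2 = 1 :> R by rewrite -exprMn mulfV ?expr1n ?gt_eqF.
  rewrite -[X in X + _]mulr_natr natrM -expr2 mulrDl -mulrA NN1 mulr1.
  have : #|bad|%:R * (4 * L ^+ 2) * N%:R^-1 ^+ 2 <= d * N%:R ^+ 2 * (4 * L ^+ 2) * N%:R^-1 ^+ 2.
    by rewrite ler_wpM2r ?exprn_ge0 ?(ltW NI)// ler_wpM2r ?mulr_ge0 ?sqr_ge0.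
  rewrite (_ : d * _ * _ * _ = d * (4 * L ^+ 2) * (N%:R ^+ 2 * N%:R^-1 ^+ 2)); last by ring.
  rewrite NN1; lra.
- by move=> q; case: (HF q).
- by move=> q; case: (HF q).
Qed.

End Grid.

(** * Following a level set across a strip *)

Section Meas.
Variable R : realType.
Local Notation mu := (@lebesgue_measure R).

(** The sum is integrated over c: the cell q contributes for the levels in an
    interval of length 2 rho q only. *)
Lemma level_selection (I : finType) (y rho beta : I -> R) (c0 c1 e : R) :
  c0 < c1 -> (forall q, 0 <= rho q) -> (forall q, 0 <= beta q) ->
  2 * (\sum_q rho q * beta q) < e * (c1 - c0) ->
  exists2 c, c0 <= c < c1 & \sum_(q | `|c - y q| <= rho q) beta q <= e.
Proof.
move=> c01 rho0 beta0; apply: contraPP => no; apply/negP; rewrite -leNgt.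
have big c : c0 <= c < c1 -> e <= \sum_(q | `|c - y q| <= rho q) beta q.
  by move=> cc; rewrite leNgt; apply/negP => h; apply: no; exists c => //; exact: ltW.
have [e0|e0] := ltP e 0.
  have : 0 <= \sum_q rho q * beta q by apply: sumr_ge0 => q _; rewrite mulr_ge0.
  nra.
pose J q := [set` `[y q - rho q, y q + rho q]] : set R.
pose D := [set` `[c0, c1[] : set R.
have mD : measurable D by exact: measurable_itv.
have muD : mu D = (c1 - c0)%:E by rewrite /D lebesgue_measure_itv /= lte_fin c01.
rewrite -lee_fin EFinM -muD -integral_cst//.
pose S c := (\sum_(q : I) (beta q)%:E * (\1_(J q) c)%:E)%E.
apply: (@le_trans _ _ (\int[mu]_(c in D) S c)%E).
  apply: ge0_le_integral => //.
  - apply: emeasurable_sum => q; apply: measurable_funeM; apply/measurable_EFinP.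
    apply: measurable_indic; exact: measurable_itv.
  - move=> c; rewrite /D /= in_itv /= => cc; rewrite /S.
    under eq_bigr do rewrite -EFinM; rewrite sumEFin lee_fin.
    apply: le_trans (big c cc) _; rewrite big_mkcond; apply: ler_sum => q _.
    case: ifP => [cq|_]; last by rewrite mulr_ge0.
    rewrite indicE mem_set ?mulr1// /J /= in_itv /=.
    by rewrite ler_norml in cq; apply/andP; move/andP: cq => [? ?]; split; lra.
rewrite ge0_integral_sum//; last first.
- by move=> q c _; rewrite -EFinM lee_fin mulr_ge0.
- by move=> q; apply: measurable_funeM; apply/measurable_EFinP; apply: measurable_indic; exact: measurable_itv.
rewrite mulr_sumr -sumEFin; apply: lee_sum => q _.
rewrite ge0_integralZl_EFin//; last first.
- by apply/measurable_EFinP; apply: measurable_indic; exact: measurable_itv.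
rewrite integral_indic//; last exact: measurable_itv.
apply: (@le_trans _ _ ((beta q)%:E * mu (J q))%E).
  rewrite lee_wpmul2l ?lee_fin// le_measure ?inE//; last exact: measurable_itv.
  by apply: measurableI; exact: measurable_itv.
rewrite /J lebesgue_measure_itv /= lte_fin; case: ifP => _; last first.
  by rewrite mule0 lee_fin !mulr_ge0.
by rewrite -EFinB -EFinM lee_fin; nra.
Qed.

Lemma lipschitz_continuous (f : R -> R) (L : R) :
  (forall t t' : R, `|f t' - f t| <= L * `|t' - t|) -> continuous f.
Proof.
move=> fL t; apply/cvgrPdist_lt => e e0.
have L0 : 0 <= L.
  by have := fL 0 1; rewrite subr0 normr1 mulr1; apply: le_trans.
have L1 : 0 < L + 1 by lra.
near=> s; rewrite distrC; apply: le_lt_trans (fL _ _) _.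
apply: (@le_lt_trans _ _ ((L + 1) * `|s - t|)); first by rewrite ler_wpM2r//; lra.
rewrite mulrC -ltr_pdivlMr// distrC.
by near: s; apply: cvgr_dist_lt => //; rewrite divr_gt0.
Unshelve. all: by end_near. Qed.

Lemma prim_exists (L : R) (f : R -> R) : 0 <= L -> (forall t t' : R, `|f t' - f t| <= L * `|t' - t|) ->
  exists Y : R -> R, forall t t' : R, 0 <= t -> t <= t' ->
    `|Y t' - Y t - (t' - t) * f t| <= L * (t' - t) ^+ 2.
Proof.
move=> L0 fL.
have fc : continuous f by exact: lipschitz_continuous fL.
have fi (a b : R) : mu.-integrable `[a, b] (EFin \o f).
  apply: continuous_compact_integrable; first exact: segment_compact.
  exact: continuous_subspaceT.
have ci (a b c : R) : mu.-integrable `]a, b] (EFin \o cst c).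
  have : mu.-integrable `[a, b] (EFin \o cst c).
    apply: continuous_compact_integrable; first exact: segment_compact.
    by apply: continuous_subspaceT => x; exact: cvg_cst.
  by apply: integrableS => //; apply: subset_itvr; rewrite bnd_simp.
exists (fun t => \int[mu]_(r in `[0%R, t]) f r)%R => t t' t0 tt.
rewrite Rintegral_itvB//.
have it : mu.-integrable `]t, t'] (EFin \o f).
  by apply: integrableS (fi t t') => //; apply: subset_itvr; rewrite bnd_simp.
have muE : mu `]t, t'] = (t' - t)%:E.
  rewrite lebesgue_measure_itv /= lte_fin; case: ltP => [//|tt'].
  by have -> : t' = t; [apply/eqP; rewrite eq_le tt tt'|rewrite subrr].
have Ec c : (\int[mu]_(r in `]t, t']) c)%R = c * (t' - t).
  rewrite Rintegral_cst; last exact: measurable_itv.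
  congr (_ * _); exact: (congr1 fine muE).
have idf : mu.-integrable `]t, t'] (EFin \o (fun r => f r - f t)).
  exact: (integrableB _ it (ci _ _ _)).
rewrite mulrC -Ec -RintegralB//; last exact: ci.
apply: le_trans (le_normr_Rintegral _ _) _ => //.
rewrite expr2 mulrA -Ec.
apply: le_Rintegral => //; [exact: (integrable_norm idf)|exact: ci|].
move=> r /=; rewrite in_itv /= => /andP[tr rt].
apply: le_trans (fL _ _) _; rewrite ler_wpM2l// ger0_norm; lra.
Qed.
End Meas.

Section Planar.
Variable R : realType.

Lemma lipschitz_IVT (f : R -> R) (L a b c : R) : a <= b ->
  (forall t t' : R, `|f t' - f t| <= L * `|t' - t|) ->
  (f a <= c <= f b) \/ (f b <= c <= f a) -> exists2 t, a <= t <= b & f t = c.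
Proof.
move=> ab fL fc; have [||t] := @IVT R f a b c ab.
- by apply: continuous_subspaceT; apply: lipschitz_continuous fL.
- case: fc => /andP[h1 h2].
    by rewrite ge_min h1 le_max h2 orbT.
  by rewrite ge_min h1 le_max h2 orbT.
by rewrite in_itv /= => tab ft; exists t.
Qed.

Lemma lipschitz_prims (L : R) (f : R -> R -> R) : 0 <= L -> lipschitz2 L f -> has_prims L f.
Proof.
move=> L0 fL.
have /choice[Y1 H1] : forall s, exists Y : R -> R, forall t t' : R, 0 <= t -> t <= t' ->
    `|Y t' - Y t - (t' - t) * f s t| <= L * (t' - t) ^+ 2.
  by move=> s; apply: prim_exists => // t t'; have := fL s t s t'; rewrite subrr normr0 add0r.
have /choice[Y2 H2] : forall t, exists Y : R -> R, forall s s' : R, 0 <= s -> s <= s' ->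
    `|Y s' - Y s - (s' - s) * f s t| <= L * (s' - s) ^+ 2.
  by move=> t; apply: prim_exists => // s s'; have := fL s t s' t; rewrite subrr normr0 addr0.
exists Y1, (fun s t => Y2 t s); split; first exact: H1.
by move=> t s s'; apply: H2.
Qed.

Lemma flip_root (f : R -> R) (L c : R) (N i : nat) : (0 < N)%N ->
  (forall t t' : R, `|f t' - f t| <= L * `|t' - t|) ->
  (c < f (i%:R / N%:R)) (+) (c < f (i.+1%:R / N%:R)) ->
  exists2 t, i%:R / N%:R <= t <= i.+1%:R / N%:R & f t = c.
Proof.
move=> N0 fL fc; apply: lipschitz_IVT fL _.
  by rewrite ler_pM2r ?invr_gt0 ?ltr0n// ler_nat.
have [h1|h1] := boolP (c < f (i%:R / N%:R)); rewrite ?h1 ?(negbTE h1) /= in fc.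
  by right; rewrite (ltW h1) leNgt fc.
by left; rewrite (ltW fc) leNgt h1.
Qed.

(** Two consecutive cells of the interface between x <= c and c < x share a
    point of the level set x = c. From such a point to the next one, x does not
    change, w 1 changes by at most beta q, and w j.+1 changes by o(1 / N) because
    dx = 0. The total change is small by the choice of c. *)
Lemma level_chain (k : nat) (L : R) (w : nat -> R -> R -> R) (c0 c1 : R) :
  (0 < k)%N -> 0 <= L -> (forall j, lipschitz2 L (w j)) ->
  (forall j, (0 < j <= k)%N -> primitive_of (w 0%N) (w j) (w j.+1)) ->
  c0 < c1 -> (forall t : R, 0 <= t <= 1 -> w 0%N 0 t <= c0) ->
  (forall t : R, 0 <= t <= 1 -> c1 <= w 0%N 1 t) ->
  forall e : R, 0 < e -> exists s s' : R, [/\ 0 <= s <= 1, 0 <= s' <= 1 &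
    forall j, (j <= k.+1)%N -> `|w j s' 1 - w j s 0| <= e].
Proof.
move=> k0 L0 wL wP c01 wleft wright e e0.
set x := w 0%N.
have d0 : 0 < c1 - c0 by lra.
have ed0 : 0 < e * (c1 - c0) by rewrite mulr_gt0.
pose tau := e * (c1 - c0) / (32 * (L + 1)).
have L1 : 0 < L + 1 by lra.
have tau0 : 0 < tau by rewrite divr_gt0// mulr_gt0.
have tauE : 4 * (L + 1) * tau = e * (c1 - c0) / 8 by rewrite /tau; field; lra.
have [r r0 Hr] : exists2 r, 0 < r & forall j, (0 < j <= k)%N ->
    forall s t s' t', `|s' - s| + `|t' - t| < r ->
    `|w j.+1 s' t' - w j.+1 s t - w j s t * (x s' t' - x s t)| <= tau * (`|s' - s| + `|t' - t|).
  elim: k {k0} wP => [_|k IH wP]; first by exists 1 => // j; case: j.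
  have [|r1 r10 H1] := IH.
    by move=> j /andP[? ?]; apply: wP; apply/andP; split=> //; apply: leqW.
  have [r2 r20 H2] := wP k.+1 (leqnn _) tau tau0.
  exists (Num.min r1 r2); first by rewrite lt_min r10.
  move=> j /andP[j0 jk] s t s' t'; rewrite lt_min => /andP[h1 h2].
  move: jk; rewrite leq_eqVlt => /orP[/eqP ->|jk]; first exact: H2.
  by apply: H1 => //; rewrite j0.
have [N0 N00 N0r] : exists2 N0, (0 < N0)%N & 2 / N0%:R < r.
  exists (Num.bound `|2 / r|).+1 => //.
  rewrite ltr_pdivrMr ?ltr0n// mulrC -ltr_pdivrMr//.
  rewrite (le_lt_trans (ler_norm _))// -[X in _ < X]natr1 ltr_wpDr//.
  by rewrite archi_boundP.
have th0 : 0 < e * (c1 - c0) / 8 by rewrite divr_gt0.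
have P1 : primitive_of x (w 1%N) (w 2%N) by apply: wP.
have [N NN [rho [beta [rhoB beta0 sumB xB uB]]]] :=
  grid_bound L0 th0 N00 (wL 0%N) (wL 1%N) P1 (lipschitz_prims L0 (wL 0%N)) (lipschitz_prims L0 (wL 1%N)).
have Ngt : (0 < N)%N by apply: leq_trans NN.
have NR : 0 < N%:R :> R by rewrite ltr0n.
have NI : 0 < N%:R^-1 :> R by rewrite invr_gt0.
have Nr : 2 / N%:R < r.
  apply: le_lt_trans N0r; rewrite ler_pM2l// lef_pV2 ?posrE ?ltr0n//.
  by rewrite ler_nat.
(* The second term bounds the change of w j for j > 1. It is part of the sum to
   which the level is adapted because the interface may have more than O(N)
   cells at other levels. *)
pose B q := beta q + tau * (2 / N%:R).
have rho0 q : 0 <= rho q by case/andP: (rhoB q).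
have tN0 : 0 <= tau * (2 / N%:R) by rewrite mulr_ge0 ?(ltW tau0)// mulr_ge0// ltW.
have B0 q : 0 <= B q by rewrite addr_ge0.
have [c /andP[cc0 cc1] cB] : exists2 c, c0 <= c < c1 &
    \sum_(q : 'I_N * 'I_N | `|c - x (q.1%:R / N%:R) (q.2%:R / N%:R)| <= rho q) B q <= e.
  (* A level meets at most O(N) cells on average, since the bounds rho q are
     O(1 / N). *)
  apply: level_selection => //.
  under eq_bigr do rewrite mulrDr.
  rewrite big_split /=.
  have : \sum_(q : 'I_N * 'I_N) rho q * (tau * (2 / N%:R)) <= e * (c1 - c0) / 8.
    apply: (@le_trans _ _ (\sum_(q : 'I_N * 'I_N) (2 * (L + 1) / N%:R) * (tau * (2 / N%:R)))).
      by apply: ler_sum => q _; rewrite ler_wpM2r//; case/andP: (rhoB q).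
    rewrite sumr_const card_prod card_ord -[X in X <= _]mulr_natr natrM -tauE le_eqVlt.
    by apply/orP; left; apply/eqP; field; rewrite gt_eqF.
  lra.
pose b i j := c < x (i%:R / N%:R) (j%:R / N%:R).
have unit01 j : (j <= N)%N -> 0 <= (j%:R / N%:R : R) <= 1.
  by move=> jN; rewrite divr_ge0//= ler_pdivrMr// mul1r ler_nat.
have bl j : (j <= N)%N -> b 0%N j = false.
  move=> jN; apply/negbTE; rewrite /b mul0r -leNgt.
  by apply: le_trans cc0; apply: wleft; apply: unit01.
have br j : (j <= N)%N -> b N j = true.
  move=> jN; rewrite /b mulfV ?gt_eqF//; apply: lt_le_trans cc1 _.
  by apply: wright; apply: unit01.
have lipS t s s' : `|x s' t - x s t| <= L * `|s' - s|.
  by have := wL 0%N s t s' t; rewrite subrr normr0 addr0.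
have lipT s t t' : `|x s t' - x s t| <= L * `|t' - t|.
  by have := wL 0%N s t s t'; rewrite subrr normr0 add0r.
have hroot i j : hdoor b i j -> exists2 s, i%:R / N%:R <= s <= i.+1%:R / N%:R & x s (j%:R / N%:R) = c.
  by move=> h; apply: (flip_root Ngt (lipS (j%:R / N%:R))) h.
have vroot i j : vdoor b i j -> exists2 t, j%:R / N%:R <= t <= j.+1%:R / N%:R & x (i%:R / N%:R) t = c.
  by move=> h; apply: (flip_root Ngt (lipT (i%:R / N%:R))) h.
have lo i : i%:R / N%:R <= i.+1%:R / N%:R :> R by rewrite ler_pM2r// ler_nat.
have edgeL (i : nat) : i%:R / N%:R <= (i%:R / N%:R : R) <= i.+1%:R / N%:R by rewrite lo lexx.
have edgeR (i : nat) : i%:R / N%:R <= (i.+1%:R / N%:R : R) <= i.+1%:R / N%:R by rewrite lo lexx.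
have cross (q q' : 'I_N * 'I_N) : through_door b q q' -> exists s t,
    [/\ in_cell N q.1 q.2 s t, in_cell N q'.1 q'.2 s t & x s t = c].
  case/or4P => /and3P[/eqP E1 /eqP E2] d; rewrite /in_cell.
  - have [t th xt] := vroot _ _ d; exists (q'.1%:R / N%:R), t.
    split; [split|split|exact: xt]; [rewrite E2; exact: edgeR|by rewrite E1|exact: edgeL|exact: th].
  - have [t th xt] := vroot _ _ d; exists (q.1%:R / N%:R), t.
    split; [split|split|exact: xt]; [exact: edgeL|exact: th|rewrite E2; exact: edgeR|by rewrite -E1].
  - have [s sh xs] := hroot _ _ d; exists s, (q'.2%:R / N%:R).
    split; [split|split|exact: xs]; [by rewrite E1|rewrite E2; exact: edgeR|exact: sh|exact: edgeL].
  - have [s sh xs] := hroot _ _ d; exists s, (q.2%:R / N%:R).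
    split; [split|split|exact: xs]; [exact: sh|exact: edgeL|by rewrite -E1|rewrite E2; exact: edgeR].
have step (q : 'I_N * 'I_N) s t s' t' : in_cell N q.1 q.2 s t -> in_cell N q.1 q.2 s' t' ->
    x s t = c -> x s' t' = c -> forall j, (j <= k.+1)%N -> `|w j s' t' - w j s t| <= B q.
  move=> st st' xs xs' [|[|j]] jk.
  - by rewrite -/x xs xs' subrr normr0.
  - apply: (@le_trans _ _ (beta q)); first by apply: uB st st' _; rewrite -/x xs xs'.
    by rewrite /B lerDl.
  have dist : `|s' - s| + `|t' - t| <= 2 / N%:R.
    have corner m : m.+1%:R / N%:R = m%:R / N%:R + N%:R^-1 :> R by rewrite -natr1 mulrDl mul1r.
    move: st st' => [] + + []; rewrite !corner => sh th sh' th'.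
    have E1 := itv_dist_le sh sh'; have E2 := itv_dist_le th th'.
    by clear -E1 E2; lra.
  have := Hr j.+1 jk s t s' t' (le_lt_trans dist Nr); rewrite xs xs' subrr mulr0 subr0.
  move/le_trans; apply; rewrite /B; apply: (@le_trans _ _ (tau * (2 / N%:R))).
    by rewrite ler_pM2l.
  by rewrite lerDr.
have chain p : forall (q : 'I_N * 'I_N) s t, in_cell N q.1 q.2 s t -> x s t = c ->
    path (through_door b) q p -> (last q p).2.+1 = N -> hdoor b (last q p).1 N ->
    [/\ (exists s', 0 <= s' <= 1 /\ forall j, (j <= k.+1)%N ->
         `|w j s' 1 - w j s t| <= \sum_(q' <- q :: p) B q')
      & {in q :: p, forall q' : 'I_N * 'I_N, `|c - x (q'.1%:R / N%:R) (q'.2%:R / N%:R)| <= rho q'}].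
  elim: p => [|q' p IH] q s t st xs /=.
    move=> _ qN hd; have [s' sh xs'] := hroot _ _ hd.
    have e1 : N%:R / N%:R = (q.2.+1)%:R / N%:R :> R by rewrite qN.
    have s'cell : in_cell N q.1 q.2 s' (N%:R / N%:R) by split=> //; rewrite e1; exact: edgeR.
    split; last by move=> q'; rewrite inE => /eqP ->; rewrite -xs; apply: xB.
    exists s'; split.
      have /andP[h1 _] := unit01 q.1 (ltnW (ltn_ord _)).
      have /andP[_ h2] := unit01 q.1.+1 (ltn_ord _).
      by case/andP: sh => h3 h4; rewrite (le_trans h1 h3) (le_trans h4 h2).
    move=> j jk; rewrite big_seq1 -[1](mulfV (x := N%:R)) ?gt_eqF//.
    exact: step st s'cell xs xs' j jk.
  move=> /andP[qq' pp] lastN hd; have [s1 [t1 [c1' c2' xs1]]] := cross _ _ qq'.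
  have [[s' [s'01 Hs']] Hrho] := IH q' s1 t1 c2' xs1 pp lastN hd.
  split.
    exists s'; split=> // j jk; rewrite big_cons.
    have := Hs' j jk; have := step q s t s1 t1 st c1' xs xs1 j jk.
    have := ler_distD (w j s1 t1) (w j s' 1) (w j s t).
    lra.
  move=> q1; rewrite inE => /orP[/eqP ->|]; last exact: Hrho.
  by rewrite -xs; apply: xB.
have [q [p [q2 hd pp up [lastN hdN]]]] := door_path_bottom_top Ngt bl br.
have [s sh xs] := hroot _ _ hd.
have scell : in_cell N q.1 q.2 s (0%N%:R / N%:R) by split=> //; rewrite q2; exact: edgeL.
have [[s' [s'01 Hs']] Hrho] := chain p q s _ scell xs pp lastN hdN.
exists s, s'; split => //.
  have /andP[h1 _] := unit01 q.1 (ltnW (ltn_ord _)).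
  have /andP[_ h2] := unit01 q.1.+1 (ltn_ord _).
  by case/andP: sh => h3 h4; rewrite (le_trans h1 h3) (le_trans h4 h2).
move=> j jk; have := Hs' j jk; rewrite mul0r => /le_trans; apply.
apply: le_trans cB; rewrite big_uniq//= [X in _ <= X]big_mkcond [X in X <= _]big_mkcond.
apply: ler_sum => q' _; case: ifP => [q'p|_]; last by case: ifP.
by rewrite Hrho.
Qed.

(** The sum of the distances of the coordinates attains its minimum over the pairs
    of points of the two sides, by compactness, and [level_chain] makes it 0. *)
Lemma strip_collapse (k : nat) (L : R) (w : nat -> R -> R -> R) (c0 c1 : R) :
  (0 < k)%N -> 0 <= L -> (forall j, lipschitz2 L (w j)) ->
  (forall j, (0 < j <= k)%N -> primitive_of (w 0%N) (w j) (w j.+1)) ->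
  c0 < c1 -> (forall t : R, 0 <= t <= 1 -> w 0%N 0 t <= c0) ->
  (forall t : R, 0 <= t <= 1 -> c1 <= w 0%N 1 t) ->
  exists s s' : R, [/\ 0 <= s <= 1, 0 <= s' <= 1 &
    forall j, (j <= k.+1)%N -> w j s 0 = w j s' 1].
Proof.
move=> k0 L0 wL wP c01 wleft wright.
have [[s s'] /set_mem[/= sI s'I] Fmin] : exists2 z : R * R, z \in `[0%R, 1%R] `*` `[0%R, 1%R] &
    forall z', z' \in `[0%R, 1%R] `*` `[0%R, 1%R] ->
    \sum_(j < k.+2) `|w j z.2 1 - w j z.1 0| <= \sum_(j < k.+2) `|w j z'.2 1 - w j z'.1 0|.
  apply: (@compact_EVT_min _ _ (fun z : R * R => \sum_(j < k.+2) `|w j z.2 1 - w j z.1 0|)).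
  - by exists (0, 0); split; rewrite /= in_itv /= lexx ler01.
  - by apply: compact_setX; exact: segment_compact.
  - apply: continuous_subspaceT => z; apply: cvg_big => [|j _]; first exact: add_continuous.
    have wc t : continuous (fun s => w j s t).
      apply: (@lipschitz_continuous _ _ L) => a a'.
      by have := wL j a t a' t; rewrite subrr normr0 addr0.
    apply: cvg_norm; apply: cvgB.
      by apply: (@cvg_comp _ _ _ snd (fun s => w j s 1) _ (nbhs z.2)); [exact: cvg_snd|exact: wc].
    by apply: (@cvg_comp _ _ _ fst (fun s => w j s 0) _ (nbhs z.1)); [exact: cvg_fst|exact: wc].
exists s, s'; move: sI s'I; rewrite /= !in_itv /= => sI s'I; split=> // j jk.
have F0 : \sum_(j < k.+2) `|w j s' 1 - w j s 0| <= 0.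
  apply/ler_addgt0Pr => e e0; rewrite add0r.
  have e'0 : 0 < e / k.+2%:R by rewrite divr_gt0.
  have [s1 [s1' [h1 h1' H]]] := level_chain k0 L0 wL wP c01 wleft wright e'0.
  have := Fmin (s1, s1'); rewrite inE /= => /(_ _)/le_trans; apply.
    by split; rewrite /= in_itv.
  apply: (@le_trans _ _ (\sum_(j < k.+2) e / k.+2%:R)).
    by apply: ler_sum => i _; apply: H; rewrite -ltnS.
  by rewrite sumr_const card_ord -[X in X <= _]mulr_natr divfK// pnatr_eq0.
have : `|w j s' 1 - w j s 0| <= 0.
  apply: le_trans F0; rewrite (bigD1 (Ordinal (jk : (j < k.+2)%N)))//= lerDl.
  exact: sumr_ge0.
by rewrite normr_le0 subr_eq0 => /eqP.
Qed.
End Planar.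

Section Strip.
Variable R : realType.

Lemma primitive_of_cst (x u v : R -> R -> R) : (forall s t s' t', x s t = x s' t') ->
  primitive_of x u v -> forall s t s' t', v s t = v s' t'.
Proof.
move=> xc vP.
have along (psi : R -> R) : (forall e : R, 0 < e -> exists2 r : R, 0 < r & forall t t',
    `|t' - t| < r -> `|psi t' - psi t| <= e * `|t' - t|) -> forall a b : R, psi a = psi b.
  move=> H.
  have le (a b : R) : a <= b -> psi a = psi b.
    move=> ab; have : `|psi b - psi a| <= 0 * (b - a).
      apply: local_to_global => // e e0; have [r r0 Hr] := H e e0; exists r => // t t' _ tt' _ tr.
      by have := Hr t t'; rewrite add0r ger0_norm ?subr_ge0//; apply.
    by rewrite mul0r normr_le0 subr_eq0 => /eqP.
  by move=> a b; have [/le//|/ltW/le] := leP a b.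
move=> s t s' t'; rewrite (along (fun s => v s t) _ s s') ?(along (fun t => v s' t) _ t t')//.
  move=> e e0; have [r r0 Hr] := vP e e0; exists r => // a a' aa.
  by have := Hr s' a s' a'; rewrite subrr normr0 add0r (xc s' a' s' a) subrr mulr0 subr0; apply.
move=> e e0; have [r r0 Hr] := vP e e0; exists r => // a a' aa.
by have := Hr a t a' t; rewrite subrr normr0 addr0 (xc a' t a t) subrr mulr0 subr0; apply.
Qed.

(** When w 0 is constant, the relations force w 2, ..., w k.+1 to be constant,
    and w 1 takes the value c0 on the bottom and on the top. *)
Lemma strip_collapse_cst (k : nat) (L : R) (w : nat -> R -> R -> R) (c0 c1 : R) :
  (forall s t s' t', w 0%N s t = w 0%N s' t') -> lipschitz2 L (w 1%N) ->
  (forall j, (0 < j <= k)%N -> primitive_of (w 0%N) (w j) (w j.+1)) ->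
  c0 < c1 -> (forall t : R, 0 <= t <= 1 -> w 1%N 0 t <= c0) ->
  (forall t : R, 0 <= t <= 1 -> c1 <= w 1%N 1 t) ->
  exists s s' : R, [/\ 0 <= s <= 1, 0 <= s' <= 1 &
    forall j, (j <= k.+1)%N -> w j s 0 = w j s' 1].
Proof.
move=> w0 wL wP c01 wl wr.
have root (t : R) : 0 <= t <= 1 -> exists2 s : R, 0 <= s <= 1 & w 1%N s t = c0.
  move=> t01; apply: (@lipschitz_IVT R (fun s => w 1%N s t) L) => //.
    by move=> s s'; have := wL s t s' t; rewrite subrr normr0 addr0.
  by left; rewrite wl//=; apply: le_trans (wr t t01); exact: ltW.
have z01 : 0 <= (0 : R) <= 1 by rewrite lexx ler01.
have o01 : 0 <= (1 : R) <= 1 by rewrite lexx ler01.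
have [s s01 sE] := root 0 z01; have [s' s'01 s'E] := root 1 o01.
exists s, s'; split=> // -[|[|j]] jk; [exact: w0|by rewrite sE s'E|].
by apply: (primitive_of_cst w0 (wP j.+1 _)).
Qed.

End Strip.

(** * Increments of absolutely continuous functions *)

Section AC.
Variable R : realType.
Local Notation mu := (@lebesgue_measure R).

(** By completeness: the supremum of the points where P holds is one of them, and
    it can only be b. *)
Lemma real_induction (P : R -> Prop) (a b : R) : a <= b -> P a ->
  (forall t, a <= t <= b -> exists2 h : R, 0 < h &
     (forall s, a <= s < t -> t - h < s -> P s -> P t) /\
     (forall s, t < s <= b -> s < t + h -> P t -> P s)) -> P b.
Proof.
move=> ab Pa step; pose S := [set t | a <= t <= b /\ P t].
have Sa : S a by split=> //; rewrite lexx.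
have hS : has_sup S by split; [exists a | exists b => t [/andP[]]].
have supSb : sup S <= b by apply: ge_sup; [exists a|move=> t [/andP[]]].
have supSa : a <= sup S by apply: ub_le_sup => //; case: hS.
have supSab : a <= sup S <= b by rewrite supSa supSb.
have [h h0 [below above]] := step (sup S) supSab.
have Psup : P (sup S).
  have [s [/andP[sa sb] Ps] hs] := sup_adherent h0 hS.
  have : s <= sup S by apply: ub_le_sup; [case: hS|split=> //; rewrite sa].
  rewrite le_eqVlt => /orP[/eqP <- //|slt].
  by apply: below Ps => //; rewrite sa.
move: supSb; rewrite le_eqVlt => /orP[/eqP <- //|supb].
pose s := Num.min (sup S + h / 2) b.
have sS : sup S < s by rewrite lt_min supb andbT ltrDl divr_gt0.
have sb : s <= b by rewrite ge_min lexx orbT.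
have Ps : P s.
  apply: above => //; first by rewrite sS.
  by rewrite gt_min ltrD2l ltr_pdivrMr// mulr_natr mulr2n ltrDl h0.
have : s <= sup S by apply: ub_le_sup; [case: hS|split=> //; rewrite sb (le_trans supSa (ltW sS))].
by rewrite leNgt sS.
Qed.

Definition ac_fun (a b : R) (y : R -> R) : Prop :=
  forall eps : R, 0 < eps -> exists2 delta : R, 0 < delta &
    forall (m : nat) (l r : 'I_m -> R),
      (forall i, a <= l i /\ l i <= r i /\ r i <= b) ->
      trivIset setT (fun i => `]l i, r i[%classic) ->
      \sum_(i < m) (r i - l i) < delta ->
      \sum_(i < m) `|y (r i) - y (l i)| < eps.

(** Nonoverlapping intervals contained in O, between a and t, listed from right
    to left: thus a chain is extended on the right as t increases. *)
Fixpoint chain (O : set R) (a t : R) (F : seq (R * R)) : Prop :=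
  if F is lr :: F' then
    [/\ a <= lr.1, lr.1 <= lr.2, lr.2 <= t, `]lr.1, lr.2[%classic `<=` O & chain O a lr.1 F']
  else True.

Lemma chain_le (O : set R) (a t t' : R) (F : seq (R * R)) : t <= t' -> chain O a t F -> chain O a t' F.
Proof. by move=> tt; case: F => // -[l r] F /= [? ? rt ? ?]; split=> //; apply: le_trans tt. Qed.

Lemma chain_nth (O : set R) (a t : R) (F : seq (R * R)) : chain O a t F -> forall i, (i < size F)%N ->
  let q := nth (0, 0) F i in
  [/\ a <= q.1, q.1 <= q.2, q.2 <= t, `]q.1, q.2[%classic `<=` O &
      forall j, (i < j < size F)%N -> (nth (0, 0) F j).2 <= q.1].
Proof.
elim: F t => // -[l r] F IH t /= [al lr rt sub cF] [|i] iF /=.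
  split=> // -[|j]// /andP[_ jF] /=.
  by have [_ _ ? _ _] := IH _ cF j jF.
have [A1 A2 A3 A4 A5] := IH _ cF i iF.
split=> //; first by rewrite (le_trans A3)// (le_trans lr).
by case=> // j; apply: A5.
Qed.

Lemma ac_chain (O : set R) (a b : R) (y : R -> R) (eps : R) : ac_fun a b y -> 0 < eps -> exists2 delta : R, 0 < delta &
  forall F, chain O a b F -> \sum_(q <- F) (q.2 - q.1) < delta ->
     \sum_(q <- F) `|y q.2 - y q.1| < eps.
Proof.
move=> yac e0; have [d d0 H] := yac eps e0; exists d => // F cF.
rewrite !(big_nth (0, 0)) !big_mkord => Fd.
have nF := chain_nth cF.
apply: (H (size F) (fun i => (nth (0, 0) F i).1) (fun i => (nth (0, 0) F i).2)) => //.
  by move=> i; have [] := nF i (ltn_ord i).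
apply/trivIsetP => i j _ _ ij.
have disj (i1 j1 : 'I_(size F)) : (i1 < j1)%N ->
   `](nth (0, 0) F i1).1, (nth (0, 0) F i1).2[%classic `&`
   `](nth (0, 0) F j1).1, (nth (0, 0) F j1).2[%classic = set0.
  move=> lij; have [_ _ _ _ /(_ j1)] := nF i1 (ltn_ord i1).
  rewrite lij ltn_ord => /(_ isT) rl; apply/seteqP; split=> // x /=; rewrite !in_itv /=.
  by move=> [/andP[h1 _] /andP[_ h2]]; have := lt_trans h1 h2; rewrite ltNge rl.
by move: ij; rewrite neq_ltn => /orP[|]/disj //; rewrite setIC.
Qed.

Lemma chain_measure (O : set R) (a t : R) (F : seq (R * R)) : open O -> a <= t -> chain O a t F ->
  ((\sum_(q <- F) (q.2 - q.1))%:E <= mu (O `&` `]a, t[))%E.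
Proof.
move=> oO; have mO : measurable O by exact: open_measurable.
elim: F t => [|[l r] F IH] t at_ /=; first by rewrite big_nil.
move=> [al lr rt sub cF]; rewrite big_cons /= EFinD.
have IHl := IH _ al cF.
apply: (@le_trans _ _ (mu `]l, r[ + mu (O `&` `]a, l[))%E).
  by rewrite leeD// lebesgue_measure_itv /= lte_fin -EFinB; case: ltP => // ?; rewrite lee_fin subr_le0.
rewrite -measureU//; last 2 first.
- by apply: measurableI => //; exact: measurable_itv.
- apply/seteqP; split=> // x [] /=; rewrite !in_itv /= => /andP[h1 _] [_ /andP[_ h2]].
  by have := lt_trans h1 h2; rewrite ltxx.
apply: le_measure; rewrite ?inE.
- apply: measurableU; first exact: measurable_itv.
  by apply: measurableI => //; exact: measurable_itv.
- by apply: measurableI => //; exact: measurable_itv.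
move=> x [/=|[/=]]; rewrite !in_itv /=.
  move=> h; split; first by apply: sub; rewrite /= in_itv.
  by case/andP: h => h1 h2; rewrite (le_lt_trans al h1) (lt_le_trans h2 rt).
move=> Ox /andP[h1 h2]; split=> //; rewrite h1 (lt_le_trans h2)// (le_trans lr)//.
Qed.

Lemma derivable_slope (f : R -> R) (t e : R) : derivable f t 1 -> 0 < e ->
  exists2 h : R, 0 < h & forall s, `|s - t| < h -> 
    `|f s - f t - 'D_1 f t * (s - t)| <= e * `|s - t|.
Proof.
move=> df e0.
have /cvgrPdist_le/(_ e e0)/nbhs_ballP[h /= h0 H] := df.
exists h => // s sh; have [->|st] := eqVneq s t.
  by rewrite !subrr mulr0 subrr normr0 mulr0.
have st0 : s - t != 0 by rewrite subr_eq0.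
have := H (s - t); rewrite /ball /= sub0r normrN => /(_ sh st0).
rewrite /= [(s - t)%:A]mulr1 subrK => H1.
have -> : f s - f t - 'D_1 f t * (s - t) = - ('D_1 f t - (s - t)^-1 * (f s - f t)) * (s - t).
  by field.
by rewrite normrM normrN; apply: ler_wpM2r => //; exact: H1.
Qed.

(** By real induction on t, y t - y a is at most z t - z a + e (t - a) plus the
    variation of y along a chain in an open set O of small measure which
    contains N. Off N the derivatives give the step; at a point of N an
    interval is added to the chain, z being monotone. The variation along the
    chain is small because y is absolutely continuous. *)
Lemma ac_increment_le (a b : R) (y z : R -> R) (N : set R) : a <= b -> ac_fun a b y ->
  (forall s t, a <= s -> s <= t -> t <= b -> z s <= z t) ->
  measurable N -> mu N = 0%E ->
  (forall t, a < t < b -> ~ N t -> [/\ derivable y t 1, derivable z t 1 & 'D_1 y t <= 'D_1 z t]) ->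
  y b - y a <= z b - z a.
Proof.
move=> ab yac zmon mN N0 yz; apply/ler_addgt0Pr => e' e'0.
have [e e0 ee'] : exists2 e : R, 0 < e & e * (b - a) + e <= e'.
  exists (e' / (b - a + 1)); first by rewrite divr_gt0// ltr_wpDl// subr_ge0.
  have ba1 : b - a + 1 != 0 by rewrite gt_eqF// ltr_wpDl// subr_ge0.
  by rewrite -[X in _ + X]mulr1 -mulrDr divfK.
(* The derivatives at the end points are not controlled, so these points are
   treated as points of N. *)
pose N' := N `|` [set a] `|` [set b].
have mN' : measurable N' by apply: measurableU; [apply: measurableU|].
have muN' : mu N' = 0%E.
  rewrite /N' measureU0//; [rewrite measureU0//; exact: lebesgue_measure_set1|exact: measurableU|exact: lebesgue_measure_set1].
have [d d0 yd] : exists2 delta : R, 0 < delta & forall O F, chain O a b F ->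
    \sum_(q <- F) (q.2 - q.1) < delta -> \sum_(q <- F) `|y q.2 - y q.1| < e.
  have [d d0 H] := ac_chain setT yac e0; exists d => // O F cF; apply: H.
  have sub t G : chain O a t G -> chain setT a t G.
    by elim: G t => // -[l r] G IH t /= [? ? ? _ ?]; split=> //; apply: IH.
  exact: sub cF.
have [ O [oO NO muO]] : exists O : set R, [/\ open O, N' `<=` O & (mu O < d%:E)%E].
  have fin : (mu N' < +oo)%E by rewrite muN'.
  have [ O [oO NO muO]] := lebesgue_regularity_outer mN' fin d0.
  exists O; split=> //; rewrite -(setDUK NO) measureU//; last 2 first.
  - by apply: measurableD => //; exact: open_measurable.
  - by rewrite setDIK.
  by rewrite [X in (X + _)%E](_ : _ = 0%E) ?add0e//; exact: muN'.
pose P t := exists2 F, chain O a t F &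
  z a - y a <= z t - y t + e * (t - a) + \sum_(q <- F) `|y q.2 - y q.1|.
have Pb : P b.
  apply: real_induction ab _ _.
    by exists [::] => //; rewrite big_nil subrr mulr0 !addr0.
  move=> t /andP[at_ tb].
  have [tN|tN] := pselect (N' t).
    have /nbhs_ballP[h /= h0 hO] : nbhs t O by apply: open_nbhs_nbhs; split=> //; apply: NO.
    exists h => //; split.
      move=> s /andP[as_ st] sh [F cF HF]; exists ((s, t) :: F).
        split=> //=; first exact: ltW.
        move=> x /=; rewrite in_itv /= => /andP[sx xt]; apply: hO.
        by rewrite /ball /= ger0_norm; lra.
      rewrite big_cons /=; have := zmon s t as_ (ltW st) tb.
      have := ler_norm (y t - y s); have : 0 <= e * (t - s) by rewrite mulr_ge0 ?subr_ge0 ?(ltW e0) ?(ltW st).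
      lra.
    move=> s /andP[ts sb] sh [F cF HF]; exists ((t, s) :: F).
      split=> //=; first exact: ltW.
      move=> x /=; rewrite in_itv /= => /andP[tx xs]; apply: hO.
      rewrite /ball /= distrC ger0_norm; lra.
    rewrite big_cons /=; have := zmon t s at_ (ltW ts) sb.
    have := ler_norm (y s - y t); have : 0 <= e * (s - t) by rewrite mulr_ge0 ?subr_ge0 ?(ltW e0) ?(ltW ts).
    lra.
  have ta : t != a by apply/eqP => tE; apply: tN; rewrite tE; left; right.
  have tb' : t != b by apply/eqP => tE; apply: tN; rewrite tE; right.
  have [||dy dz dyz] := yz t; first by rewrite !lt_neqAle tb' tb at_ eq_sym ta.
    by move=> tN'; apply: tN; left; left.
  have e20 : 0 < e / 2 by rewrite divr_gt0.
  have [h1 h10 H1] := derivable_slope dy e20.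
  have [h2 h20 H2] := derivable_slope dz e20.
  exists (Num.min h1 h2); first by rewrite lt_min h10.
  have small s : `|s - t| < Num.min h1 h2 ->
      0 <= s - t -> z t - y t <= z s - y s + e * (s - t).
    rewrite lt_min => /andP[/H1 A1 /H2 A2] st0; move: A1 A2; rewrite (ger0_norm st0) !ler_norml => /andP[? ?] /andP[? ?].
    have : 0 <= ('D_1 z t - 'D_1 y t) * (s - t) by rewrite mulr_ge0// subr_ge0.
    lra.
  have small' s : `|s - t| < Num.min h1 h2 ->
      s - t <= 0 -> z s - y s <= z t - y t + e * (t - s).
    rewrite lt_min => /andP[/H1 A1 /H2 A2] st0; move: A1 A2; rewrite (ler0_norm st0) !ler_norml => /andP[? ?] /andP[? ?].
    have : 0 <= ('D_1 z t - 'D_1 y t) * (t - s) by rewrite mulr_ge0 ?subr_ge0// -subr_le0.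
    lra.
  move: (Num.min h1 h2) small small' => h small small'; split=> s.
    move=> /andP[as_ st] sh [F cF HF]; exists F; first exact: chain_le (ltW st) cF.
    have := small' s; rewrite ltr_norml => /(_ ltac:(apply/andP; split; lra) ltac:(lra)).
    lra.
  move=> /andP[ts sb] sh [F cF HF]; exists F; first exact: chain_le (ltW ts) cF.
  have := small s; rewrite ltr_norml => /(_ ltac:(apply/andP; split; lra) ltac:(lra)).
  lra.
have [F cF HF] := Pb.
have Fd : \sum_(q <- F) (q.2 - q.1) < d.
  rewrite -lte_fin; apply: le_lt_trans (chain_measure oO ab cF) _.
  apply: le_lt_trans muO; apply: le_measure; rewrite ?inE; last exact: subIsetl.
    by apply: measurableI; [exact: open_measurable|exact: measurable_itv].
  exact: open_measurable.
have := yd O F cF Fd; lra.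
Qed.

End AC.

Section AC2.
Variable R : realType.
Local Notation mu := (@lebesgue_measure R).

(** The integral of a nonnegative function is a supremum over the simple
    functions below it, hence monotone for all functions. The speed of a
    horizontal path has no evident measurability. *)
Lemma le_integral_nonmeasurable d (T : measurableType d) (nu : {measure set T -> \bar R})
  (A : set T) (f g : T -> \bar R) : (forall x, A x -> (0 <= f x)%E) ->
  (forall x, A x -> (f x <= g x)%E) -> (\int[nu]_(x in A) f x <= \int[nu]_(x in A) g x)%E.
Proof.
move=> f0 fg.
have g0 x : A x -> (0 <= g x)%E by move=> Ax; apply: le_trans (f0 x Ax) (fg x Ax).
rewrite !ge0_integralE//; apply: ereal_sup_le => _ [h /= hf <-]; exists h => //= x.
apply: le_trans (hf x) _; rewrite /patch; case: ifP => // /set_mem; exact: fg.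
Qed.

Implicit Types (a b s t : R).

Definition clamp (a b t : R) := Num.max a (Num.min t b).

Lemma clamp_itv a b t : a <= b -> a <= clamp a b t <= b.
Proof. by move=> ab; rewrite /clamp le_max lexx ge_max ab ge_min lexx orbT. Qed.

Lemma clamp_id a b t : a <= t <= b -> clamp a b t = t.
Proof. by move=> /andP[at_ tb]; rewrite /clamp (min_idPl tb) (max_idPr at_). Qed.

Lemma clamp_lip a b s t : a <= b -> `|clamp a b s - clamp a b t| <= `|s - t|.
Proof.
move=> ab; have cases r : [\/ r <= a /\ clamp a b r = a, a <= r <= b /\ clamp a b r = r
    | b <= r /\ clamp a b r = b].
  have [ra|/ltW ar] := lerP r a.
    by constructor 1; rewrite /clamp; split=> //; apply/max_idPl; rewrite ge_min ra.
  have [rb|/ltW br] := lerP r b; first by constructor 2; rewrite clamp_id ?ar ?rb.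
  by constructor 3; rewrite /clamp (min_idPr br) (max_idPr ab).
have H (u v : R) : u <= v -> `|clamp a b u - clamp a b v| <= `|u - v|.
  move=> uv; rewrite (distrC u) (ger0_norm (x := v - u)) ?subr_ge0//.
  rewrite ler_norml.
  case: (cases u) => [[? ->]|[/andP[? ?] ->]|[? ->]];
    case: (cases v) => [[? ->]|[/andP[? ?] ->]|[? ->]]; apply/andP; split; lra.
have [st|/ltW ts] := leP s t; first exact: H.
by rewrite distrC (distrC s); apply: H.
Qed.

Lemma ac_uniform (a b : R) (y : R -> R) (e : R) : ac_fun a b y -> 0 < e ->
  exists2 h : R, 0 < h & forall s t, a <= s <= b -> a <= t <= b -> `|s - t| < h -> `|y s - y t| < e.
Proof.
move=> yac e0; have [h h0 H] := yac e e0; exists h => //.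
have K s t : s <= t -> a <= s -> t <= b -> t - s < h -> `|y t - y s| < e.
  move=> st as_ tb th; have := H 1%N (fun=> s) (fun=> t); rewrite !big_ord1; apply => //.
  by apply/trivIsetP => i j _ _; rewrite !ord1 eqxx.
move=> s t /andP[as_ sb] /andP[at_ tb].
have [st|/ltW ts] := lerP s t.
  by move=> ?; rewrite distrC; apply: K.
by move=> ?; apply: K.
Qed.

Lemma ac_clamp_continuous (a b : R) (y : R -> R) : a <= b -> ac_fun a b y ->
  continuous (y \o clamp a b).
Proof.
move=> ab yac t; apply/cvgrPdist_lt => e e0.
have [h h0 H] := ac_uniform yac e0.
near=> s; rewrite /=; apply: H; rewrite ?clamp_itv//.
apply: le_lt_trans (clamp_lip _ _ ab) _.
by near: s; apply: cvgr_dist_lt.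
Unshelve. all: by end_near. Qed.

(** The upper limit of the absolute difference quotients, y being extended by
    constants to a continuous function on the line. *)
Lemma ac_measurable_speed (a b : R) (y : R -> R) : a <= b -> ac_fun a b y ->
  exists2 G : R -> R, measurable_fun setT G &
    forall t, a < t < b -> derivable y t 1 -> G t = `|'D_1 y t|.
Proof.
move=> ab yac; pose yy := y \o clamp a b.
have yyc : continuous yy by apply: ac_clamp_continuous.
pose d (n : nat) t := (n.+1%:R * `|yy (t + n.+1%:R^-1) - yy t|)%:E.
exists (fun t => fine (limn_esup (d ^~ t))).
  apply: measurableT_comp => //; apply: measurable_fun_limn_esup => n.
  apply/measurable_EFinP; apply: measurable_funM => //.
  apply: measurableT_comp => //; apply: measurable_funB.
    apply: continuous_measurable_fun => x.
    apply: (@continuous_comp _ _ _ (fun t => t + n.+1%:R^-1) yy); last exact: yyc.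
    by apply: cvgD => //; exact: cvg_cst.
  exact: continuous_measurable_fun.
move=> t /andP[at_ tb] dy.
suff dl : (d ^~ t) @ \oo --> (`|'D_1 y t|)%:E by rewrite (cvg_limn_einf_sup dl).2.
apply: cvg_EFin; first by near=> n.
apply/cvgrPdist_le => e e0; have [h h0 H] := derivable_slope dy e0.
have bt : 0 < b - t by rewrite subr_gt0.
near=> n; rewrite /= /yy /=.
have n0 : 0 < n.+1%:R^-1 :> R by rewrite invr_gt0.
have nh : n.+1%:R^-1 < h :> R.
  by near: n; exact: near_infty_natSinv_lt (PosNum h0).
have nb : n.+1%:R^-1 < b - t :> R.
  by near: n; exact: near_infty_natSinv_lt (PosNum bt).
have nn : n.+1%:R * n.+1%:R^-1 = 1 :> R by rewrite mulfV.
have nR : 0 < n.+1%:R :> R by [].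
move: (n.+1%:R : R) (n.+1%:R^-1 : R) n0 nh nb nn nR => M u n0 nh nb nn nR.
rewrite !clamp_id; [|apply/andP; split; lra|apply/andP; split; lra].
have := H (t + u); rewrite addrAC subrr add0r (ger0_norm (ltW n0)) => /(_ nh) Hn.
have -> : M * `|y (t + u) - y t| = `|M * (y (t + u) - y t)| by rewrite normrM (ger0_norm (ltW nR)).
apply: le_trans (ler_dist_dist _ _) _.
have -> : 'D_1 y t - M * (y (t + u) - y t) = - M * (y (t + u) - y t - 'D_1 y t * u).
  by rewrite [RHS]mulrBr mulrCA !mulNr nn; ring.
rewrite normrM normrN (ger0_norm (ltW nR)).
apply: (@le_trans _ _ (M * (e * u))); first by rewrite ler_pM2l.
by rewrite mulrCA nn mulr1.
Unshelve. all: by end_near. Qed.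

(** The measurable function |y'| is integrated in place of D. Its indefinite
    integral z is monotone and, by Lebesgue's differentiation theorem, has
    derivative |y'| almost everywhere; so [ac_increment_le] applies to y and z,
    and to - y and z. *)
Lemma ac_le_integral (a b : R) (y D : R -> R) : a <= b -> ac_fun a b y ->
  (forall t, a <= t <= b -> 0 <= D t) ->
  {ae mu, forall t, t \in `[a, b] -> derivable y t 1 /\ `|'D_1 y t| <= D t} ->
  ((`|y b - y a|)%:E <= \int[mu]_(t in `[a, b]) (D t)%:E)%E.
Proof.
move=> ab yac D0 [N [mN N0 NP]].
have [G mG GE] := ac_measurable_speed ab yac.
have good t : a < t < b -> ~ N t -> derivable y t 1 /\ `|'D_1 y t| <= D t.
  move=> /andP[at_ tb] tN; apply: contrapT => bad; apply: tN; apply: NP => /= H.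
  by apply: bad; apply: H; rewrite in_itv /= !ltW.
pose E := `]a, b[%classic `\` N.
have mE : measurable E by apply: measurableD => //; exact: measurable_itv.
pose dd := G \_ E.
have mdd : measurable_fun setT dd.
  apply/(measurable_restrictT _ mE); exact: measurable_funTS.
have ddE t : E t -> dd t = `|'D_1 y t| /\ dd t <= D t.
  move=> Et; have : a < t < b by case: Et; rewrite /= in_itv.
  move=> tab; have [dy yD] := good t tab Et.2.
  by rewrite /dd patchE mem_set// GE.
have dd0 t : 0 <= dd t.
  have [/ddE[-> _]//|nE] := pselect (E t).
  by rewrite /dd patchE memNset.
have Eab t : E t -> a <= t <= b.
  by case; rewrite /= in_itv /= => /andP[/ltW -> /ltW ->].
have ddD : (\int[mu]_(t in `[a, b]) (dd t)%:E <= \int[mu]_(t in `[a, b]) (D t)%:E)%E.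
  apply: le_integral_nonmeasurable => t; first by rewrite lee_fin.
  rewrite /= in_itv /= => tab; rewrite lee_fin.
  have [/ddE[_ //]|nE] := pselect (E t).
  by rewrite /dd patchE memNset//; apply: D0.
apply: le_trans ddD.
have [->|ddfin] := eqVneq (\int[mu]_(t in `[a, b]) (dd t)%:E)%E +oo%E; first by rewrite leey.
have iab : mu.-integrable `[a, b] (EFin \o dd).
  apply/integrableP; split; first by apply/measurable_EFinP; exact: measurable_funTS.
  have -> : (fun x => `|(EFin \o dd) x|%E) = (fun t => (dd t)%:E).
    by apply/funext => t; rewrite /= ger0_norm.
  by rewrite ltey.
have ddab : dd = dd \_ `[a, b].
  apply/funext => t; rewrite [RHS]patchE; case: ifP => // /negbT.
  rewrite notin_setE /= in_itv /= => tab; rewrite /dd patchE memNset// => /Eab.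
  by move=> h; apply: tab.
have iT : mu.-integrable setT (EFin \o dd).
  rewrite ddab -restrict_EFin; apply: (iffLR (integrable_mkcond _ _)) iab.
  exact: measurable_itv.
have iy t : mu.-integrable `]-oo, t] (EFin \o dd).
  by apply: integrableS iT.
have lT : locally_integrable [set: R] dd.
  by rewrite ddab; apply: integrable_locally iab; exact: measurable_itv.
have [N2 [mN2 N20 N2P]] := FTC1Ny iy lT.
pose z (t : R) := (\int[mu]_(s in [set` `]-oo, t]]) dd s)%R.
have zP t : ~ N2 t -> derivable z t 1 /\ 'D_1 z t = dd t.
  move=> tN2; have [] : derivable z t 1 /\ z^`()%classic t = dd t.
    by apply: contrapT => bad; apply: tN2; apply: N2P.
  by rewrite derive1E.
have zB s t : s <= t -> z t - z s = (\int[mu]_(r in `]s, t]) dd r)%R.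
  by move=> st; rewrite /z Rintegral_itvB// bnd_simp.
have zmon s t : a <= s -> s <= t -> t <= b -> z s <= z t.
  by move=> _ st _; rewrite -subr_ge0 zB// Rintegral_ge0.
have NN0 : mu (N `|` N2) = 0%E by rewrite measureU0.
have mNN : measurable (N `|` N2) by exact: measurableU.
have up : `|y b - y a| <= z b - z a.
  have yN : ac_fun a b (fun t => - y t).
    move=> e e0; have [h h0 H] := yac e e0; exists h => // m l r P1 P2 P3.
    by under eq_bigr do rewrite -opprD normrN; apply: H.
  have goodz t : a < t < b -> ~ (N `|` N2) t ->
      [/\ derivable y t 1, derivable z t 1 & `|'D_1 y t| <= 'D_1 z t].
    move=> tab /not_orP[tN tN2]; have [dy _] := good t tab tN; have [dz ->] := zP t tN2.
    have Et : E t by split=> //; rewrite /= in_itv.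
    by split=> //; have [-> _] := ddE t Et.
  have h1 := ac_increment_le ab yac zmon mNN NN0.
  have h2 := ac_increment_le ab yN zmon mNN NN0.
  rewrite ler_norml; apply/andP; split.
    rewrite lerNl opprB; have := h2 _; rewrite opprK addrC; apply => t tab tN.
    have [dy dz le] := goodz t tab tN; split; [exact: derivableN|exact: dz|].
    by rewrite deriveN//; apply: le_trans le; rewrite -normrN ler_norm.
  apply: h1 => t tab tN; have [dy dz le] := goodz t tab tN; split; [exact: dy|exact: dz|].
  by apply: le_trans le; rewrite ler_norm.
apply: (@le_trans _ _ (z b - z a)%:E); first by rewrite lee_fin.
rewrite zB// fineK; last by apply: integrable_fin_num => //; apply: integrableS iT.
apply: ge0_subset_integral; [exact: measurable_itv|exact: measurable_itv| | |].
- by apply/measurable_EFinP; exact: measurable_funTS.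
- by move=> t _; rewrite lee_fin.
- by apply: subset_itvr; rewrite bnd_simp.
Qed.

End AC2.

(** * Coordinates of the second kind *)

Section Coord.
Variables (R : realType) (k : nat).
Local Notation n := k.+2.
Implicit Types (X Y p : 'rV[R]_n) (c : coord_kind) (i j : 'I_n).

(** With N the matrix of e^(k), the coefficient of N ^ d in the matrix which
    turns the coordinates u of kind c into those of the second kind. For the
    first kind this matrix is the series (exp(x N) - 1) / (x N). *)
Definition tau c (d : nat) (x : R) : R :=
  if c is FirstKind then x ^+ d / d.+1`!%:R else (d == 0%N)%:R.

Lemma tau0 c x : tau c 0 x = 1.
Proof. by case: c; rewrite /tau /= ?expr0 ?divr1. Qed.

Lemma tau_at0 c d : tau c d 0 = (d == 0%N)%:R.
Proof. by case: c; rewrite /tau // expr0n; case: d => [|d]; rewrite ?mul0r ?divr1. Qed.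

(** The coordinates of the second kind of the point with coordinates X of kind c;
    those of positive index form the first row of the chart, see [chart_row]. *)
Definition second_coord c X j : R :=
  if j == 0 then X 0 0
  else \sum_(i < n | (0 < i <= j)%N) X 0 i * tau c (j - i) (X 0 0).

Lemma second_coord0 c X : second_coord c X 0 = X 0 0.
Proof. by rewrite /second_coord eqxx. Qed.

Lemma second_coordS c X j : j != 0 ->
  second_coord c X j = X 0 j + \sum_(i < n | (0 < i < j)%N) X 0 i * tau c (j - i) (X 0 0).
Proof.
move=> j0; rewrite /second_coord (negbTE j0) (bigD1 j) /=; last by rewrite lt0n j0 leqnn.
rewrite subnn tau0 mulr1; congr (_ + _); apply: eq_bigl => i.
by rewrite -andbA -(inj_eq val_inj) /= (ltn_neqAle i j); case: (0 < i)%N => //=; rewrite andbC.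
Qed.

Lemma mul_T c x (v : 'rV[R]_n) j : v 0 0 = 0 ->
  (v *m (match c with FirstKind => \sum_(m < n) (m.+1)`!%:R^-1 *: (x *: jk_basis R 0) ^+ m
         | SecondKind => 1%:M end)) 0 j
  = \sum_(i < n | (0 < i <= j)%N) v 0 i * tau c (j - i) x.
Proof.
move=> v0; rewrite mxE [RHS]big_mkcond; apply: eq_bigr => i _.
have [->|i0] := eqVneq i 0; first by rewrite v0 mul0r.
have i0' : (0 < i)%N by rewrite lt0n.
rewrite i0' /=; case: c => /=; last first.
  rewrite mxE; have [->|ij] := eqVneq i j; first by rewrite leqnn subnn.
  rewrite mulr0; case: ifP => // lij; rewrite (_ : (_ == 0)%N = false) ?mulr0//.
  by apply/negbTE; rewrite subn_eq0 -ltnNge ltn_neqAle lij andbT.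
rewrite summxE; under eq_bigr => m _ do rewrite exprZn !mxE jk_basisX i0' orbT /=.
case: leqP => ij; last first.
  rewrite big1 ?mulr0// => m _; rewrite (_ : (_ == _)%N = false) ?mulr0//.
  by rewrite ltn_eqF// (leq_trans ij)// leq_addr.
have jn : (j - i < n)%N by rewrite (leq_ltn_trans (leq_subr _ _)).
rewrite (bigD1 (Ordinal jn))//= big1 => [|m mj].
  by rewrite subnKC// eqxx mulr1 addr0; congr (_ * _); exact: mulrC.
rewrite (_ : (j == (i + m)%N :> nat) = false) ?mulr0//; apply: contraNF mj => /eqP jE.
by apply/eqP/val_inj; rewrite /= jE addKn.
Qed.

Lemma chart_row c X j : j != 0 -> jk_chart c X 0 j = second_coord c X j.
Proof.
move=> j0; rewrite chartE /= mxE jk_basis_expE eqxx (negbTE j0) add0r.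
rewrite mxE big_ord1 !mxE eqxx mul1r /second_coord (negbTE j0).
set v := X - _; have v0 : v 0 0 = 0 by rewrite !mxE eqxx mulr1 subrr.
have := mul_T c (X 0 0) j v0; rewrite mxE => ->; apply: eq_bigr => i /andP[i0 _].
by rewrite !mxE (_ : (i == 0) = false) ?andbF ?mulr0 ?subr0//; apply/negbTE; rewrite -lt0n.
Qed.

Lemma chart_00 c X : jk_chart c X 0 0 = 1.
Proof.
rewrite chartE /= mxE jk_basis_expE eqxx mxE big_ord1.
set v := X - _; have v0 : v 0 0 = 0 by rewrite !mxE eqxx mulr1 subrr.
have := mulT0 c (X 0 0) v; rewrite /= v0 => ->.
by rewrite mulr0 addr0.
Qed.

Lemma second_coord_mul0 c X Y : (0 < k)%N ->
  second_coord c (jk_mul c X Y) 0 = X 0 0 + Y 0 0.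
Proof.
move=> k0; rewrite second_coord0; have := jk_chart_mul c X Y.
rewrite !chartE chart_prod ?mulT0 ?tail0// => /(congr1 (fun M : 'M[R]_n => M 1 (inord 2))).
by rewrite !chart_E.
Qed.

Lemma second_coord_mulS c X Y j : (0 < k)%N -> j != 0 ->
  second_coord c (jk_mul c X Y) j = second_coord c Y j +
    \sum_(l < n | (0 < l <= j)%N) second_coord c X l * Y 0 0 ^+ (j - l) / (j - l)`!%:R.
Proof.
move=> k0 j0; rewrite -(chart_row c _ j0) jk_chart_mul -mulmxE mxE addrC.
rewrite (bigD1 0)//= -(chart_row c Y j0) addrC chart_00 mul1r; congr (_ + _).
rewrite [LHS]big_mkcond [RHS]big_mkcond; apply: eq_bigr => l _.
have [->//|l0] := eqVneq l 0.
rewrite lt0n (l0 : l != 0%N :> nat) /=.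
rewrite chart_row// -[in RHS]mulrA [jk_chart c Y]chartE /= mxE jk_basis_expE (negbTE l0).
rewrite [X in _ * (_ + X)]mxE big_ord1 [X in _ * (_ + X * _)]mxE (negbTE l0) mul0r addr0.
by case: ifP; rewrite ?mulr0.
Qed.

Lemma second_coord_inj c X Y : (forall j, second_coord c X j = second_coord c Y j) -> X = Y.
Proof.
move=> XY; have x0 : X 0 0 = Y 0 0 by have := XY 0; rewrite !second_coord0.
have H m : forall j, (j < m)%N -> X 0 j = Y 0 j.
  elim: m => // m IH j jm; have [->//|j0] := eqVneq j 0.
  have := XY j; rewrite !second_coordS// x0.
  rewrite (eq_bigr (fun i : 'I_n => Y 0 i * tau c (j - i) (Y 0 0))); first exact: addIr.
  by move=> i /andP[_ ij]; rewrite IH// (leq_trans ij).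
by apply/rowP => j; apply: (H n).
Qed.

End Coord.

(** * Left-invariant fields in coordinates of the second kind *)

Section Eucl.
Variables (R : realType) (n : nat).
Implicit Types (X Y : 'rV[R]_n).

Lemma eucl_norm_ge0 X : 0 <= eucl_norm X. Proof. exact: sqrtr_ge0. Qed.

Lemma coord_le_eucl X i : `|X 0 i| <= eucl_norm X.
Proof.
rewrite -sqrtr_sqr ler_wsqrtr// (bigD1 i)//= lerDl.
by apply: sumr_ge0 => j _; rewrite sqr_ge0.
Qed.

Lemma eucl_le_sum X : eucl_norm X <= \sum_(i < n) `|X 0 i|.
Proof.
have S0 : 0 <= \sum_(i < n) `|X 0 i| by apply: sumr_ge0.
rewrite -(ger0_norm S0) -sqrtr_sqr ler_wsqrtr//.
have H m (f : nat -> R) : (forall i, 0 <= f i) -> \sum_(i < m) f i ^+ 2 <= (\sum_(i < m) f i) ^+ 2.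
  move=> f0; elim: m => [|m IH]; first by rewrite !big_ord0 expr0n.
  rewrite !big_ord_recr /= sqrrD.
  have : 0 <= (\sum_(i < m) f i) * f m by rewrite mulr_ge0// sumr_ge0.
  lra.
case: n X S0 => [|m] X S0; first by rewrite !big_ord0 expr0n.
have := H m.+1 (fun i => `|X 0 (inord i)|) (fun i => normr_ge0 _).
under eq_bigr do rewrite inord_val real_normK ?num_real//.
by under [X in _ <= X ^+ 2 -> _]eq_bigr do rewrite inord_val.
Qed.

Lemma eucl_dist_coord X Y i : `|X 0 i - Y 0 i| <= eucl_dist X Y.
Proof. by have := coord_le_eucl (X - Y) i; rewrite !mxE. Qed.
End Eucl.

Section Nice.
Variables (R : realType) (n : nat).
Local Notation V := 'rV[R]_n.+1.

(** The bounds on bounded sets are those which transfer absolute continuity and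
    Lipschitz estimates from a map g to phi o g. *)
Definition regular (phi : V -> R) :=
  (forall X : V, differentiable phi X) /\
  forall M : R, exists B K : R, [/\ 0 <= B, 0 <= K,
    forall X : V, (forall i, `|X 0 i| <= M) -> `|phi X| <= B &
    forall X Y : V, (forall i, `|X 0 i| <= M) -> (forall i, `|Y 0 i| <= M) ->
      `|phi X - phi Y| <= K * eucl_dist X Y].

Lemma regular_coord i : regular (fun X : V => X 0 i).
Proof.
split=> [X|M]; first exact: differentiable_coord.
exists (Num.max 0 M), 1; split=> //; first by rewrite le_max lexx.
  by move=> X XM; rewrite le_max XM orbT.
by move=> X Y _ _; rewrite mul1r eucl_dist_coord.
Qed.

Lemma regular_cst (a : R) : regular (fun=> a).
Proof.
split=> [X|M]; first exact: differentiable_cst.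
exists `|a|, 0; split=> // X Y _ _.
by rewrite subrr normr0 mul0r.
Qed.

Lemma regularD f g : regular f -> regular g -> regular (fun X : V => f X + g X).
Proof.
move=> [df Lf] [dg Lg]; split=> [X|M]; first exact: differentiableD.
have [B1 [K1 [B10 K10 b1 k1]]] := Lf M; have [B2 [K2 [B20 K20 b2 k2]]] := Lg M.
exists (B1 + B2), (K1 + K2); split; rewrite ?addr_ge0//.
  by move=> X XM; apply: le_trans (ler_normD _ _) _; rewrite lerD ?b1 ?b2.
move=> X Y XM YM; rewrite opprD addrACA mulrDl; apply: le_trans (ler_normD _ _) _.
by rewrite lerD ?k1 ?k2.
Qed.

Lemma regularM f g : regular f -> regular g -> regular (fun X : V => f X * g X).
Proof.
move=> [df Lf] [dg Lg]; split=> [X|M]; first exact: differentiableM.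
have [B1 [K1 [B10 K10 b1 k1]]] := Lf M; have [B2 [K2 [B20 K20 b2 k2]]] := Lg M.
exists (B1 * B2), (B1 * K2 + K1 * B2); split; rewrite ?addr_ge0 ?mulr_ge0//.
  by move=> X XM; rewrite normrM ler_pM ?b1 ?b2.
move=> X Y XM YM.
have -> : f X * g X - f Y * g Y = f X * (g X - g Y) + (f X - f Y) * g Y by ring.
apply: le_trans (ler_normD _ _) _; rewrite !normrM mulrDl lerD//.
  by rewrite -mulrA ler_pM ?b1 ?k2.
by rewrite mulrAC ler_pM ?b2 ?k1.
Qed.

Lemma regularX f m : regular f -> regular (fun X : V => f X ^+ m).
Proof.
move=> rf; elim: m => [|m IH]; first by under eq_fun do rewrite expr0; exact: regular_cst.
by under eq_fun do rewrite exprS; exact: regularM.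
Qed.

Lemma regular_sum (I : Type) (r : seq I) (P : pred I) (f : I -> V -> R) :
  (forall i, P i -> regular (f i)) -> regular (fun X : V => \sum_(i <- r | P i) f i X).
Proof.
move=> rf; elim: r => [|i r IH].
  by under eq_fun do rewrite big_nil; exact: regular_cst.
under eq_fun do rewrite big_cons.
by case: (boolP (P i)) => [Pi|_] //; apply: regularD => //; apply: rf.
Qed.
End Nice.

Section Coord2.
Variables (R : realType) (k : nat).
Local Notation n := k.+2.
Implicit Types (X Y p : 'rV[R]_n) (c : coord_kind) (i j : 'I_n).

Lemma regular_second_coord c j : regular (fun X => second_coord c X j).
Proof.
rewrite /second_coord; case: (j == 0); first exact: regular_coord.
apply: regular_sum => i _; apply: regularM; first exact: regular_coord.
rewrite /tau; case: c; last exact: regular_cst.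
by apply: regularM; [apply: regularX; exact: regular_coord|exact: regular_cst].
Qed.

Lemma derivable_bigsum (I : Type) (r : seq I) (P : pred I) (h : I -> R -> R) (t : R) :
  (forall i : I, P i -> derivable (h i) t 1) -> derivable (fun s => \sum_(i <- r | P i) h i s) t 1.
Proof.
move=> dh; elim: r => [|i r IH].
  by under eq_fun do rewrite big_nil; exact: derivable_cst.
under eq_fun do rewrite big_cons.
case: (boolP (P i)) => [Pi|_]; last exact: IH.
exact: derivableD (dh i Pi) IH.
Qed.

Definition axis_curve c p i (t : R) := jk_mul c p (t *: delta_mx 0 i).

Lemma sum_pow0 (F : 'I_n -> R) j : j != 0 ->
  \sum_(l < n | (0 < l <= j)%N) F l * 0 ^+ (j - l) / (j - l)`!%:R = F j.
Proof.
move=> j0; rewrite (bigD1 j) /=; last by rewrite lt0n (j0 : j != 0 :> nat) leqnn.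
rewrite subnn expr0 divr1 mulr1 big1 ?addr0// => l /andP[/andP[_ lj] nlj].
rewrite expr0n subn_eq0 (_ : (j <= l)%N = false) ?mulr0 ?mul0r//.
by apply/negbTE; rewrite -ltnNge ltn_neqAle lj andbT.
Qed.

Lemma axis_curve0 c p i : (0 < k)%N -> axis_curve c p i 0 = p.
Proof.
move=> k0; apply: (@second_coord_inj _ _ c) => j; rewrite /axis_curve scale0r.
have [->|j0] := eqVneq j 0; first by rewrite second_coord_mul0// second_coord0 mxE addr0.
rewrite second_coord_mulS// mxE sum_pow0//.
by rewrite /second_coord (negbTE j0) big1 ?add0r// => l _; rewrite mxE mul0r.
Qed.

Lemma left_field_axis c i p : left_field c i p = 'D_1 (axis_curve c p i) 0.
Proof.
rewrite /left_field /derive; set d := (fun _ : R => _); set d' := (fun _ : R => _).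
suff -> : d = d' by reflexivity.
by apply/funext => h; rewrite /d /d' /= /axis_curve !addr0 scale0r [h%:A]mulr1.
Qed.

(** The coordinates of the second kind are polynomial along the curves
    t |-> p * exp(t e) for e the first or second basis vector; so their derivatives
    along the two horizontal fields are coefficients of degree 1. *)
Definition axis_poly c p i j : {poly R} :=
  if i == 0 then
    if j == 0 then (p 0 0)%:P + 'X
    else \sum_(l < n | (0 < l <= j)%N) (second_coord c p l / (j - l)`!%:R) *: 'X^(j - l)
  else (second_coord c p j)%:P + (j == 1)%:R *: 'X.

Lemma second_coord_axis c p i j t : (0 < k)%N -> (i <= 1)%N ->
  second_coord c (axis_curve c p i t) j = (axis_poly c p i j).[t].
Proof.
move=> k0; rewrite /axis_curve /axis_poly.
have [-> _|i0] := eqVneq i 0.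
  have [->|j0] := eqVneq j 0.
    by rewrite second_coord_mul0// !mxE eqxx !hornerE.
  rewrite second_coord_mulS//.
  rewrite {1}/second_coord (negbTE j0) big1 ?add0r; last first.
    move=> l /andP[l0 _]; rewrite !mxE (_ : (l == 0) = false) ?mulr0 ?mul0r//.
    by apply/negbTE; rewrite -lt0n.
  rewrite horner_sum; apply: eq_bigr => l _.
  by rewrite !mxE eqxx mulr1 !hornerE mulrAC.
move=> i1; have {}i1 : i = 1.
  by apply/val_inj; apply/eqP; rewrite /= eqn_leq i1 lt0n.
rewrite {}i1 in i0 *.
have [->|j0] := eqVneq j 0.
  by rewrite second_coord_mul0// !mxE !hornerE second_coord0.
rewrite second_coord_mulS// !mxE eqxx mulr0 sum_pow0//.
rewrite addrC !hornerE; congr (_ + _).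
rewrite {1}/second_coord (negbTE j0).
rewrite (eq_bigr (fun l : 'I_n => if l == 1 then t * (j == 1)%:R else 0)) => [|l /andP[l0 lj]].
  rewrite -big_mkcondr /=; have [->|j1] := eqVneq j 1.
    rewrite (big_pred1 1) => [|l]; first by rewrite mulr1 mul1r.
    by rewrite /=; case: (eqVneq l 1) => [->|_]; rewrite ?andbF.
  by rewrite big1 ?mul0r// => l _; rewrite mulr0.
rewrite !mxE eqxx /=; have [l1|_] := eqVneq l 1; last by rewrite mulr0 mul0r.
rewrite mulr1 mulr0 tau_at0 l1 -val_eqE /= subn_eq0; congr (_ * (_ : bool)%:R).
by rewrite eqn_leq [(1 <= j)%N]lt0n (j0 : j != 0 :> nat) andbT.
Qed.

(** The coordinates of kind c are recovered recursively from those of the second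
    kind, which are polynomials in t. *)
Lemma derivable_axis c p i : (0 < k)%N -> (i <= 1)%N -> derivable (axis_curve c p i) 0 1.
Proof.
move=> k0 i1; apply/derivable_mxP => a j; rewrite (ord1 a) {a}.
have dsc l : derivable (fun t => second_coord c (axis_curve c p i t) l) 0 1.
  by under eq_fun do rewrite second_coord_axis//; exact: derivable_horner.
have d0 : derivable (fun t => axis_curve c p i t 0 0) 0 1.
  by under eq_fun do rewrite -(second_coord0 c); exact: dsc.
have dtau c' d : derivable (fun t => tau c' d (axis_curve c p i t 0 0)) 0 1.
  rewrite /tau; case: c'; last exact: derivable_cst.
  apply: derivableM; last exact: derivable_cst.
  elim: d => [|d IH]; under eq_fun do rewrite ?expr0 ?exprS; first exact: derivable_cst.
  exact: derivableM d0 IH.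
suff H m : forall j, (j < m)%N -> derivable (fun t => axis_curve c p i t 0 j) 0 1 by apply: (H n).
elim: m {j} => [|m IH] j jm; first by exfalso.
have [->|j0] := eqVneq j 0; first exact: d0.
have -> : (fun t => axis_curve c p i t 0 j) = (fun t => second_coord c (axis_curve c p i t) j -
    \sum_(l < n | (0 < l < j)%N) axis_curve c p i t 0 l * tau c (j - l) (axis_curve c p i t 0 0)).
  by apply/funext => t; rewrite second_coordS// addrK.
apply: derivableB; first exact: dsc.
apply: derivable_bigsum => l /andP[_ lj]; apply: derivableM.
  by apply: IH; rewrite (leq_trans lj).
exact: dtau.
Qed.

Lemma diff_second_coord_left_field c p i j : (0 < k)%N -> (i <= 1)%N ->
  'd (fun X => second_coord c X j : R) p (left_field c i p) = (axis_poly c p i j)`_1.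
Proof.
move=> k0 i1; rewrite left_field_axis.
have dg : derivable (axis_curve c p i) 0 1 by exact: derivable_axis.
have df : differentiable (axis_curve c p i) (0 : R) by apply/derivable1_diffP.
have ds : differentiable (fun X => second_coord c X j : R) (axis_curve c p i 0).
  by have [] := regular_second_coord c j.
rewrite deriveE//.
have := diff_comp df ds => /(congr1 (fun f => f 1)) /=; rewrite axis_curve0// => <-.
rewrite -deriveE; last exact: differentiable_comp.
have -> : (fun X => second_coord c X j) \o axis_curve c p i = horner (axis_poly c p i j).
  by apply/funext => t; rewrite /= second_coord_axis.
by rewrite derive_val horner_coef0 coef_deriv mulr1n.
Qed.

Lemma axis_poly_coef1 c p i j : (axis_poly c p i j)`_1 =
  if i == 0 then
    if j == 0 then 1 else if j == 1 then 0 else second_coord c p (inord j.-1)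
  else (j == 1)%:R.
Proof.
rewrite /axis_poly; case: (i == 0); last by rewrite !coefE /= add0r mulr1.
case: (eqVneq j 0) => [_|j0]; first by rewrite !coefE /= add0r.
rewrite coef_sum; under eq_bigr do rewrite coefZ coefXn.
have [->|j1] := eqVneq j 1.
  rewrite big1// => l /andP[l0 l1]; rewrite (_ : (1 == _)%N = false) ?mulr0//.
  by move: l0 l1 => /=; case: (val l) => [|[|m]].
have j2 : (1 < j)%N.
  by rewrite ltn_neqAle lt0n (j0 : j != 0 :> nat) andbT eq_sym (j1 : j != 1 :> nat).
have jE : (inord j.-1 : 'I_n) = j.-1 :> nat.
  by rewrite inordK// (leq_ltn_trans (leq_pred _)).
have jj : (j - j.-1 = 1)%N by rewrite -subn1 subKn// ltnW.
rewrite (bigD1 (inord j.-1)) /=; last by rewrite jE leq_pred andbT -subn1 subn_gt0.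
rewrite jE jj eqxx divr1 mulr1 big1 ?addr0// => l /andP[/andP[l0 lj] lj1].
rewrite (_ : (1 == _)%N = false) ?mulr0//; apply: contraNF lj1 => /eqP E.
by apply/eqP/val_inj; rewrite /= jE -subn1 E subKn.
Qed.

End Coord2.

(** * End points of a short horizontal path *)

Lemma linear_comb2 (R : realType) (V W : normedModType R) (D : {linear V -> W}) (a b : R) (u v : V) :
  D (a *: u + b *: v) = a *: D u + b *: D v.
Proof. by rewrite linearD !linearZ. Qed.

Section Path.
Variables (R : realType) (k : nat).
Local Notation n := k.+2.
Local Notation mu := (@lebesgue_measure R).
Implicit Types (X Y p q : 'rV[R]_n) (c : coord_kind) (j : nat).

(** The index is in nat, as the estimates are proved by induction on it. *)
Definition scoord c j X : R := second_coord c X (inord j).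

Lemma regular_scoord c j : regular (scoord c j).
Proof. exact: regular_second_coord. Qed.

Lemma abs_continuous_bounded m (a b : R) (g : R -> 'rV[R]_m) : a <= b -> abs_continuous a b g ->
  exists M : R, forall t, a <= t <= b -> forall i, `|g t 0 i| <= M.
Proof.
move=> ab gac.
have yac i : ac_fun a b (fun t => g t 0 i).
  move=> e e0; have [d d0 H] := gac e e0; exists d => // r l u P1 P2 P3.
  apply: le_lt_trans (H r l u P1 P2 P3); apply: ler_sum => x _.
  exact: eucl_dist_coord.
have /choice[M HM] : forall i, exists M : R, forall t, a <= t <= b -> `|g t 0 i| <= M.
  move=> i.
  have fc : {within `[a, b], continuous (fun t => `|g (clamp a b t) 0 i|)}.
    apply: continuous_subspaceT => t; apply: cvg_norm.
    exact: (ac_clamp_continuous ab (yac i)).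
  have [t _ tM] := EVT_max ab fc.
  exists `|g (clamp a b t) 0 i| => s sab.
  by have := tM s; rewrite in_itv /= => /(_ sab); rewrite clamp_id.
exists (\sum_i `|M i|) => t tab i; rewrite (bigD1 i)//=.
apply: le_trans (HM i t tab) _; apply: le_trans (ler_norm _) _.
by rewrite lerDl sumr_ge0.
Qed.

Lemma regular_ac (phi : 'rV[R]_n -> R) (a b : R) g : a <= b -> regular phi -> abs_continuous a b g ->
  ac_fun a b (phi \o g).
Proof.
move=> ab [_ rphi] gac; have [M gM] := abs_continuous_bounded ab gac.
have [B [K [_ K0 _ phiK]]] := rphi M => e e0.
have K1 : 0 < K + 1 by lra.
have [d d0 H] := gac (e / (K + 1)) ltac:(by rewrite divr_gt0); exists d => // m l r P1 P2 P3.
have := H m l r P1 P2 P3; rewrite ltr_pdivlMr// mulr_suml; apply: le_lt_trans.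
apply: ler_sum => i _; have [al [lr rb]] := P1 i.
apply: (@le_trans _ _ (K * eucl_dist (g (r i)) (g (l i)))).
  by apply: phiK; apply: gM; apply/andP; split=> //; [exact: le_trans lr|exact: le_trans rb].
by rewrite mulrC ler_wpM2l ?eucl_norm_ge0//; lra.
Qed.

(** The contact equations of jets: along a horizontal path every coordinate after
    the second one is a primitive of the previous one with respect to x. *)
Lemma scoord_derive c (g : R -> 'rV[R]_n) t : (0 < k)%N -> derivable g t 1 ->
  hspace c (g t) (g^`()%classic t) ->
  exists s1 s2 : R, [/\ `|s1| <= hnorm c (g t) (g^`()%classic t), `|s2| <= hnorm c (g t) (g^`()%classic t)
   & forall j, (j <= k.+1)%N -> derivable (scoord c j \o g) t 1 /\
     'D_1 (scoord c j \o g) t =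
        if j == 0%N then s1 else if j == 1%N then s2 else s1 * scoord c j.-1 (g t)].
Proof.
move=> k0 dg hs; set v := g^`()%classic t in hs *.
pose s := xget (0, 0) [set s | hcomb c (g t) s = v].
have sE : hcomb c (g t) s = v.
  by have [s' _ s'E] := hs; apply: (@xgetPex _ (0, 0) [set s | hcomb c (g t) s = v]); exists s'.
exists s.1, s.2; rewrite /hnorm -/s; split.
- by rewrite -[X in X <= _]sqrtr_sqr ler_wsqrtr// lerDl sqr_ge0.
- by rewrite -[X in X <= _]sqrtr_sqr ler_wsqrtr// lerDr sqr_ge0.
move=> j jk.
have df : differentiable g t by apply/derivable1_diffP.
have ds : differentiable (scoord c j) (g t) by have [] := regular_scoord c j.
have dc : differentiable (scoord c j \o g) t by exact: differentiable_comp.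
split; first by apply/derivable1_diffP.
have E1 : 'D_1 (scoord c j \o g) t = 'd (scoord c j) (g t) (hcomb c (g t) s).
  have vE : 'd g t 1 = v by rewrite -(deriveE _ df) -derive1E; reflexivity.
  by rewrite deriveE// diff_comp//= vE sE.
have E2 := linear_comb2 ('d (scoord c j) (g t)) s.1 s.2 (left_field c 0 (g t)) (left_field c 1 (g t)).
have h0 : ((0%R : 'I_n) <= 1)%N by [].
have h1 : ((1%R : 'I_n) <= 1)%N by [].
have E3 := diff_second_coord_left_field c (g t) (inord j) k0 h0.
have E4 := diff_second_coord_left_field c (g t) (inord j) k0 h1.
have E5 := eq_trans E1 (eq_trans E2 (congr2 (fun a b => s.1 * a + s.2 * b) E3 E4)).
rewrite {}E5 !axis_poly_coef1 eqxx; move: (s.1) (s.2) => s1 s2.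
have jE : (inord j : 'I_n) = j :> nat by rewrite inordK.
rewrite -!val_eqE /= jE /scoord.
move: jk jE; case: (j) => [|[|j']] jk jE /=.
- by rewrite mulr1 mulr0 addr0.
- by rewrite mulr0 mulr1 add0r.
- by rewrite mulr0 addr0.
Qed.

(** This is [ac_le_integral] for phi o g / S, dominated by the speed of the path. *)
Lemma path_increment_le c a b g (phi : 'rV[R]_n -> R) (S r : R) : a <= b ->
  horizontal_path c a b g -> (path_length c a b g <= r%:E)%E -> regular phi -> 0 < S ->
  (forall t, a <= t <= b -> derivable g t 1 -> hspace c (g t) (g^`()%classic t) ->
     derivable (phi \o g) t 1 /\ `|'D_1 (phi \o g) t| <= S * hnorm c (g t) (g^`()%classic t)) ->
  forall t, a <= t <= b -> `|phi (g t) - phi (g a)| <= S * r.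
Proof.
move=> ab [gac gae] len rphi S0 Hphi t /andP[at_ tb].
have gac' : abs_continuous a t g.
  move=> e e0; have [d d0 H] := gac e e0; exists d => // m l u P1; apply: H => i.
  by have [? [? ut]] := P1 i; split=> //; split=> //; apply: le_trans tb.
pose y s := S^-1 * phi (g s).
have yac : ac_fun a t y.
  have pac := regular_ac at_ rphi gac'.
  move=> e e0; have Se0 : 0 < S * e by rewrite mulr_gt0.
  have [d d0 H] := pac _ Se0; exists d => // m l u P1 P2 P3.
  have := H m l u P1 P2 P3; rewrite -ltr_pdivrMl// mulr_sumr; apply: le_lt_trans.
  apply: ler_sum => i _; rewrite /y -mulrBr normrM ger0_norm// invr_ge0 ltW//.
have hn0 s : 0 <= hnorm c (g s) (g^`()%classic s) by exact: sqrtr_ge0.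
have := @ac_le_integral R a t y (fun s => hnorm c (g s) (g^`()%classic s)) at_ yac (fun s _ => hn0 s).
move=> /(_ _) Hint.
have {}Hint : ((`|y t - y a|)%:E <= \int[mu]_(s in `[a, t]) (hnorm c (g s) (g^`()%classic s))%:E)%E.
  apply: Hint; move: gae; apply: filterS; first exact: (ae_filter_ringOfSetsType mu).
  move=> s Hs; rewrite in_itv /= => /andP[as_ st].
  have sab : a <= s <= b by rewrite as_ (le_trans st).
  have sab' : s \in `[a, b] by rewrite in_itv.
  have [dg hs] := Hs sab'; have [dphi Dphi] := Hphi s sab dg hs.
  split; first exact: derivableM (derivable_cst _ _ _) dphi.
  have -> : 'D_1 y s = S^-1 * 'D_1 (phi \o g) s by rewrite (deriveZ S^-1 dphi).
  by rewrite normrM ger0_norm ?invr_ge0 ?(ltW S0)// ler_pdivrMl.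
have : ((`|y t - y a|)%:E <= r%:E)%E.
  apply: le_trans Hint (le_trans _ len); rewrite /path_length.
  rewrite [X in (X <= _)%E]integral_mkcond [X in (_ <= X)%E]integral_mkcond.
  apply: le_integral_nonmeasurable => s _.
    by apply: erestrict_ge0 => ? _; rewrite lee_fin.
  rewrite !patchE; case: ifPn => [|_].
    rewrite inE /= in_itv /= => /andP[as_ st].
    by rewrite mem_set//= in_itv /= as_ (le_trans st).
  by case: ifP => _ //; rewrite lee_fin.
rewrite lee_fin /y -mulrBr normrM ger0_norm ?invr_ge0 ?(ltW S0)//.
by rewrite ler_pdivrMl.
Qed.

End Path.

Section Contact.
Variables (R : realType) (k : nat).
Hypothesis k0 : (0 < k)%N.
Local Notation n := k.+2.
Implicit Types (X Y p q : 'rV[R]_n) (c : coord_kind) (j : nat).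

(** By induction on j, the coordinate W_j stays within O(r) of its initial value
    A along the path. The derivative of W_(j+1) - A W_0 is (W_j - A) W_0', so
    that the increment of this function is O(r^2). *)
Lemma path_contact c (a b : R) (g : R -> 'rV[R]_n) (r B : R) : a <= b ->
  horizontal_path c a b g -> (path_length c a b g <= r%:E)%E -> 0 < r <= 1 -> 0 <= B ->
  (forall j, (j <= k.+1)%N -> `|scoord c j (g a)| <= B) ->
  forall j, (0 < j <= k)%N ->
  `|scoord c j.+1 (g b) - scoord c j.+1 (g a)
    - scoord c j (g a) * (scoord c 0 (g b) - scoord c 0 (g a))| <= (1 + j%:R * B) * r ^+ 2.
Proof.
move=> ab hg len /andP[r0 r1] B0 gaB.
have C0 j : 0 < 1 + j%:R * B by rewrite ltr_pwDl// mulr_ge0.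
have osc j : (0 < j <= k.+1)%N -> forall t, a <= t <= b ->
    `|scoord c j (g t) - scoord c j (g a)| <= (1 + j%:R * B) * r.
  elim: j => // j IH /andP[_ jk] t tab.
  have P := path_increment_le ab hg len (@regular_scoord R k c j.+1) (C0 j.+1). apply: P => //.
  move=> u uab dg hs.
  have [s1 [s2 [hs1 hs2 /(_ j.+1 jk)[dj ->]]]] := scoord_derive k0 dg hs.
  split=> //; move: hs1 hs2; set hn := hnorm _ _ _ => hs1 hs2.
  have hn0 : 0 <= hn by apply: le_trans hs1.
  case: j IH jk dj => [|j] IH jk dj /=.
    by rewrite mul1r; apply: le_trans hs2 _; rewrite ler_peMl//; lra.
  rewrite normrM mulrC ler_pM//.
  have := IH (ltnW jk) u uab; have := gaB j.+1 (ltnW jk).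
  have := ler_normD (scoord c j.+1 (g u) - scoord c j.+1 (g a)) (scoord c j.+1 (g a)).
  rewrite subrK -[j.+2%:R]natr1.
  have : (1 + j.+1%:R * B) * r <= 1 + j.+1%:R * B by rewrite ler_piMr// ltW.
  lra.
move=> j /andP[j0 jk].
pose A := scoord c j (g a).
pose phi X := scoord c j.+1 X + (- A) * scoord c 0 X.
have rphi : regular phi.
  apply: regularD; first exact: regular_scoord.
  by apply: regularM; [exact: regular_cst|exact: regular_scoord].
have -> : scoord c j.+1 (g b) - scoord c j.+1 (g a) - A * (scoord c 0 (g b) - scoord c 0 (g a))
   = phi (g b) - phi (g a) by rewrite /phi; ring.
rewrite expr2 mulrA.
apply: (path_increment_le ab hg len rphi); [by rewrite mulr_gt0| |by rewrite ab lexx].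
move=> u uab dg hs.
have [s1 [s2 [hs1 hs2 sd]]] := scoord_derive k0 dg hs.
have [dj] := sd j.+1 jk; rewrite /= => Dj.
have [d0] := sd 0%N isT; rewrite /= => D0.
have jk1 : (0 < j <= k.+1)%N by rewrite j0 ltnW.
have j1 : (j.+1 == 1)%N = false by apply/negbTE; rewrite eqSS -lt0n.
have dA : derivable (fun u => (- A) * scoord c 0 (g u)) u 1.
  exact: derivableM (derivable_cst _ _ _) d0.
split; first exact: derivableD dj dA.
have -> : 'D_1 (phi \o g) u = s1 * (scoord c j (g u) - A).
  rewrite /phi /comp (deriveD dj dA) Dj (deriveZ (- A) d0) D0 j1.
  by rewrite /GRing.scale /=; ring.
rewrite normrM mulrC ler_pM//; exact: osc.
Qed.

Lemma dcc_contact c p q (r B : R) : (d_cc c p q < r%:E)%E -> 0 < r <= 1 -> 0 <= B ->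
  (forall j, (j <= k.+1)%N -> `|scoord c j p| <= B) ->
  forall j, (0 < j <= k)%N ->
  `|scoord c j.+1 q - scoord c j.+1 p
    - scoord c j p * (scoord c 0 q - scoord c 0 p)| <= (1 + k%:R * B) * r ^+ 2.
Proof.
move=> /ereal_inf_lt[_ [a [b [g [ab hg <- <- ->]]]] len] r01 B0 pB j jk.
apply: le_trans (path_contact ab hg (ltW len) r01 B0 pB jk) _.
rewrite ler_wpM2r ?sqr_ge0// lerD2l ler_wpM2r// ler_nat.
by case/andP: jk.
Qed.

(** If beta 0 > 0, the values 0 and beta 0 + 1 are taken at positive points; then
    beta 0 is also taken between these points, against injectivity. *)
Lemma homeo_halfline0 (beta : R -> R) : homeo_halfline beta -> beta 0 = 0.
Proof.
case=> gamma [bH gH [bK gK] bc gc].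
have H0 (x : R) : 0 <= x -> `[0, +oo[%classic x by rewrite /= in_itv /= andbT.
have b0 (x : R) : 0 <= x -> 0 <= beta x by move=> x0; have := bH x (H0 x x0); rewrite /= in_itv /= andbT.
have g0 (x : R) : 0 <= x -> 0 <= gamma x by move=> x0; have := gH x (H0 x x0); rewrite /= in_itv /= andbT.
have bgK (x : R) : 0 <= x -> beta (gamma x) = x by move=> x0; apply: gK; apply/mem_set/H0.
have gbK (x : R) : 0 <= x -> gamma (beta x) = x by move=> x0; apply: bK; apply/mem_set/H0.
have IV (x y v : R) : 0 <= x -> x <= y -> (beta x <= v <= beta y) \/ (beta y <= v <= beta x) ->
    exists2 t, x <= t <= y & beta t = v.
  move=> x0 xy vxy; have [||t] := @IVT R beta x y v xy.
  - apply: continuous_subspaceW bc => t /=; rewrite !in_itv /= andbT => /andP[xt _].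
    exact: le_trans xt.
  - by case: vxy => /andP[h1 h2]; rewrite ge_min h1 le_max h2 ?orbT.
  by rewrite in_itv /= => ?; exists t.
apply/eqP; rewrite eq_le b0// andbT leNgt; apply/negP => y0.
pose x0 := gamma 0; pose x1 := gamma (beta 0 + 1).
have bx0 : beta x0 = 0 by rewrite bgK.
have bx1 : beta x1 = beta 0 + 1 by rewrite bgK// addr_ge0// ltW.
have x00 : 0 < x0.
  rewrite lt_neqAle g0// andbT; apply/eqP => E; move: bx0; rewrite -E => E2; move: y0; rewrite E2 ltxx//.
have x10 : 0 < x1.
  rewrite lt_neqAle g0 ?addr_ge0 ?ltW// andbT; apply/eqP => E; move: bx1; rewrite -E => E2; lra.
have [t [t0 tE]] : exists t, 0 < t /\ beta t = beta 0.
  have [le|/ltW le] := leP x0 x1.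
    have [|t /andP[tx _] tE] := IV x0 x1 (beta 0) (ltW x00) le.
      by left; rewrite bx0 bx1; apply/andP; split; lra.
    by exists t; split=> //; apply: lt_le_trans tx.
  have [|t /andP[tx _] tE] := IV x1 x0 (beta 0) (ltW x10) le.
    by right; rewrite bx0 bx1; apply/andP; split; lra.
  by exists t; split=> //; apply: lt_le_trans tx.
have := gbK t (ltW t0); rewrite tE gbK// => E.
by move: t0; rewrite -E ltxx.
Qed.

Lemma homeo_halfline_small (beta : R -> R) (e : R) : homeo_halfline beta -> 0 < e ->
  exists2 d : R, 0 < d & forall t, 0 < t < d -> beta t < e.
Proof.
move=> hb e0; have b0 := homeo_halfline0 hb.
have [gamma [_ _ _ /continuous_within_itvcyP[_ bc] _]] := hb.
move/cvgrPdist_lt : bc => /(_ e e0); rewrite b0 => /nbhs_ballP[d /= d0 H].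
exists d => // t /andP[t0 td]; have := H t.
rewrite /ball /= sub0r normrN gtr0_norm// => /(_ td t0).
rewrite sub0r normrN; apply: le_lt_trans; exact: ler_norm.
Qed.

End Contact.

(** * Two-dimensional sheets in the domain *)

Section Room.
Variable R : realType.

Lemma norm_delta_le1 n (i : 'I_n.+2) : `|delta_mx 0 i : 'rV[R]_n.+2| <= 1.
Proof.
rewrite [leLHS]/Num.Def.normr/= mx_normrE; apply/bigmax_leP; split=> // -[a b] _ /=.
by rewrite mxE; case: (_ && _); rewrite ?normr1 ?normr0.
Qed.

(** In dimension at least 2 some coordinate axis is transverse to B - A. Along a
    short vector nu of this axis, the values of phi near A and near B remain
    separated. *)
Lemma strip_exists n (p0 A B : 'rV[R]_n.+2) (rho K : R) (phi : 'rV[R]_n.+2 -> R) :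
  ball p0 rho A -> ball p0 rho B -> phi A < phi B ->
  (forall X Y, ball p0 rho X -> ball p0 rho Y -> `|phi X - phi Y| <= K * eucl_dist X Y) ->
  exists nu c0 c1, [/\ forall s, s *: (B - A) != nu,
     forall s t : R, 0 <= s <= 1 -> 0 <= t <= 1 -> ball p0 rho (A + s *: (B - A) + t *: nu),
     c0 < c1, forall t : R, 0 <= t <= 1 -> phi (A + t *: nu) <= c0
     & forall t : R, 0 <= t <= 1 -> c1 <= phi (B + t *: nu)].
Proof.
move=> bA bB AB phiK.
have AB0 : B - A != 0 by rewrite subr_eq0; apply: contraTneq AB => ->; rewrite ltxx.
have [i1 Hi1] : exists i1 : 'I_n.+2, forall e s : R, e != 0 -> s *: (B - A) != e *: delta_mx 0 i1.
  have [i0 wi0] : exists i0, (B - A) 0 i0 != 0.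
    by apply/existsP; rewrite -negb_forall; apply: contra AB0 => /forallP H; apply/eqP/rowP => i;
       rewrite [RHS]mxE; apply/eqP; exact: H.
  have [i1 i10] : exists i1, i1 != i0.
    by have [->|] := eqVneq i0 0; [exists 1|exists 0; rewrite eq_sym].
  exists i1 => e s e0; apply/negP => /eqP E.
  have := congr1 (fun M : 'rV[R]_n.+2 => M 0 i0) E; rewrite mxE [RHS]mxE [in RHS]mxE eqxx /=.
  rewrite eq_sym (negbTE i10) mulr0 => /eqP; rewrite mulf_eq0 (negbTE wi0) orbF => /eqP s0.
  have := congr1 (fun M : 'rV[R]_n.+2 => M 0 i1) E; rewrite s0 scale0r !mxE !eqxx mulr1.
  by move=> e00; rewrite -e00 eqxx in e0.
pose d := phi B - phi A; have d0 : 0 < d by rewrite subr_gt0.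
have K1 : 0 < `|K| + 1 by rewrite ltr_wpDl.
move: bA bB; rewrite -!ball_normE /ball_ /= => bA bB.
pose m := rho - Num.max `|p0 - A| `|p0 - B|.
have m0 : 0 < m by rewrite subr_gt0 gt_max bA bB.
pose e := Num.min (m / 2) (d / (3 * (`|K| + 1))).
have e0 : 0 < e by rewrite lt_min !divr_gt0// mulr_gt0.
have em : e < m by rewrite gt_min ltr_pdivrMr// mulr_natr mulr2n ltrDl m0.
have eK : (`|K| + 1) * e <= d / 3.
  have : e <= d / (3 * (`|K| + 1)) by rewrite ge_min lexx orbT.
  rewrite ler_pdivlMr ?mulr_gt0//; lra.
pose nu : 'rV[R]_n.+2 := e *: delta_mx 0 i1.
have dnorm := norm_delta_le1 i1.
have nunorm t : 0 <= t <= 1 -> `|t *: nu| <= e.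
  move=> /andP[t0 t1]; rewrite !normrZ (ger0_norm t0) (gtr0_norm e0).
  rewrite -[leRHS]mul1r ler_pM ?mulr_ge0 ?(ltW e0)//.
  by rewrite -[leRHS]mulr1 ler_wpM2l ?(ltW e0).
have inball s t : 0 <= s <= 1 -> 0 <= t <= 1 -> `|p0 - (A + s *: (B - A) + t *: nu)| < rho.
  move=> /andP[s0 s1] t01.
  have -> : p0 - (A + s *: (B - A) + t *: nu) = (1 - s) *: (p0 - A) + s *: (p0 - B) - t *: nu.
    by apply/rowP => i; rewrite !mxE; ring.
  apply: le_lt_trans (ler_normB _ _) _; have := nunorm t t01.
  have := ler_normD ((1 - s) *: (p0 - A)) (s *: (p0 - B)).
  rewrite !normrZ (ger0_norm s0) (ger0_norm (x := 1 - s)) ?subr_ge0//.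
  have : (1 - s) * `|p0 - A| <= (1 - s) * Num.max `|p0 - A| `|p0 - B|.
    by rewrite ler_wpM2l ?subr_ge0// le_max lexx.
  have : s * `|p0 - B| <= s * Num.max `|p0 - A| `|p0 - B|.
    by rewrite ler_wpM2l// le_max lexx orbT.
  move: em; rewrite /m; lra.
have edist (X : 'rV[R]_n.+2) t : 0 <= t <= 1 -> eucl_dist (X + t *: nu) X <= e.
  move=> /andP[t0 t1]; rewrite /eucl_dist (addrC X) addrK.
  apply: le_trans (eucl_le_sum _) _; rewrite (bigD1 i1)//= big1 => [|i ii1]; last first.
    by rewrite !mxE eqxx (negbTE ii1) !mulr0 normr0.
  rewrite !mxE !eqxx mulr1 addr0 ger0_norm ?mulr_ge0 ?(ltW e0)//.
  by rewrite ler_piMl// ltW.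
have near X t : ball p0 rho X -> ball p0 rho (X + t *: nu) -> 0 <= t <= 1 ->
    `|phi (X + t *: nu) - phi X| <= d / 3.
  move=> bX bXt t01; apply: le_trans (phiK _ _ bXt bX) (le_trans _ eK).
  apply: (@le_trans _ _ ((`|K| + 1) * eucl_dist (X + t *: nu) X)).
    by rewrite ler_wpM2r ?eucl_norm_ge0// (le_trans (ler_norm _))// lerDl.
  by rewrite ler_wpM2l ?(ltW K1)// edist.
have z01 : 0 <= (0 : R) <= 1 by rewrite lexx ler01.
have o01 : 0 <= (1 : R) <= 1 by rewrite lexx ler01.
exists nu, (phi A + d / 3), (phi B - d / 3); split.
- by move=> s; apply: Hi1; rewrite gt_eqF.
- exact: inball.
- rewrite /d; lra.
- move=> t t01; have := near A t; rewrite -ball_normE => /(_ bA) H.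
  have := inball 0 t z01 t01; rewrite scale0r addr0 => /H/(_ t01).
  by rewrite ler_norml => /andP[_]; lra.
- move=> t t01; have := near B t; rewrite -ball_normE => /(_ bB) H.
  have := inball 1 t o01 t01; rewrite scale1r (addrC A) subrK => /H/(_ t01).
  by rewrite ler_norml => /andP[h _]; lra.
Qed.

End Room.

Section Final.
Variables (R : realType) (k n : nat) (c : coord_kind) (alpha L rho : R).
Variables (f : 'rV[R]_n.+2 -> 'rV[R]_k.+2) (p0 : 'rV[R]_n.+2) (beta : R -> R).
Hypotheses (k0 : (0 < k)%N) (rho0 : 0 < rho) (alphaP : 2^-1 <= alpha).
Hypothesis hbeta : homeo_halfline beta.
Hypothesis fholder : forall X Y, ball p0 rho X -> ball p0 rho Y ->
  (d_cc c (f X) (f Y) <= (eucl_dist X Y `^ alpha * beta (eucl_dist X Y))%:E)%E.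
Hypothesis fL : forall X Y, ball p0 rho X -> ball p0 rho Y ->
  eucl_dist (f X) (f Y) <= L * eucl_dist X Y.
Local Notation V := 'rV[R]_n.+2.
Let phi j (X : V) := scoord c j (f X).

Lemma ball_eucl (X : V) : ball p0 rho X -> eucl_dist X p0 <= n.+2%:R * rho.
Proof.
rewrite -ball_normE /ball_ /= => bX.
apply: le_trans (eucl_le_sum _) _; rewrite mulr_natl -[X in _ *+ X]card_ord -sumr_const.
apply: ler_sum => i _; apply: le_trans (ltW bX).
rewrite -[X - p0]opprB mxE normrN [leRHS]/Num.Def.normr/= mx_normrE.
by apply: le_trans; last exact: (le_bigmax _ _ (0, i)).
Qed.

Lemma f_bounded : exists M : R, forall X, ball p0 rho X -> forall i, `|f X 0 i| <= M.
Proof.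
exists (\sum_i `|f p0 0 i| + `|L| * (n.+2%:R * rho)) => X bX i.
have bp : ball p0 rho p0 by exact: ballxx.
have := fL bX bp; have := eucl_dist_coord (f X) (f p0) i.
have : L * eucl_dist X p0 <= `|L| * (n.+2%:R * rho).
  apply: (@le_trans _ _ (`|L| * eucl_dist X p0)).
    by rewrite ler_wpM2r ?eucl_norm_ge0// ler_norm.
  by rewrite ler_wpM2l// ball_eucl.
have : `|f p0 0 i| <= \sum_i `|f p0 0 i|.
  by rewrite (bigD1 i)//= lerDl sumr_ge0.
have := ler_normD (f X 0 i - f p0 0 i) (f p0 0 i); rewrite subrK.
lra.
Qed.

Lemma phi_lipschitz : exists B K : R, [/\ 0 <= B, 0 <= K,
  forall j X, (j <= k.+1)%N -> ball p0 rho X -> `|phi j X| <= B &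
  forall j X Y, (j <= k.+1)%N -> ball p0 rho X -> ball p0 rho Y ->
    `|phi j X - phi j Y| <= K * eucl_dist X Y].
Proof.
have [M fM] := f_bounded.
have /choice[BK H] : forall j, exists BK : R * R, [/\ 0 <= BK.1, 0 <= BK.2,
    forall X, ball p0 rho X -> `|phi j X| <= BK.1 &
    forall X Y, ball p0 rho X -> ball p0 rho Y -> `|phi j X - phi j Y| <= BK.2 * eucl_dist X Y].
  move=> j; have [_ /(_ M)[B [K [B0 K0 HB HK]]]] := @regular_scoord R k c j.
  exists (B, K * `|L|); split => //=; first by rewrite mulr_ge0.
    by move=> X bX; apply: HB; apply: fM.
  move=> X Y bX bY; apply: le_trans (HK _ _ (fM X bX) (fM Y bY)) _.
  rewrite -mulrA ler_wpM2l//; apply: le_trans (fL bX bY) _.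
  by rewrite ler_wpM2r ?eucl_norm_ge0// ler_norm.
exists (\sum_(j < k.+2) (BK j).1), (\sum_(j < k.+2) (BK j).2); split.
- by apply: sumr_ge0 => j _; case: (H j).
- by apply: sumr_ge0 => j _; case: (H j).
- move=> j X jk bX; have [_ _ /(_ X bX) Hj _] := H j; apply: le_trans Hj _.
  rewrite (bigD1 (Ordinal (jk : (j < k.+2)%N)))//= lerDl sumr_ge0// => i _; by case: (H i).
move=> j X Y jk bX bY; have [_ _ _ /(_ X Y bX bY) Hj] := H j; apply: le_trans Hj _.
rewrite ler_wpM2r ?eucl_norm_ge0//.
rewrite (bigD1 (Ordinal (jk : (j < k.+2)%N)))//= lerDl sumr_ge0// => i _; by case: (H i).
Qed.

Lemma eucl_dist_eq0 m (X Y : 'rV[R]_m) : eucl_dist X Y = 0 -> X = Y.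
Proof.
move=> XY; apply/rowP => i; apply/eqP; rewrite -subr_eq0 -normr_le0 -XY.
exact: eucl_dist_coord.
Qed.

(** Since alpha >= 1/2, the distance of f X and f Y is at most sqrt t times
    something arbitrarily small, where t is the Euclidean distance of X and Y;
    the bound in [dcc_contact] is the square of this. *)
Lemma phi_contact e : 0 < e -> exists2 r : R, 0 < r & forall X Y,
  ball p0 rho X -> ball p0 rho Y -> eucl_dist X Y < r -> forall j, (0 < j <= k)%N ->
  `|phi j.+1 Y - phi j.+1 X - phi j X * (phi 0 Y - phi 0 X)| <= e * eucl_dist X Y.
Proof.
move=> e0; have [B [K [B0 K0 phiB phiK]]] := phi_lipschitz.
pose C := 1 + k%:R * B.
have C0 : 0 < C by rewrite ltr_pwDl// mulr_ge0.
pose eta := Num.min 1 (e / C).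
have eta0 : 0 < eta by rewrite lt_min ltr01 divr_gt0.
have eta1 : eta <= 1 by rewrite ge_min lexx.
have Ceta : C * eta ^+ 2 <= e.
  have h1 : C * eta <= e.
    have : eta <= e / C by rewrite ge_min lexx orbT.
    by rewrite ler_pdivlMr// mulrC.
  apply: le_trans h1; rewrite expr2 mulrA ler_piMr// mulr_ge0// ltW//.
have [d d0 Hd] := homeo_halfline_small hbeta eta0.
exists (Num.min 1 d); first by rewrite lt_min ltr01.
move=> X Y bX bY; rewrite lt_min => /andP[XY1 XYd] j jk.
have [XY0|XY0] := eqVneq (eucl_dist X Y) 0.
  by rewrite (eucl_dist_eq0 XY0) !subrr mulr0 subrr normr0 mulr_ge0 ?eucl_norm_ge0// ltW.
set D := eucl_dist X Y in XY1 XYd XY0 *.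
have D0 : 0 < D by rewrite lt_neqAle eq_sym XY0 eucl_norm_ge0.
have sD : 0 < Num.sqrt D by rewrite sqrtr_gt0.
have r01 : 0 < Num.sqrt D * eta <= 1.
  rewrite mulr_gt0//= mulr_ile1 ?(ltW sD) ?(ltW eta0)//.
  by rewrite -[X in _ <= X]sqrtr1 ler_wsqrtr// ltW.
have dcc : (d_cc c (f X) (f Y) < (Num.sqrt D * eta)%:E)%E.
  apply: le_lt_trans (fholder bX bY) _; rewrite lte_fin -/D.
  have bD : beta D < eta by apply: Hd; rewrite D0.
  have pD : D `^ alpha <= Num.sqrt D.
    by rewrite -powR12_sqrt ?(ltW D0)// ger_powR// D0 ltW.
  have [bneg|bpos] := leP (beta D) 0.
    apply: (@le_lt_trans _ _ 0); first by rewrite mulr_ge0_le0// powR_ge0.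
    by rewrite mulr_gt0.
  apply: (@le_lt_trans _ _ (Num.sqrt D * beta D)); first by rewrite ler_wpM2r// ltW.
  by rewrite ltr_pM2l.
have := dcc_contact k0 dcc r01 B0 (fun j jk => phiB j X jk bX) jk.
move/le_trans; apply; rewrite exprMn sqr_sqrtr ?(ltW D0)//.
by rewrite mulrCA mulrC ler_wpM2r// ltW.
Qed.

Section Sheet.
Variables A w nu : V.
Hypothesis inball : forall s t : R, 0 <= s <= 1 -> 0 <= t <= 1 -> ball p0 rho (A + s *: w + t *: nu).

(** The parameters are clamped to the unit square, and the index below is cut
    off at k + 1, so that the Lipschitz bounds hold everywhere. *)
Definition sheet (s t : R) : V := A + clamp 0 1 s *: w + clamp 0 1 t *: nu.
Definition sheet_coord (j : nat) (s t : R) := phi (minn j k.+1) (sheet s t).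

Lemma sheet_ball s t : ball p0 rho (sheet s t).
Proof. by apply: inball; apply: clamp_itv; rewrite ler01. Qed.

Lemma sheet_dist : exists2 D : R, 0 <= D & forall s t s' t',
  eucl_dist (sheet s t) (sheet s' t') <= D * (`|s - s'| + `|t - t'|).
Proof.
exists (\sum_i (`|w 0 i| + `|nu 0 i|)); first by apply: sumr_ge0 => i _; rewrite addr_ge0.
move=> s t s' t'; apply: le_trans (eucl_le_sum _) _; rewrite mulr_suml; apply: ler_sum => i _.
have -> : (sheet s t - sheet s' t') 0 i =
  (clamp 0 1 s - clamp 0 1 s') * w 0 i + (clamp 0 1 t - clamp 0 1 t') * nu 0 i.
  by rewrite !mxE; ring.
apply: le_trans (ler_normD _ _) _; rewrite !normrM.
have le01 : (0 : R) <= 1 by exact: ler01.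
have hs := clamp_lip s s' le01; have ht := clamp_lip t t' le01.
have : `|clamp 0 1 s - clamp 0 1 s'| * `|w 0 i| <= `|s - s'| * `|w 0 i| by rewrite ler_wpM2r.
have : `|clamp 0 1 t - clamp 0 1 t'| * `|nu 0 i| <= `|t - t'| * `|nu 0 i| by rewrite ler_wpM2r.
have : 0 <= `|s - s'| * `|nu 0 i| by rewrite mulr_ge0.
have : 0 <= `|t - t'| * `|w 0 i| by rewrite mulr_ge0.
lra.
Qed.

Lemma sheet_lipschitz : exists2 K : R, 0 <= K & forall j, lipschitz2 K (sheet_coord j).
Proof.
have [B [K [_ K0 _ phiK]]] := phi_lipschitz; have [D D0 DP] := sheet_dist.
exists (K * D); first by rewrite mulr_ge0.
move=> j s t s' t'; apply: le_trans (phiK _ _ _ _ (sheet_ball _ _) (sheet_ball _ _)) _; first exact: geq_minr.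
by rewrite -mulrA ler_wpM2l.
Qed.

Lemma sheet_primitive j : (0 < j <= k)%N ->
  primitive_of (sheet_coord 0) (sheet_coord j) (sheet_coord j.+1).
Proof.
move=> jk e e0; have [D D0 DP] := sheet_dist.
have D1 : 0 < D + 1 by lra.
have e'0 : 0 < e / (D + 1) by rewrite divr_gt0.
have [r r0 Hr] := phi_contact e'0.
exists (r / (D + 1)); first by rewrite divr_gt0.
move=> s t s' t'; rewrite ltr_pdivlMr// => st.
have dist : eucl_dist (sheet s t) (sheet s' t') <= (`|s' - s| + `|t' - t|) * (D + 1).
  apply: le_trans (DP _ _ _ _) _; rewrite (distrC s) (distrC t) mulrC ler_wpM2l ?addr_ge0//; lra.
have := Hr _ _ (sheet_ball s t) (sheet_ball s' t') (le_lt_trans dist st) j jk.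
have /andP[j0 jk'] := jk.
rewrite /sheet_coord min0n (minn_idPl (leqW jk')) (minn_idPl (jk' : (j.+1 <= k.+1)%N)).
move/le_trans; apply; apply: (@le_trans _ _ (e / (D + 1) * ((`|s' - s| + `|t' - t|) * (D + 1)))).
  by rewrite ler_wpM2l// ltW.
by rewrite mulrCA divfK ?gt_eqF// mulrC.
Qed.

End Sheet.

Hypothesis finj : forall X Y, ball p0 rho X -> ball p0 rho Y -> f X = f Y -> X = Y.

Lemma phi_inj X Y : ball p0 rho X -> ball p0 rho Y ->
  (forall j, (j <= k.+1)%N -> phi j X = phi j Y) -> X = Y.
Proof.
move=> bX bY XY; apply: finj => //; apply: (@second_coord_inj _ _ c) => j.
by have := XY j; rewrite /phi /scoord inord_val -ltnS; apply.
Qed.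

Lemma sheet_not_collapsed A w nu s s' :
  (forall s t : R, 0 <= s <= 1 -> 0 <= t <= 1 -> ball p0 rho (A + s *: w + t *: nu)) ->
  (forall s : R, s *: w != nu) -> 0 <= s <= 1 -> 0 <= s' <= 1 ->
  ~ (forall j, (j <= k.+1)%N -> sheet_coord A w nu j s 0 = sheet_coord A w nu j s' 1).
Proof.
move=> inb wnu s01 s'01 col.
have z01 : 0 <= (0 : R) <= 1 by rewrite lexx ler01.
have o01 : 0 <= (1 : R) <= 1 by rewrite lexx ler01.
have := phi_inj (sheet_ball inb s 0) (sheet_ball inb s' 1) => H.
have {}H : sheet A w nu s 0 = sheet A w nu s' 1.
  by apply: H => j jk; have := col j jk; rewrite /sheet_coord (minn_idPl jk).
have := wnu (s - s'); apply/negP/negPn; rewrite scalerBl subr_eq.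
move: H; rewrite /sheet !clamp_id// scale0r scale1r addr0 -addrA => /addrI ->.
by rewrite addrC.
Qed.

(** If phi 0 took two values on the ball, it would separate the sides of a strip
    which collapses. So phi 0 is constant. The same argument then shows that
    phi 1 is constant, and the remaining coordinates are constant as successive
    primitives: f is constant on the ball. *)
Lemma no_embedding : False.
Proof.
have z01 : 0 <= (0 : R) <= 1 by rewrite lexx ler01.
have o01 : 0 <= (1 : R) <= 1 by rewrite lexx ler01.
have bp : ball p0 rho p0 by exact: ballxx.
have [B0 [K [_ K0 _ phiK]]] := phi_lipschitz.
have strip j : (j <= 1)%N -> (j = 1%N -> forall X Y, ball p0 rho X -> ball p0 rho Y -> phi 0 X = phi 0 Y) ->
    forall A B, ball p0 rho A -> ball p0 rho B -> phi j A < phi j B -> False.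
  move=> j1 jc A B bA bB AB.
  have jk1 : (j <= k.+1)%N by apply: leq_trans j1 _.
  have [nu [c0 [c1 [tr inb c01 left right]]]] :=
    strip_exists bA bB AB (fun X Y => phiK j X Y jk1).
  have [L' L'0 wL] := sheet_lipschitz inb.
  have wP := sheet_primitive inb.
  have edge0 t : 0 <= t <= 1 -> sheet_coord A (B - A) nu j 0 t <= c0.
    move=> t01; rewrite /sheet_coord (minn_idPl jk1) /sheet !clamp_id// scale0r addr0.
    exact: left.
  have edge1 t : 0 <= t <= 1 -> c1 <= sheet_coord A (B - A) nu j 1 t.
    move=> t01; rewrite /sheet_coord (minn_idPl jk1) /sheet !clamp_id// scale1r (addrC A) subrK.
    exact: right.
  have [s [s' [s01 s'01 col]]] : exists s s' : R, [/\ 0 <= s <= 1, 0 <= s' <= 1 &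
      forall j, (j <= k.+1)%N -> sheet_coord A (B - A) nu j s 0 = sheet_coord A (B - A) nu j s' 1].
    case: j j1 jk1 jc AB left right edge0 edge1 => [|[|//]] j1 jk1 jc AB left right edge0 edge1.
      exact: (strip_collapse k0 L'0 wL wP c01 edge0 edge1).
    apply: (strip_collapse_cst _ (wL 1%N) wP c01 edge0 edge1) => s t s' t'.
    by apply: jc => //; exact: sheet_ball.
  exact: sheet_not_collapsed inb tr s01 s'01 col.
have phi0 X Y : ball p0 rho X -> ball p0 rho Y -> phi 0 X = phi 0 Y.
  move=> bX bY; have [lt|lt|//] := ltgtP (phi 0 X) (phi 0 Y).
    by exfalso; apply: (strip 0%N _ _ X Y).
  by exfalso; apply: (strip 0%N _ _ Y X).
have phi1 X Y : ball p0 rho X -> ball p0 rho Y -> phi 1 X = phi 1 Y.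
  move=> bX bY; have [lt|lt|//] := ltgtP (phi 1 X) (phi 1 Y).
    by exfalso; apply: (strip 1%N _ _ X Y).
  by exfalso; apply: (strip 1%N _ _ Y X).
have [h h0 hrho] : exists2 h : R, 0 < h & h < rho.
  by exists (rho / 2); have := rho0; lra.
pose w : V := h *: delta_mx 0 0.
have inb (s t : R) : 0 <= s <= 1 -> 0 <= t <= 1 -> ball p0 rho (p0 + s *: w + t *: 0).
  move=> /andP[s0 s1] _; rewrite scaler0 addr0 -ball_normE /ball_ /= opprD addrA subrr add0r normrN.
  rewrite !normrZ (ger0_norm s0) (gtr0_norm h0).
  apply: le_lt_trans hrho; rewrite mulrCA ler_piMr ?(ltW h0)// mulr_ile1//.
  exact: norm_delta_le1.
have wP := sheet_primitive inb.
have E : p0 = p0 + w.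
  apply: phi_inj => //.
    by have := inb 1 0 o01 z01; rewrite scale1r scaler0 addr0.
  move=> j jk; have -> : phi j p0 = sheet_coord p0 w 0 j 0 0.
    by rewrite /sheet_coord (minn_idPl jk) /sheet !clamp_id// !scale0r !addr0.
  have -> : phi j (p0 + w) = sheet_coord p0 w 0 j 1 0.
    by rewrite /sheet_coord (minn_idPl jk) /sheet !clamp_id// !scale1r scaler0 addr0.
  case: j jk => [|[|j]] jk.
  - by apply: phi0; exact: sheet_ball.
  - by rewrite /sheet_coord (minn_idPl jk); apply: phi1; exact: sheet_ball.
  apply: (primitive_of_cst _ (wP j.+1 jk)) => s t s' t'.
  by apply: phi0; exact: sheet_ball.
have := congr1 (fun M : V => M 0 0) E; rewrite !mxE !eqxx mulr1.
lra.
Qed.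

End Final.

Theorem theorem1p5 (R : realType) (alpha : R) (n k : nat)
    (Omega : set 'rV[R]_n) (c : coord_kind) :
  2^-1 <= alpha -> (1 < n)%N -> (0 < k)%N ->
  open Omega -> Omega !=set0 ->
  ~ exists f : 'rV[R]_n -> 'rV[R]_k.+2,
      [/\ holder_plus (@eucl_dist R n) (@d_cc R k c) alpha Omega f,
          {in Omega &, injective f}
        & locally_lipschitz Omega f].
Proof.
case: n Omega => [|[|n]] Omega alphaP // _ k0 oO [p0 Op0] [f [[beta hbeta fh] finj fL]].
have [U nU [L UL]] := fL p0 Op0.
have /nbhs_ballP[rho /= rho0 ball_sub] : nbhs p0 (Omega `&` U).
  by apply: filterI => //; exact: open_nbhs_nbhs.
apply: (@no_embedding R k n c alpha L rho f p0 beta) => // X Y bX bY.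
- by apply: fh; [case: (ball_sub _ bX)|case: (ball_sub _ bY)].
- by have [? ?] := ball_sub _ bX; have [? ?] := ball_sub _ bY; exact: UL.
- by apply: finj; apply/mem_set; [case: (ball_sub _ bX)|case: (ball_sub _ bY)].
Qed.
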